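(* Let $x\in S_\infty$ be an irregular point such that, for every critical point $c$ of $f:S_0\to S_0$, the signature $sign(x,c)$ has a maximal element. Then there exists an open neighborhood $U$ of $x$ such that for any open neighborhood $V\subset U$ of $x$ and for any point $v\in V$, $v\neq x$, the open set $V-\{v\}$ is path-connected.
   Context: Let $S_0$ be a simply connected Riemann surface (the unit disk, the complex plane, or the Riemann sphere) and $f:S_0\to S_0$ a holomorphic branched covering of degree $d$, $1<d<\infty$. For $i=1,2,\dots$ put $S_i=S_0$ and regard $f$ as a map $S_{i+1}\to S_i$ for every $i$; critical points of $f$ are regarded as points of every $S_i$. The plaque inverse limit $S_\infty$ is the set of all sequences $x=(x_1,x_2,\dots)$ with $x_i\in S_i$ and $f(x_{i+1})=x_i$ for all $i$. Open sets of $S_\infty$ are described by sequences $U=(U_1,U_2,\dots)$ of open sets $U_i\subset S_i$ with $f(U_{i+1})=U_i$; $U_i$ is called the $i$-th level of $U$. A local basis of the topology at $x$ is given by the pull-backs along $x$ of open neighborhoods $U_1$ of $x_1$, i.e. $U_{i+1}$ is the connected component of $f^{-1}(U_i)$ containing $x_{i+1}$. An open set $U$ is a plaque if each $U_i$ is conformally equivalent to the unit disk and $f:U_{i+1}\to U_i$ is conformally equivalent to a self-map $z\mapsto z^t$ of the unit disk with $t\le d$. Convention: every open neighborhood of a point of $S_\infty$ is assumed to be a plaque, and every open neighborhood of a point in a Riemann surface is assumed to be simply connected. A point $x\in S_\infty$ is regular if for some neighborhood $U$ of $x$ there is $n$ such that $U_{m}$ contains no critical points of $f$ for all $m>n$;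 otherwise $x$ is irregular. Let $I$ be the Boolean algebra of binary sequences modulo the relation of differing in only finitely many places, with coordinatewise operations and order $b\le a\iff a\vee b=a$. For $a\in I$ let $\alpha(a)=\{b\in I: b\le a\}$. For an open neighborhood $U\subset S_\infty$ and a critical point $c$, $ind(U,c)\in I$ is the class of the binary sequence whose $n$-th entry is $1$ if and only if $c\in U_n$. The signature is $sign(x,c)=\bigcap_{j=1}^\infty \alpha(ind(U(j),c))\subset I$, where $U(1)\supset U(2)\supset\cdots$ is any sequence of open neighborhoods of $x$ forming a local base at $x$ (the result does not depend on this choice). The signature $sign(x,c)$ has a maximal element if $sign(x,c)=\alpha(a)$ for some $a\in I$. *)

(* Defs.v *)
From HB Require Import structures.
From mathcomp Require Import all_boot all_order all_algebra generic_quotient.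
From mathcomp Require Import all_classical all_reals all_analysis.
From mathcomp Require Import complex.

Set Implicit Arguments.
Unset Strict Implicit.
Unset Printing Implicit Defensive.

Import Order.TTheory GRing.Theory Num.Theory.
Import numFieldNormedType.Exports.

Local Open Scope classical_set_scope.
Local Open Scope ring_scope.
Local Open Scope quotient_scope.

(* R[i] gets its normed-space topology through the alias _^o. *)
Notation cplx R := ((R[i])^o).

Definition sphere (R : realType) : Type := one_point_compactification (cplx R).
HB.instance Definition _ (R : realType) := Topological.on (sphere R).

Section RiemannSurfaces.
Variable R : realType.
Implicit Types (p : sphere R) (D U W : set (sphere R)).
Implicit Types (f phi psi : sphere R -> sphere R).

Definition unit_disk : set (sphere R) :=
  Some @` [set z : cplx R | `|z| < 1].
Definition complex_plane : set (sphere R) := Some @` setT.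

(* The simply connected Riemann surfaces up to conformal equivalence, all
   realized as open subsets of the sphere. *)
Definition simply_connected_model (S : set (sphere R)) : Prop :=
  [\/ S = unit_disk, S = complex_plane | S = setT].

(* The chart around p is z on the plane and 1/z when p is the point at
   infinity; [unchart p] is its inverse. *)
Definition chart p (q : sphere R) : cplx R :=
  match p, q with
  | Some _, Some z => z
  | None, Some z => z^-1
  | _, None => 0
  end.

Definition unchart p (w : cplx R) : sphere R :=
  match p with
  | Some _ => Some w
  | None => if w == 0 then None else Some w^-1
  end.

Definition local_rep f p : cplx R -> cplx R := chart (f p) \o f \o unchart p.

(* Meant for open D, so the values of f outside D are irrelevant. *)
Definition holomorphic_on D f : Prop :=
  forall p, D p ->
    {for p, continuous f} /\
    derivable (local_rep f p) (chart p p) 1.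

Definition critical_point (S : set (sphere R)) f (c : sphere R) : Prop :=
  S c /\ 'D_1 (local_rep f c) (chart c c) = 0.

Definition conformal_iso U W phi : Prop :=
  holomorphic_on U phi /\
  exists psi, [/\ holomorphic_on W psi,
    forall z, U z -> W (phi z) /\ psi (phi z) = z
    & forall w, W w -> U (psi w) /\ phi (psi w) = w].

Definition conformal_to_disk U : Prop :=
  exists phi, conformal_iso U unit_disk phi.

Definition power_map (t : nat) : sphere R -> sphere R :=
  omap (fun z : cplx R => z ^+ t).

Definition conformal_to_power (t : nat) f U W : Prop :=
  (forall z, U z -> W (f z)) /\
  exists phi psi, [/\ conformal_iso U unit_disk phi,
    conformal_iso W unit_disk psi
    & forall z, U z -> psi (f z) = power_map t (phi z)].

Definition branched_covering (S : set (sphere R)) (d : nat) f : Prop :=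
  [/\ forall z, S z -> S (f z),
      holomorphic_on S f
    & forall y, S y -> exists W, [/\ open W, W y, W `<=` S &
        exists (k : nat) (V : 'I_k -> set (sphere R)) (t : 'I_k -> nat),
        [/\ forall j, open (V j) /\ (0 < t j)%N /\
              conformal_to_power (t j) f (V j) W,
            trivIset setT V,
            S `&` f @^-1` W = \bigcup_j V j
          & (\sum_(j < k) t j)%N = d]]].

End RiemannSurfaces.

(* All sequences are indexed from 0: index i stands for level S_{i+1}. *)
Definition plaque_inverse_limit (R : realType) (S : set (sphere R))
    (f : sphere R -> sphere R) : Type :=
  {x : nat -> sphere R | forall i, S (x i) /\ f (x i.+1) = x i}.

Section PlaqueInverseLimit.
Variables (R : realType) (S : set (sphere R)) (f : sphere R -> sphere R).
Local Notation pil := (plaque_inverse_limit S f).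

Definition coord (x : pil) (i : nat) : sphere R := sval x i.

(* The subset of the inverse limit described by its levels. *)
Definition levels (U : nat -> set (sphere R)) : set pil :=
  [set y | forall i, U i (coord y i)].

Fixpoint pullback (x : pil) (U1 : set (sphere R)) (i : nat) : set (sphere R) :=
  if i is j.+1 then
    connected_component (S `&` f @^-1` (pullback x U1 j)) (coord x i)
  else U1.

Definition pil_open (A : set pil) : Prop :=
  forall x, A x -> exists U1 : set (sphere R),
    [/\ open U1, U1 (coord x 0) & levels (pullback x U1) `<=` A].

Lemma pullback_sub (x : pil) (U V : set (sphere R)) (i : nat) :
  U `<=` V -> pullback x U i `<=` pullback x V i.
Proof.
move=> UV; elim: i => [//|i IH] /= y [B [Bx BU cB] By]; exists B => //.
by split=> // z /BU [Sz /IH].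
Qed.

Lemma pil_openT : pil_open setT.
Proof. by move=> x _; exists setT; split=> //; exact: openT. Qed.

Lemma pil_openI : setI_closed pil_open.
Proof.
move=> A B oA oB x [/oA[U [oU Ux UA]] /oB[V [oV Vx VB]]].
exists (U `&` V); split; [exact: openI|by []|move=> y Hy; split].
- by apply: UA => i; apply: (pullback_sub (V := U)) (Hy i) => z [].
- by apply: VB => i; apply: (pullback_sub (V := V)) (Hy i) => z [].
Qed.

Lemma pil_open_bigU (I : Type) (F : I -> set pil) :
  (forall i, pil_open (F i)) -> pil_open (\bigcup_i F i).
Proof.
move=> oF x [i _ /oF[U [oU Ux UF]]]; exists U; split=> // y /UF Fy.
by exists i.
Qed.

HB.instance Definition _ := gen_eqMixin pil.
HB.instance Definition _ := gen_choiceMixin pil.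
HB.instance Definition _ :=
  @isOpenTopological.Build pil pil_open pil_openT pil_openI pil_open_bigU.

(* The condition on f forces each U i.+1 to be a component of f^-1 (U i), so
   that [levels U] is open. *)
Definition plaque (d : nat) (U : nat -> set (sphere R)) : Prop :=
  forall i, [/\ open (U i), U i `<=` S, f @` (U i.+1) = U i,
    conformal_to_disk (U i)
    & exists2 t, (0 < t <= d)%N & conformal_to_power t f (U i.+1) (U i)].

(* Open neighborhoods are plaques by convention. *)
Definition open_neighborhood (d : nat) (x : pil) (U : nat -> set (sphere R)) :=
  plaque d U /\ levels U x.

Definition regular_point (d : nat) (x : pil) : Prop :=
  exists2 U, open_neighborhood d x U &
    exists n, forall m c, (n < m)%N -> critical_point S f c -> ~ U m c.

Definition irregular_point (d : nat) (x : pil) : Prop := ~ regular_point d x.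

(* [B j i] is the i-th level of the j-th neighborhood. *)
Definition decreasing_local_base (d : nat) (x : pil)
    (B : nat -> nat -> set (sphere R)) : Prop :=
  [/\ forall j, open_neighborhood d x (B j),
      forall j, levels (B j.+1) `<=` levels (B j)
    & forall A : set pil, nbhs x A -> exists j, levels (B j) `<=` A].

End PlaqueInverseLimit.

Section BinarySequences.
Implicit Types s t : nat -> bool.

Definition almost_eq s t : bool := `[< finite_set [set n | s n <> t n] >].

Lemma almost_eq_refl : reflexive almost_eq.
Proof.
move=> s; apply/asboolP; suff -> : [set n | s n <> s n] = set0 by [].
by apply/seteqP; split=> n /=.
Qed.

Lemma almost_eq_sym : symmetric almost_eq.
Proof.
by move=> s t; apply/asboolP/asboolP; apply: sub_finite_set => n /= + /esym.
Qed.

Lemma almost_eq_trans : transitive almost_eq.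
Proof.
move=> t s u /asboolP st /asboolP tu; apply/asboolP.
have : finite_set ([set n | s n <> t n] `|` [set n | t n <> u n]).
  by rewrite finite_setU.
apply: sub_finite_set => n /= su.
by case: (pselect (s n = t n)) => [<-|]; [right|left].
Qed.

Canonical almost_eq_equiv :=
  EquivRel almost_eq almost_eq_refl almost_eq_sym almost_eq_trans.

(* The Boolean algebra I, of which only the join is needed; it is computed on
   representatives, and [germ_joinE] shows it is the coordinatewise one. *)
Definition germ : Type := {eq_quot almost_eq}.

Definition germ_of s : germ := \pi_germ s.

Definition germ_join (a b : germ) : germ :=
  germ_of (fun n => repr a n || repr b n).

Lemma germ_joinE s t :
  germ_join (germ_of s) (germ_of t) = germ_of (fun n => s n || t n).
Proof.
have rep u : finite_set [set n | repr (germ_of u) n <> u n].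
  apply/asboolP; change (almost_eq (repr (germ_of u)) u).
  by apply/eqquotP; exact: (reprK (germ_of u)).
apply/eqquotP/asboolP.
have : finite_set ([set n | repr (germ_of s) n <> s n] `|`
                   [set n | repr (germ_of t) n <> t n]).
  by rewrite finite_setU.
apply: sub_finite_set => n /= H.
case: (pselect (repr (germ_of s) n = s n)) => [E|]; last by left.
by right=> E'; apply: H; rewrite E E'.
Qed.

Definition germ_le (b a : germ) : Prop := germ_join a b = a.

Definition alpha (a : germ) : set germ := [set b | germ_le b a].

Definition has_maximal_element (A : set germ) : Prop :=
  exists a, A = alpha a.

End BinarySequences.

Definition ind (R : realType) (U : nat -> set (sphere R)) (c : sphere R) : germ :=
  germ_of (fun n => `[< U n c >]).

(* The signature at x, for B a decreasing local base at x. *)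
Definition sign (R : realType) (B : nat -> nat -> set (sphere R))
    (c : sphere R) : set germ :=
  \bigcap_j alpha (ind (B j) c).

Definition path_connected (R : realType) (T : topologicalType) (A : set T) :=
  forall a b, A a -> A b -> exists gamma : R -> T,
    [/\ {within `[0, 1], continuous gamma}, gamma 0 = a, gamma 1 = b
      & forall t, 0 <= t <= 1 -> A (gamma t)].

(* Main.v *)
Require Import Defs.
From HB Require Import structures.
From mathcomp Require Import all_boot all_order all_algebra generic_quotient.
From mathcomp Require Import all_classical all_reals all_analysis.
From mathcomp Require Import complex zify ring lra.

(** The idea is to join every point of V - {v} to x inside V - {v}.

    Critical points. The map f has only finitely many critical points
    (finite_critical). A signature with a maximal element means that, from some
    neighborhood B J on, smaller neighborhoods contain the critical point on the same
    levels, up to finitely many (has_maximal_elementP, a diagonal argument). So one J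
    serves all critical points, and U is B J: for neighborhoods W of x inside V inside U,
    with W one of the B k, all critical points in V n lie in W n when n is large.

    Plaques. On V the map V n.+1 -> V n is z ^ t between disks. When t > 1 its branch point is
    critical, so at high levels it belongs to W n.+1, and W n.+1 is the whole preimage of W n in
    V n.+1 (plaque_saturated). Hence from some level on one coordinate decides whether
    a point of V belongs to W.

    Paths. A path in the plane has continuous t-th roots even if it runs through 0
    (path_root_exists); so every path in a level V n lifts to a path in V
    (plaque_path_lift). Given p in V different from v, choose W that does not contain
    v and a high level n at which p and v differ. The disk V n without the coordinate
    of v is path-connected; a path there from the coordinate of p to that of x lifts to
    a path that avoids v and ends in W (path_avoiding_point). In the same way one
    passes from W to smaller and smaller B k, now without having to avoid v, and the
    infinite concatenation of these paths tends to x (path_to_center).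

    Finiteness of the critical set. On the sphere it follows from compactness. On the
    disk and the plane, f is a proper open map g with finitely many zeros. Let c be
    critical with r = |g c| > 0. Near c, sectors with |g| < r and with |g| > r
    alternate. Each sector of the first kind leads to a zero of g inside |g| < r, and two
    such sectors cannot be joined inside |g| < r, since that would give two loops that
    cross exactly once (crossing_loops_meet). So r is the level at which two
    zeros of g merge into one component of the sublevel set. There are finitely many
    pairs of zeros, hence finitely many levels r, and over each closed disk |w| <= r
    there are finitely many critical points by compactness. *)

Set Implicit Arguments.
Unset Strict Implicit.
Unset Printing Implicit Defensive.
Import Order.TTheory GRing.Theory Num.Theory.
Import numFieldNormedType.Exports.
Local Open Scope classical_set_scope.
Local Open Scope ring_scope.
Local Open Scope complex_scope.
Local Notation Re := complex.Re.
Local Notation Im := complex.Im.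

(** * Topology of the complex plane *)

Lemma continuous_near_eq (X Y : topologicalType) (f g : X -> Y) (x : X) :
  {for x, continuous f} -> (\forall y \near x, f y = g y) -> {for x, continuous g}.
Proof.
move=> cf fg A; rewrite -(nbhs_singleton fg) => /cf fA.
by apply: filterS2 fg fA => y /= ->.
Qed.

Lemma continuous_forall (X Y : topologicalType) (f : X -> Y) :
  (forall x, {for x, continuous f}) -> continuous f.
Proof. by []. Qed.

Section ComplexPlane.
Variable R : realType.
Local Notation C := (cplx R).
Implicit Types (z w : C) (e r : R).

(** The library norm of a complex number is again a complex number; inequalities
    between moduli are much easier to handle in the ordered field R. *)
Definition cabs (z : C) : R := ComplexField.Normc.normc z.

Lemma normE z : `|z| = (cabs z)%:C.
Proof. by case: z. Qed.

Lemma cabs_ge0 z : 0 <= cabs z.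
Proof. by case: z => a b; exact: sqrtr_ge0. Qed.

Lemma cabsM z w : cabs (z * w) = cabs z * cabs w.
Proof. exact: ComplexField.Normc.normcM. Qed.

Lemma cabs0 : cabs 0 = 0. Proof. exact: ComplexField.Normc.normc0. Qed.
Lemma cabs1 : cabs 1 = 1. Proof. exact: ComplexField.Normc.normc1. Qed.
Lemma cabsV z : cabs z^-1 = (cabs z)^-1.
Proof. exact: ComplexField.Normc.normcV. Qed.

Lemma cabs_eq0 z : (cabs z == 0) = (z == 0).
Proof.
by apply/eqP/eqP => [/ComplexField.Normc.eq0_normc|->//]; rewrite ?cabs0.
Qed.

Lemma cabs_gt0 z : (0 < cabs z) = (z != 0).
Proof. by rewrite lt_def cabs_ge0 andbT cabs_eq0. Qed.

Lemma cabsD z w : cabs (z + w) <= cabs z + cabs w.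
Proof. exact: le_normcD. Qed.

Lemma cabsN z : cabs (- z) = cabs z.
Proof. exact: normcN. Qed.

Lemma cabsC z w : cabs (z - w) = cabs (w - z).
Proof. by rewrite -cabsN opprB. Qed.

Lemma cabsX z n : cabs (z ^+ n) = cabs z ^+ n.
Proof. by elim: n => [|n IH]; rewrite ?expr0 ?cabs1 // !exprS cabsM IH. Qed.

Lemma cabsR (x : R) : cabs x%:C = `|x|.
Proof. by rewrite /cabs /= expr0n /= addr0 sqrtr_sqr. Qed.

Lemma cabs_le_tri z w : cabs z <= cabs w + cabs (z - w).
Proof. by rewrite -{1}(subrK w z) addrC cabsD. Qed.

Lemma sqr_cabs z : cabs z ^+ 2 = Re z ^+ 2 + Im z ^+ 2.
Proof. by case: z => a b; rewrite /cabs /= sqr_sqrtr // addr_ge0 ?sqr_ge0. Qed.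

Lemma Re_le_cabs z : `|Re z| <= cabs z.
Proof.
by case: z => a b; rewrite /cabs /= -sqrtr_sqr ler_wsqrtr // lerDl sqr_ge0.
Qed.

Lemma Im_le_cabs z : `|Im z| <= cabs z.
Proof.
by case: z => a b; rewrite /cabs /= -sqrtr_sqr ler_wsqrtr // lerDr sqr_ge0.
Qed.

Lemma cabs_le_ReIm z : cabs z <= `|Re z| + `|Im z|.
Proof.
have -> : z = (Re z)%:C + 'i * (Im z)%:C by exact: complexE.
apply: (le_trans (cabsD _ _)); rewrite cabsM !cabsR.
have -> : cabs 'i = 1 by rewrite /cabs /= expr0n expr1n add0r sqrtr1.
by case: z => a b /=; rewrite !(mul0r,mulr0,addr0,add0r,mul1r,subr0).
Qed.

Lemma nbhsCP z (A : set C) :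
  nbhs z A <-> exists2 e : R, 0 < e & forall w, cabs (w - z) < e -> A w.
Proof.
split.
- move=> /nbhs_ballP[e /= e0 eA]; have eR : e \is Num.real by rewrite gtr0_real.
  exists (Re e); first by move: e0; rewrite ltcE => /andP[].
  move=> w we; apply: eA; rewrite -ball_normE /= normE cabsC.
  by rewrite -(RRe_real eR) ltcR.
- move=> [e e0 eA]; apply/nbhs_ballP; exists e%:C; first by rewrite /= ltcR.
  by move=> w; rewrite -ball_normE /= normE ltcR cabsC => /eA.
Qed.

Lemma cvgCP (T : Type) (F : set_system T) (FF : Filter F) (f : T -> C) z :
  f @ F --> z <-> forall e : R, 0 < e -> \forall x \near F, cabs (f x - z) < e.
Proof.
split.
- by move=> fz e e0; apply: (fz [set w | cabs (w - z) < e]); apply/nbhsCP; exists e.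
- move=> H A /nbhsCP[e e0 eA]; have := H _ e0; apply: filterS => x; exact: eA.
Qed.

Lemma open_CP (A : set C) : open A <->
  forall z, A z -> exists2 e : R, 0 < e & forall w, cabs (w - z) < e -> A w.
Proof.
by rewrite openE; split=> H z Az; [apply/nbhsCP; exact: H|apply/nbhsCP; exact: H].
Qed.

Lemma lipschitz_C_continuous (f : C -> R) :
  (forall z w, `|f w - f z| <= cabs (w - z)) -> continuous f.
Proof.
move=> L z; apply/(@cvgrPdist_lt _ _ _ (nbhs z) _) => e e0; apply/nbhsCP.
by exists e => // w we; rewrite distrC (le_lt_trans (L _ _)).
Qed.

Lemma continuous_cabs : continuous cabs.
Proof.
apply: lipschitz_C_continuous => z w; rewrite ler_norml; apply/andP; split.
- by have := cabs_le_tri z w; rewrite cabsC; lra.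
- by have := cabs_le_tri w z; lra.
Qed.

Lemma continuous_Re : continuous (@Re R : C -> R).
Proof.
by apply: lipschitz_C_continuous => -[a b] [c d]; exact: (Re_le_cabs (Complex (c - a) (d - b))).
Qed.

Lemma continuous_Im : continuous (@Im R : C -> R).
Proof.
by apply: lipschitz_C_continuous => -[a b] [c d]; exact: (Im_le_cabs (Complex (c - a) (d - b))).
Qed.

Lemma cvg_Complex (T : Type) (F : set_system T) (FF : Filter F) (f g : T -> R) a b :
  f @ F --> a -> g @ F --> b -> (fun x => Complex (f x) (g x) : C) @ F --> (Complex a b : C).
Proof.
move=> /cvgrPdist_lt fa /cvgrPdist_lt gb; apply/cvgCP => e e0.
have e2 : 0 < e / 2 by rewrite divr_gt0.
near=> x; apply: (le_lt_trans (cabs_le_ReIm _)) => /=.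
rewrite [e]splitr ltrD // distrC; near: x; [exact: fa|exact: gb].
Unshelve. all: by end_near. Qed.

Lemma continuous_RtoC : continuous (fun x : R => x%:C : C).
Proof. by move=> x; apply: cvg_Complex; [exact: cvg_id|exact: cvg_cst]. Qed.

Lemma compact_disk (r : R) : compact [set z : C | cabs z <= r].
Proof.
have cI : compact `[- r, r]%classic by exact: segment_compact.
have cP : compact (`[- r, r]%classic `*` `[- r, r]%classic) by exact: compact_setX.
have ct : continuous (fun p : R * R => Complex p.1 p.2 : C).
  by move=> p; apply: cvg_Complex; [exact: cvg_fst|exact: cvg_snd].
have := continuous_compact (continuous_subspaceT ct) cP.
move=> /(subclosed_compact _); apply.
- have -> : [set z : C | cabs z <= r] = cabs @^-1` [set x | x <= r] by [].
  by apply: closed_comp; [move=> z _; exact: continuous_cabs|exact: closed_le].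
- move=> z /= zr; exists (Re z, Im z) => /=; last by case: z {zr}.
  by split; rewrite /= in_itv /= -ler_norml (le_trans _ zr) ?Re_le_cabs ?Im_le_cabs.
Qed.

Lemma hausdorff_C : hausdorff_space C.
Proof. exact: norm_hausdorff. Qed.

Section Continuity.
Variable X : topologicalType.
Implicit Types (f g : X -> C) (x : X).

Lemma contC_const x (c : C) : {for x, continuous (fun _ : X => c)}.
Proof. exact: cvg_cst. Qed.

Lemma contC_add x f g : {for x, continuous f} -> {for x, continuous g} ->
  {for x, continuous (fun y => f y + g y)}.
Proof. by move=> cf cg; apply: (@cvgD _ _ _ (nbhs x)). Qed.

Lemma contC_sub x f g : {for x, continuous f} -> {for x, continuous g} ->
  {for x, continuous (fun y => f y - g y)}.
Proof. by move=> cf cg; apply: (@cvgB _ _ _ (nbhs x)). Qed.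

Lemma contC_mul x f g : {for x, continuous f} -> {for x, continuous g} ->
  {for x, continuous (fun y => f y * g y)}.
Proof. by move=> cf cg; apply: (@cvgM _ _ (nbhs x)). Qed.

Lemma contC_inv x f : f x != 0 -> {for x, continuous f} ->
  {for x, continuous (fun y => (f y)^-1)}.
Proof. by move=> f0 cf; apply: (@cvgV _ _ (nbhs x)). Qed.

Lemma contC_exp x f n : {for x, continuous f} ->
  {for x, continuous (fun y => f y ^+ n)}.
Proof.
move=> cf; elim: n => [|n IH]; first exact: contC_const.
rewrite (_ : (fun y => _) = (fun y => f y * f y ^+ n)); first exact: contC_mul.
by apply/funext => y; rewrite exprS.
Qed.

Lemma contC_sum x n (f : nat -> X -> C) :
  (forall k, (k < n)%N -> {for x, continuous (f k)}) ->
  {for x, continuous (fun y => \sum_(k < n) f k y)}.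
Proof.
elim: n => [|n IH] H.
  by rewrite (_ : (fun y => _) = fun=> 0) ?funeqE => [|y]; [exact: contC_const|rewrite big_ord0].
rewrite (_ : (fun y => _) = fun y => \sum_(k < n) f k y + f n y); last first.
  by apply/funext => y; rewrite big_ord_recr.
by apply: contC_add; [apply: IH => k kn; apply/H/ltnW|exact: H].
Qed.

Lemma contC_prod x n (f : nat -> X -> C) :
  (forall k, (k < n)%N -> {for x, continuous (f k)}) ->
  {for x, continuous (fun y => \prod_(k < n) f k y)}.
Proof.
elim: n => [|n IH] H.
  by rewrite (_ : (fun y => _) = fun=> 1) ?funeqE => [|y]; [exact: contC_const|rewrite big_ord0].
rewrite (_ : (fun y => _) = fun y => \prod_(k < n) f k y * f n y); last first.
  by apply/funext => y; rewrite big_ord_recr.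
by apply: contC_mul; [apply: IH => k kn; apply/H/ltnW|exact: H].
Qed.

Lemma contC_real x (f : X -> R) : {for x, continuous f} ->
  {for x, continuous (fun y => (f y)%:C : C)}.
Proof. by move=> cf; apply: continuous_comp => //; exact: continuous_RtoC. Qed.

Lemma contCP x f : {for x, continuous f} <->
  forall e : R, 0 < e -> \forall y \near x, cabs (f y - f x) < e.
Proof. exact: cvgCP. Qed.

Lemma contC_neq0 x f : {for x, continuous f} -> f x != 0 ->
  \forall y \near x, f y != 0.
Proof.
move=> /cvgCP H; rewrite -cabs_gt0 => /H; apply: filterS => y; apply: contraTneq => ->.
by rewrite sub0r cabsN ltxx.
Qed.

End Continuity.

End ComplexPlane.
Arguments cabs {R} z : simpl never.

(** * Roots of functions without zeros *)

Section Connected.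

(** A predicate that is locally constant along a connected set cuts it into two
    relatively open pieces, so it is constant. *)
Lemma connected_locally_constant (T : topologicalType) (A : set T)
    (P : T -> Prop) a b : connected A ->
  (forall t, A t -> \forall s \near t, A s -> (P s <-> P t)) ->
  A a -> A b -> P a -> P b.
Proof.
move=> cA locP Aa Ab Pa.
suff : A `&` [set t | P t] = A by move=> /seteqP[_ /(_ b Ab)[]].
apply: cA.
- by exists a.
- exists [set t | A t -> P t]^°; first exact: open_interior.
  apply/seteqP; split=> t [At Pt]; split=> //.
  + have := locP _ At; apply: filterS => s H As; by apply/(H As).
  + exact: (interior_subset Pt).
- exists (~` [set t | A t -> ~ P t]^°); first by apply: open_closedC; exact: open_interior.
  apply/seteqP; split=> t [At Pt]; split=> //.
  + by move=> /interior_subset; exact.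
  + apply: contrapT => nPt; apply: Pt.
    by have := locP _ At; apply: filterS => s H As; move/(H As).
Qed.

Lemma continuous_glue (R : realType) (T : topologicalType) (f g : R -> T) a :
  continuous f -> continuous g -> f a = g a ->
  continuous (fun t => if t <= a then f t else g t).
Proof.
move=> cf cg fg t A; have [ta|ta|ta] := ltrgtP t a => H.
- change (nbhs (f t) A) in H.
  have h1 : \forall s \near t, s < a by exact: lt_nbhsl.
  have h2 : \forall s \near t, A (f s) by exact: cf.
  by apply: filterS2 h1 h2 => s /= /ltW ->.
- change (nbhs (g t) A) in H.
  have h1 : \forall s \near t, a < s by exact: lt_nbhsr.
  have h2 : \forall s \near t, A (g s) by exact: cg.
  by apply: filterS2 h1 h2 => s /=; rewrite ltNge => /negPf ->.
- have h1 : \forall s \near t, A (f s) by exact: cf.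
  have h2 : \forall s \near t, A (g s) by apply: cg; rewrite ta -fg -ta.
  by apply: filterS2 h1 h2 => s /= ? ?; case: ifP.
Qed.

End Connected.

Section Roots.
Variable R : realType.
Local Notation C := (cplx R).

Definition cis (x : R) : C := Complex (cos x) (sin x).

Lemma cis0 : cis 0 = 1.
Proof. by rewrite /cis cos0 sin0. Qed.

Lemma cisD x y : cis (x + y) = cis x * cis y.
Proof. by rewrite /cis cosD sinD; apply/eqP; rewrite eq_complex /= eqxx /= addrC. Qed.

Lemma cisX x n : cis x ^+ n = cis (n%:R * x).
Proof.
elim: n => [|n IH]; first by rewrite expr0 mul0r cis0.
by rewrite exprS IH -cisD -natr1 mulrDl mul1r addrC.
Qed.

Lemma cabs_cis x : cabs (cis x) = 1.
Proof. by rewrite /cabs /= cos2Dsin2 sqrtr1. Qed.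

Lemma cvg_cis (T : Type) (F : set_system T) (FF : Filter F) (f : T -> R) a :
  f @ F --> a -> cis (f x) @[x --> F] --> cis a.
Proof.
by move=> fa; apply: cvg_Complex; apply: continuous_cvg => //;
  [exact: continuous_cos|exact: continuous_sin].
Qed.

Lemma cabs_dirE (z : C) : 0 < cabs z ->
  (cabs z)%:C * Complex (Re z / cabs z) (Im z / cabs z) = z.
Proof.
case: z => a b; move: (cabs _) => r r0; apply/eqP; rewrite eq_complex /=.
by apply/andP; split; apply/eqP; field; rewrite gt_eqF.
Qed.

Lemma polar (z : C) : exists x, z = (cabs z)%:C * cis x.
Proof.
have [->|z0] := eqVneq z 0; first by exists 0; rewrite cabs0 mul0r.
have r0 : 0 < cabs z by rewrite cabs_gt0.
have s1 : (Re z / cabs z) ^+ 2 + (Im z / cabs z) ^+ 2 = 1.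
  by rewrite !expr_div_n -mulrDl -sqr_cabs divff // expf_neq0 // gt_eqF.
suff [x cx sx] : exists2 x, Re z / cabs z = cos x & Im z / cabs z = sin x.
  by exists x; rewrite /cis -cx -sx cabs_dirE.
have c1 : -1 <= Re z / cabs z <= 1.
  by rewrite -ler_norml -sqrtr_sqr -[leRHS]sqrtr1 ler_wsqrtr // -s1 lerDl sqr_ge0.
have cK : cos (acos (Re z / cabs z)) = Re z / cabs z by rewrite acosK.
have sK : sin (acos (Re z / cabs z)) = `|Im z / cabs z|.
  by rewrite sin_acos // -s1 addrAC subrr add0r sqrtr_sqr.
have [i0|i0] := lerP 0 (Im z / cabs z).
- by exists (acos (Re z / cabs z)); rewrite // sK ger0_norm.
- by exists (- acos (Re z / cabs z)); rewrite ?cosN // sinN sK ltr0_norm ?opprK.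
Qed.

(** The principal branch of the n-th root, in polar coordinates. On the right half
    plane the argument is the arc tangent of a quotient, hence continuous. *)
Definition near1_root (n : nat) (w : C) : C :=
  (expR (ln (cabs w) / n%:R))%:C * cis (atan (Im w / Re w) / n%:R).

Lemma near1_rootK n (w : C) : (0 < n)%N -> 0 < Re w -> near1_root n w ^+ n = w.
Proof.
move=> n0 w0; have nR : n%:R != 0 :> R by rewrite pnatr_eq0 -lt0n.
have r0 : 0 < cabs w by apply: lt_le_trans (Re_le_cabs w); rewrite gtr0_norm.
rewrite /near1_root exprMn cisX -rmorphXn -expRM_natl mulrCA divff // mulr1.
rewrite mulrCA divff // mulr1 lnK ?posrE //.
have ca : cos (atan (Im w / Re w)) = Re w / cabs w.
  rewrite cos_atan -[LHS](mulfK (lt0r_neq0 r0)); congr (_ / _).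
  have -> : cabs w = Re w * Num.sqrt (1 + (Im w / Re w) ^+ 2).
    rewrite -[RHS]gtr0_norm ?mulr_gt0 ?sqrtr_gt0 ?ltr_wpDr ?sqr_ge0 //.
    rewrite -[LHS]ger0_norm ?cabs_ge0 // -!sqrtr_sqr; congr Num.sqrt.
    rewrite exprMn sqr_sqrtr ?ler_wpDr ?sqr_ge0 // sqr_cabs.
    by field; rewrite gt_eqF.
  by rewrite mulrCA mulVf ?mulr1 // gt_eqF // sqrtr_gt0 ltr_wpDr // sqr_ge0.
have sa : sin (atan (Im w / Re w)) = Im w / cabs w.
  have := atanK (Im w / Re w); rewrite /tan ca => /(canRL (divfK _)) ->.
  - by field; rewrite !gt_eqF.
  - by rewrite mulf_neq0 ?invr_eq0 // gt_eqF.
by rewrite /cis ca sa cabs_dirE.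
Qed.

Lemma continuous_near1_root n (w : C) : 0 < Re w -> {for w, continuous (near1_root n)}.
Proof.
move=> w0; have r0 : 0 < cabs w by apply: lt_le_trans (Re_le_cabs w); rewrite gtr0_norm.
have cI : {for w, continuous (fun u : C => Im u / Re u)}.
  apply: (@cvgM R C (nbhs w) _ (@Im R) (fun u => (Re u)^-1)); first exact: continuous_Im.
  by apply: (@cvgV _ _ (nbhs w)); [rewrite gt_eqF|exact: continuous_Re].
apply: contC_mul.
- apply: contC_real; apply: (@continuous_comp C R R); last exact: continuous_expR.
  apply: (@cvgMr_tmp R C (nbhs w) _ (fun u => ln (cabs u))).
  by apply: (@continuous_comp C R R); [exact: continuous_cabs|exact: continuous_ln].
- apply: (@cvg_cis C (nbhs w)); apply: (@cvgMr_tmp R C (nbhs w)).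
  by apply: (@continuous_cvg _ _ _ (nbhs w)) => //; exact: continuous_atan.
Qed.

Lemma near1_root1 n : near1_root n 1 = 1.
Proof. by rewrite /near1_root cabs1 ln1 !mul0r expR0 mul1r atan0 mul0r cis0. Qed.

(** Uniform continuity, in the multiplicative form needed for roots: quotients of
    values at near points stay in the right half plane. *)
Lemma compact_rel_osc (T : normedModType R) (K : set T) (Phi : T -> C) :
  compact K -> continuous Phi -> (forall z, K z -> Phi z != 0) ->
  exists2 e : R, 0 < e & forall z w, K z -> K w -> `|z - w| < e ->
    cabs (Phi w - Phi z) < cabs (Phi z).
Proof.
move=> /compact_near_coveringP cK cP P0.
have := cK _ (0^'+) (fun e z => forall w, `|z - w| < e ->
   cabs (Phi w - Phi z) < cabs (Phi z)) _.
case=> [z Kz|e1 /= e10 He].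
- have nbhs_norm_ball (d : R) : 0 < d -> \forall z' \near z, `|z - z'| < d.
    by move=> d0; have := nbhsx_ballx z d d0; rewrite -ball_normE.
  have m0 : 0 < cabs (Phi z) by rewrite cabs_gt0 P0.
  have m4 : 0 < cabs (Phi z) / 4 by rewrite divr_gt0.
  have /cvgCP := cP z => /(_ _ m4) /nbhs_ballP[e /= e0 He].
  have e2 : 0 < e / 2 by rewrite divr_gt0.
  near=> z' d => /= w wd.
  have h1 : cabs (Phi z' - Phi z) < cabs (Phi z) / 4.
    apply: He; rewrite -ball_normE /=.
    have : `|z - z'| < e / 2 by near: z'; exact: nbhs_norm_ball.
    lra.
  have h2 : cabs (Phi w - Phi z) < cabs (Phi z) / 4.
    apply: He; rewrite -ball_normE /=.
    have : `|z - z'| < e / 2 by near: z'; exact: nbhs_norm_ball.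
    have : d < e / 2 by near: d; exact: nbhs_right_lt.
    have := ler_normD (z - z') (z' - w); rewrite addrA subrK; lra.
  have := cabs_le_tri (Phi w - Phi z') (Phi w - Phi z).
  have -> : Phi w - Phi z' - (Phi w - Phi z) = Phi z - Phi z' by ring.
  have := cabs_le_tri (Phi z) (Phi z').
  rewrite [cabs (Phi z - Phi z')]cabsC; lra.
- exists (e1 / 2); first by rewrite divr_gt0.
  move=> z w Kz Kw zw; apply: (He (e1 / 2)) => //; last by rewrite divr_gt0.
  by rewrite /ball_ /= sub0r normrN gtr0_norm; lra.
Unshelve. all: by end_near. Qed.

Lemma cabs_lt1_Re (z w : C) : w != 0 -> cabs (z - w) < cabs w -> 0 < Re (z / w).
Proof.
move=> w0 H; have cw : 0 < cabs w by rewrite cabs_gt0.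
have : cabs (z / w - 1) < 1.
  have -> : z / w - 1 = (z - w) / w by field.
  by rewrite cabsM cabsV ltr_pdivrMr // mul1r.
move=> /(le_lt_trans (Re_le_cabs _)); case: (z / w) => a b /=.
by rewrite ltr_norml; lra.
Qed.

(** On a star-shaped compact set a function without zeros has a continuous n-th
    root. Cut each ray from the center into N equal steps; quotients of successive
    values lie in the right half plane, where the principal root is continuous, and
    the product of their roots telescopes to a root of the value at the end. *)
Lemma continuous_root_star (T : normedModType R) (K : set T) (p : T)
    (Phi : T -> C) n r0 :
  compact K -> K p -> (forall z (s : R), K z -> 0 <= s <= 1 -> K (p + s *: (z - p))) ->
  continuous Phi -> (forall z, K z -> Phi z != 0) ->
  (0 < n)%N -> r0 ^+ n = Phi p ->
  exists2 r : T -> C, r p = r0 &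
    forall z, K z -> {for z, continuous r} /\ r z ^+ n = Phi z.
Proof.
move=> cK Kp starK cP P0 n0 r0E.
have [e e0 osc] := compact_rel_osc cK cP P0.
have [M [_ HM]] := compact_bounded cK.
pose B := `|M| + 1 + `|p|.
have Kb z : K z -> `|z - p| <= B.
  move=> Kz; apply: (le_trans (ler_normB _ _)); rewrite lerD2r.
  by apply: (HM (`|M| + 1)) Kz; have := ler_norm M; lra.
have B0 : 0 < B by rewrite /B; have := normr_ge0 M; have := normr_ge0 p; lra.
pose N := (Num.truncn (B / e)).+1.
have NE : B / e < N%:R by rewrite truncnS_gt.
have N0 : 0 < N%:R :> R by rewrite ltr0n.
pose q (k : nat) z : T := p + (k%:R / N%:R) *: (z - p).
pose r z := r0 * \prod_(k < N) near1_root n (Phi (q k.+1 z) / Phi (q k z)).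
have Kq k z : K z -> (k <= N)%N -> K (q k z).
  move=> Kz kN; apply: starK => //; rewrite divr_ge0 ?ler0n //=.
  by rewrite ler_pdivrMr // mul1r ler_nat.
have Rq k z : K z -> (k < N)%N -> 0 < Re (Phi (q k.+1 z) / Phi (q k z)).
  move=> Kz kN; apply: cabs_lt1_Re; first by apply/P0/Kq => //; exact: ltnW.
  apply: osc; [exact: Kq (ltnW _)|exact: Kq|].
  rewrite /q opprD addrACA subrr add0r -scalerBl -mulrBl -natr1 opprD addrA subrr sub0r.
  rewrite normrZ mulN1r normrN gtr0_norm ?invr_gt0 // mulrC ltr_pdivrMr // mulrC.
  by apply: le_lt_trans (Kb _ Kz) _; rewrite -ltr_pdivrMr // mulrC.
have cq k : continuous (q k).
  move=> z; apply: cvgD; first exact: cvg_cst.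
  apply: (@cvgZ _ _ _ (nbhs z)); first exact: cvg_cst.
  by apply: (@cvgB _ _ _ (nbhs z)); [exact: cvg_id|exact: cvg_cst].
have cPq k z : Phi (q k u) @[u --> z] --> Phi (q k z).
  by apply: (@continuous_cvg _ _ _ (nbhs z) _ (q k)); [exact: cP|exact: cq].
exists r.
- rewrite /r big1 ?mulr1 // => k _.
  by rewrite /q subrr !scaler0 addr0 divff ?near1_root1 ?P0.
move=> z Kz; split.
- apply: contC_mul; first exact: contC_const.
  apply: (@contC_prod R T z N (fun k u => near1_root n (Phi (q k.+1 u) / Phi (q k u)))) => k kN.
  apply: (@continuous_comp T C C).
    apply: contC_mul; first exact: cPq.
    by apply: contC_inv; [apply/P0/Kq => //; exact: ltnW|exact: cPq].
  by apply: continuous_near1_root; exact: Rq.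
- rewrite exprMn r0E -prodrXl.
  rewrite (eq_bigr (fun k : 'I_N => Phi (q k.+1 z) / Phi (q k z))); last first.
    by move=> k _; rewrite near1_rootK //; exact: Rq.
  have tele m : (m <= N)%N ->
      Phi p * \prod_(k < m) (Phi (q k.+1 z) / Phi (q k z)) = Phi (q m z).
    elim: m => [|m IH] mN; first by rewrite big_ord0 mulr1 /q mul0r scale0r addr0.
    rewrite big_ord_recr /= mulrA IH ?(ltnW mN) //.
    by rewrite mulrC divfK //; apply/P0/Kq/ltnW.
  by rewrite tele // /q divff ?scale1r ?gt_eqF // addrC subrK.
Qed.

(** The only root of 1 near 1 is 1: the other factor of u ^ n - 1 is the geometric
    sum, whose value at 1 is n. *)
Lemma root1_isolated n : (0 < n)%N -> exists2 e : R, 0 < e &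
  forall u : C, u ^+ n = 1 -> cabs (u - 1) < e -> u = 1.
Proof.
move=> n0.
have ct : {for (1 : C), continuous (fun u : C => \sum_(k < n) u ^+ k)}.
  by apply: (@contC_sum R C 1 n (fun k u => u ^+ k)) => k _; apply: contC_exp; exact: cvg_id.
have nz : \sum_(k < n) (1 : C) ^+ k != 0.
  under eq_bigr do rewrite expr1n.
  by rewrite sumr_const card_ord pnatr_eq0 -lt0n.
have /nbhsCP[e e0 He] : \forall u \near (1 : C), \sum_(k < n) u ^+ k != 0.
  exact: (contC_neq0 ct nz).
exists e => // u u1 /He un; have := subrX1 u n; rewrite u1 subrr => /esym/eqP.
by rewrite mulf_eq0 (negPf un) orbF subr_eq0 => /eqP.
Qed.

(** The quotient of two continuous roots of one function is a continuous n-th root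
    of unity, and these are isolated. The equation is stated without division. *)
Lemma root_unique (r1 r2 : R -> C) (A : set R) n a b :
  (0 < n)%N -> connected A -> A a -> A b ->
  (forall t, A t -> [/\ {for t, continuous r1}, {for t, continuous r2},
     r1 t != 0 & r1 t ^+ n = r2 t ^+ n]) ->
  r1 a * r2 b = r2 a * r1 b.
Proof.
move=> n0 cA Aa Ab H.
have r2n t : A t -> r2 t != 0.
  move=> /H[_ _ r10 E]; apply/eqP => r20; move: E.
  by rewrite r20 expr0n gtn_eqF //= => /eqP; rewrite expf_eq0 n0 (negPf r10).
suff : r2 b / r1 b = r2 a / r1 a.
  have [_ _ ra _] := H _ Aa; have [_ _ rb _] := H _ Ab.
  by move=> /(canRL (divfK rb)) ->; field.
have [e e0 He] := root1_isolated n0.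
apply: (@connected_locally_constant _ A (fun t => r2 t / r1 t = r2 a / r1 a) a b) => //.
move=> t At; have [c1 c2 rt E] := H _ At.
have : {for t, continuous (fun s => r2 s / r1 s / (r2 t / r1 t))}.
  apply: contC_mul; last exact: contC_const.
  by apply: (contC_mul c2); apply: contC_inv; [exact: rt|exact: c1].
move=> cq; have /cvgCP := cq; move=> /(_ _ e0); rewrite divff ?mulf_neq0 ?invr_eq0 ?r2n //.
apply: filterS => s /He HH As; have [_ _ rs Es] := H _ As.
have : r2 s / r1 s / (r2 t / r1 t) = 1.
  by apply: HH; rewrite !expr_div_n E Es !divff ?expf_neq0 ?r2n // divr1.
by move=> /(canRL (divfK _)); rewrite mul1r => -> //; rewrite mulf_neq0 ?invr_eq0 ?r2n.
Qed.

End Roots.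

(** * Roots of a path that may run through zero *)

Section PathRoot.
Variable R : realType.
Local Notation C := (cplx R).

Section OnePath.
Variables (b : R -> C) (n : nat) (a : C).
Hypotheses (cb : continuous b) (n0 : (0 < n)%N) (ab : a ^+ n = b 0).

(** An equivalence on the points where b does not vanish, whose classes are the
    components of this open set. On each such component a branch of the root is chosen; at the zeros of b
    all branches tend to 0, so the choices fit together. *)
Definition nonzero_between (s t : R) :=
  forall u, (s <= u <= t) || (t <= u <= s) -> b u != 0.

Lemma nonzero_between_sym s t : nonzero_between s t -> nonzero_between t s.
Proof. by move=> H u Hu; apply: H; rewrite orbC. Qed.

Lemma nonzero_between_trans t s u :
  nonzero_between s t -> nonzero_between t u -> nonzero_between s u.
Proof.
move=> H1 H2 x Hx; have [xt|xt] := lerP x t.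
- have [sx|sx] := lerP s x; first by apply: H1; rewrite sx xt.
  by apply: H2; apply/orP; right; case/orP: Hx => /andP[] *; apply/andP; lra.
- have [sx|sx] := lerP x s; first by apply: H1; rewrite sx (ltW xt) orbT.
  by apply: H2; apply/orP; left; case/orP: Hx => /andP[] *; apply/andP; lra.
Qed.

(** A base point for the component of t. It depends only on the component, and it
    is 0 when 0 belongs to it, so that the value at 0 can be prescribed. *)
Definition root_base (t : R) : R :=
  if `[< nonzero_between 0 t >] then 0 else xget 0 [set s | nonzero_between s t].

Lemma root_baseP t : b t != 0 -> nonzero_between (root_base t) t.
Proof.
move=> bt; rewrite /root_base; case: asboolP => // _.
apply: (@xgetPex _ 0 [set s | nonzero_between s t]); exists t => u.
by rewrite orbb => /le_anti <-.
Qed.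

Lemma root_base_eq s t : nonzero_between s t -> root_base s = root_base t.
Proof.
move=> st; have E x : nonzero_between x s <-> nonzero_between x t.
  split=> H; first exact: nonzero_between_trans H st.
  exact: nonzero_between_trans H (nonzero_between_sym st).
rewrite /root_base (asbool_equiv_eq (E 0)); case: ifP => // _.
by congr (xget 0 _); apply/seteqP; split => x /E.
Qed.

Definition base_root (s : R) : C := if s == 0 then a else n.-root (b s).

Lemma base_rootP s : base_root s ^+ n = b s.
Proof. by rewrite /base_root; case: eqP => [->|_] //; rewrite rootCK. Qed.

Definition is_branch (x y : R) (r : R -> C) :=
  forall u, x <= u <= y -> {for u, continuous r} /\ r u ^+ n = b u.

Lemma branch_exists x y s r0 : x <= s <= y ->
  (forall u, x <= u <= y -> b u != 0) -> r0 ^+ n = b s ->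
  exists2 r, r s = r0 & is_branch x y r.
Proof.
move=> sxy nz r0s.
have [|||||||r r0E H] := @continuous_root_star R R `[x, y]%classic s b n r0.
- exact: segment_compact.
- by rewrite /= in_itv.
- move=> z u /=; rewrite !in_itv /= => zxy u01; apply/andP; split.
  + have -> : s + u *: (z - s) = (1 - u) * s + u * z by rewrite /GRing.scale /=; ring.
    have -> : x = (1 - u) * x + u * x by ring.
    by apply: lerD; apply: ler_wpM2l; lra.
  + have -> : s + u *: (z - s) = (1 - u) * s + u * z by rewrite /GRing.scale /=; ring.
    have -> : y = (1 - u) * y + u * y by ring.
    by apply: lerD; apply: ler_wpM2l; lra.
- exact: cb.
- by move=> z; rewrite /= in_itv /=; exact: nz.
- exact: n0.
- exact: r0s.
by exists r => // u uxy; apply: H; rewrite /= in_itv.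
Qed.

(** The value at t of the branch, over an interval containing t and its base point,
    that has the prescribed value at the base point; 0 where b vanishes. *)
Definition path_root (t : R) : C :=
  xget 0 [set z | b t != 0 /\ exists x y r, [/\ x <= root_base t <= y, x <= t <= y,
    r (root_base t) = base_root (root_base t), is_branch x y r & z = r t] ].

Lemma branch_unique x y r r' s t : x <= s <= y -> x <= t <= y ->
  is_branch x y r -> is_branch x y r' -> r s = r' s ->
  (forall u, x <= u <= y -> b u != 0) -> r t = r' t.
Proof.
move=> sxy txy Br Br' E nz.
have rn u : x <= u <= y -> r u != 0.
  by move=> ux; have [_] := Br u ux; apply: contra_eq_neq => ->; rewrite expr0n gtn_eqF // eq_sym nz.
have := @root_unique R r r' `[x, y]%classic n s t n0 (@segment_connected _ _ _).
rewrite /= !in_itv /= => /(_ sxy txy) H.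
have : r s * r' t = r' s * r t.
  apply: H => u; rewrite in_itv /= => uxy.
  have [c1 e1] := Br _ uxy; have [c2 e2] := Br' _ uxy.
  by split; [exact: c1|exact: c2|exact: rn|rewrite e1 e2].
by rewrite E => /(mulfI _) -> //; rewrite -E rn.
Qed.

Lemma path_rootE x y r t : x <= root_base t <= y -> x <= t <= y ->
  (forall u, x <= u <= y -> b u != 0) ->
  r (root_base t) = base_root (root_base t) -> is_branch x y r ->
  path_root t = r t.
Proof.
move=> bxy txy nz rb Br.
have : [set z | b t != 0 /\ exists x y r, [/\ x <= root_base t <= y, x <= t <= y,
    r (root_base t) = base_root (root_base t), is_branch x y r & z = r t] ] (path_root t).
  apply: xgetPex; exists (r t); split; first exact: nz.
  by exists x, y, r.
case=> bt [x' [y' [r' [bxy' txy' rb' Br' ->]]]].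
pose X := Num.min (root_base t) t; pose Y := Num.max (root_base t) t.
have XY u : X <= u <= Y -> (x <= u <= y) /\ (x' <= u <= y').
  rewrite /X /Y; case: (lerP (root_base t) t) => h; rewrite ?minElt ?maxElt; move: h bxy txy bxy' txy'.
    by case: ltrgtP => //; lra.
  by case: ltrgtP => //; lra.
apply: (@branch_unique X Y r' r (root_base t) t).
- by rewrite ge_min le_max !lexx.
- by rewrite ge_min le_max !lexx !orbT.
- by move=> u /XY[_ /Br'].
- by move=> u /XY[/Br].
- by rewrite rb'.
- by move=> u /XY[/nz].
Qed.

Lemma path_rootK t : path_root t ^+ n = b t.
Proof.
have [bt|bt] := eqVneq (b t) 0.
  rewrite bt /path_root xgetPN ?expr0n ?gtn_eqF // => z [] /=.
  by rewrite bt eqxx.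
have nzb := root_baseP bt.
pose X := Num.min (root_base t) t; pose Y := Num.max (root_base t) t.
have nz u : X <= u <= Y -> b u != 0.
  move=> Hu; apply: nzb; move: Hu; rewrite /X /Y.
  by case: (ltrgtP (root_base t) t) => h Hu; apply/orP; [left|right|left; rewrite h in Hu *].
have bX : X <= root_base t <= Y by rewrite ge_min le_max !lexx.
have tX : X <= t <= Y by rewrite ge_min le_max !lexx !orbT.
have [r rb Br] := branch_exists bX nz (base_rootP _).
by rewrite (path_rootE bX tX nz rb Br); have [] := Br _ tX.
Qed.

Lemma path_root0 : path_root 0 = a.
Proof.
have [b0|b0] := eqVneq (b 0) 0.
  have := path_rootK 0; rewrite b0 => /eqP; rewrite expf_eq0 n0 => /eqP ->.
  by move: ab; rewrite b0 => /eqP; rewrite expf_eq0 n0 => /eqP ->.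
have E : root_base 0 = 0.
  rewrite /root_base; case: asboolP => // -[] u.
  by rewrite orbb => /le_anti <-.
have bX : 0 <= root_base 0 <= 0 by rewrite E lexx.
have tX : (0 <= (0 : R)) && ((0 : R) <= 0) := introT andP (conj (lexx 0) (lexx 0)).
have nz u : 0 <= u <= 0 -> b u != 0 by move=> /le_anti <-.
have [r rb Br] := branch_exists bX nz (base_rootP _).
by rewrite (path_rootE bX tX nz rb Br); move: rb; rewrite E /base_root eqxx.
Qed.

Lemma continuous_path_root : continuous path_root.
Proof.
move=> t; have [bt|bt] := eqVneq (b t) 0.
- have E : path_root t = 0.
    by have := path_rootK t; rewrite bt => /eqP; rewrite expf_eq0 n0 => /eqP.
  apply/contCP => e e0; rewrite E; have en : 0 < e ^+ n by rewrite exprn_gt0.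
  have /contCP H := @cb t; have := H _ en; rewrite bt; apply: filterS => s.
  rewrite !subr0 -path_rootK cabsX ltr_pXn2r // ?nnegrE ?cabs_ge0 ?ltW //.
- have [e e0 He] : exists2 e : R, 0 < e & forall u, `|t - u| <= e -> b u != 0.
    have /nbhs_ballP[e /= e0 He] := contC_neq0 (@cb t) bt.
    exists (e / 2); first by rewrite divr_gt0.
    by move=> u tu; apply: He; rewrite -ball_normE /=; lra.
  have nzb := root_baseP bt.
  pose X := Num.min (root_base t) (t - e); pose Y := Num.max (root_base t) (t + e).
  have nz u : X <= u <= Y -> b u != 0.
    move=> Hu; have [tu|tu] := lerP `|t - u| e; first exact: He.
    apply: nzb; move: Hu tu; rewrite /X /Y ltr_normr.
    by rewrite ge_min le_max; lra.
  have bX : X <= root_base t <= Y by rewrite ge_min le_max !lexx.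
  have tX u : `|t - u| < e -> X <= u <= Y.
    by rewrite ltr_norml ge_min le_max => ?; lra.
  have [r rb Br] := branch_exists bX nz (base_rootP _).
  have [cr _] : {for t, continuous r} /\ r t ^+ n = b t.
    by apply/Br/tX; rewrite subrr normr0.
  apply: (continuous_near_eq cr).
  have : \forall u \near t, `|t - u| < e.
    by have := nbhsx_ballx t e e0; rewrite -ball_normE.
  apply: filterS => u tu.
  have ub : root_base u = root_base t.
    apply: root_base_eq => v Hv; apply: He; move: tu.
    by rewrite ltr_norml ler_norml; lra.
  have uX := tX _ tu.
  by rewrite (@path_rootE X Y r u) ?ub.
Qed.

End OnePath.

(** Unlike functions of a complex variable, a path has continuous n-th roots even if
    it runs through 0: roots are chosen independently on the intervals where it does
    not vanish, and continuity at a zero is automatic because the modulus of the root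
    is the n-th root of the modulus. This is what makes z ^ n lift all paths,
    including those through the branch point. *)
Theorem path_root_exists (b : R -> C) n a : continuous b -> (0 < n)%N ->
  a ^+ n = b 0 -> exists r : R -> C,
  [/\ continuous r, r 0 = a & forall t, r t ^+ n = b t].
Proof.
move=> cb n0 ab; exists (path_root b n a); split.
- exact: continuous_path_root.
- exact: path_root0.
- exact: path_rootK.
Qed.

End PathRoot.

(** * Loops that cross at one point *)

Section Crossing.
Variable R : realType.
Local Notation C := (cplx R).

(** If eta lies in the right half plane, the segment from 1 to eta ^ 2 avoids the
    negative half line, so a continuous square root along it never becomes purely
    imaginary and must end at eta rather than at its opposite. *)
Lemma half_plane_root (h : R -> C) (eta : C) : 0 < Re eta -> h 0 = 1 ->
  (forall t, 0 <= t <= 1 -> {for t, continuous h} /\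
     h t ^+ 2 = (1 - t)%:C + t%:C * eta ^+ 2) ->
  h 1 = eta.
Proof.
move=> e0 h0 H.
have Rn t : 0 <= t <= 1 -> Re (h t) != 0.
  move=> t01; have [_ E] := H _ t01; apply/eqP => Rh; move: E.
  case: (h t) Rh => x y /= ->; case: (eta) e0 => u v /= u0.
  rewrite !expr2 => /eqP; rewrite eq_complex /= => /andP[/eqP E1 /eqP E2].
  have : t * (u * v) = 0 by nra.
  move=> /eqP; rewrite !mulf_eq0 (gt_eqF u0) /= => /orP[/eqP t0|/eqP v0].
    by move: E1; rewrite t0; nra.
  have u2 : 0 < u * u by rewrite mulr_gt0.
  have tu : 0 <= t * (u * u) by apply: mulr_ge0; lra.
  have y2 : 0 <= y * y by rewrite -expr2 sqr_ge0.
  move: E1; rewrite v0; have [t2|t2] := lerP t (1 / 2); first by lra.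
  have : 0 < (t - 1 / 2) * (u * u) by apply: mulr_gt0; lra.
  by lra.
have R1 : 0 < Re (h 1).
  apply: (@connected_locally_constant R `[0, 1]%classic (fun t => 0 < Re (h t)) 0 1).
  - exact: segment_connected.
  - move=> t; rewrite /= in_itv /= => t01; have [ch _] := H _ t01.
    have cR : {for t, continuous (fun s => Re (h s))}.
      by apply: (@continuous_comp _ _ _ h (@Re R : C -> R)) => //; exact: continuous_Re.
    have /orP[Rp|Rm] : (Re (h t) < 0) || (0 < Re (h t)) by rewrite -neq_lt Rn.
    + have N : \forall s \near t, Re (h s) < 0 by exact: (cR _ (lt_nbhsl Rp)).
      apply: filterS N => s hs _.
      by split => H'; lra.
    + have N : \forall s \near t, 0 < Re (h s) by exact: (cR _ (lt_nbhsr Rm)).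
      apply: filterS N => s hs _.
      by split => H'; lra.
  - by rewrite /= in_itv /= lexx ler01.
  - by rewrite /= in_itv /= lexx ler01.
  - by rewrite h0 /= ltr01.
have [_ E] := H 1 ltac:(by rewrite lexx ler01).
have /eqP : h 1 ^+ 2 = eta ^+ 2 by rewrite E subrr rmorph0 rmorph1 mul1r add0r.
rewrite eqf_sqr => /orP[/eqP//|/eqP E']; exfalso.
by move: R1 e0; rewrite E'; case: (eta) => u v /=; lra.
Qed.

Definition path_in (T : topologicalType) (A : set T) (x y : T) :=
  exists g : R -> T, [/\ continuous g, g 0 = x, g 1 = y & forall t, A (g t)].

(** Retraction of the line onto the unit interval. It turns paths that are given
    on the unit interval into maps defined on the whole line. *)
Definition clamp (t : R) : R := Num.max 0 (Num.min t 1).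

Lemma continuous_clamp : continuous clamp.
Proof.
move=> t; apply: (@continuous_max R R (fun=> 0) (fun t => Num.min t 1)).
- exact: cvg_cst.
- by apply: (@continuous_min R R id (fun=> 1)); [exact: cvg_id|exact: cvg_cst].
Qed.

Lemma clamp_id t : 0 <= t <= 1 -> clamp t = t.
Proof. by move=> /andP[t0 t1]; rewrite /clamp (min_idPl t1) (max_idPr t0). Qed.

Lemma clamp_lt0 t : t <= 0 -> clamp t = 0.
Proof. by move=> t0; rewrite /clamp (min_idPl _) ?(max_idPl t0) // (le_trans t0). Qed.

Lemma clamp_gt1 t : 1 <= t -> clamp t = 1.
Proof. by move=> t1; rewrite /clamp (min_idPr t1) (max_idPr _). Qed.

Lemma clamp01 t : 0 <= clamp t <= 1.
Proof. by rewrite /clamp le_max lexx /= ge_max ler01 ge_min lexx orbT. Qed.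

(** For a path P from c + u to c + v this is the closed curve, on the interval from
    0 to 3, that leaves c along u, follows P and returns to c along v. The single
    formula, where clamps switch the straight pieces on and off, makes continuity
    immediate. *)
Definition loop_through (P : R -> C) (u v : C) (s : R) : C :=
  P (clamp (s - 1)) - (1 - clamp s)%:C * u - (clamp (s - 2))%:C * v.

Section Loop.
Variables (P : R -> C) (c u v : C).
Hypotheses (cP : continuous P) (P0 : P 0 = c + u) (P1 : P 1 = c + v).
Local Notation g := (loop_through P u v).

Lemma loop_through_out s : 0 <= s <= 1 -> g s = c + s%:C * u.
Proof.
move=> s01; rewrite /loop_through (clamp_id s01) !clamp_lt0; [|lra..].
have -> : (1 - s)%:C = 1 - s%:C :> C by rewrite rmorphB rmorph1.
by rewrite P0 rmorph0; ring.
Qed.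

Lemma loop_through_mid s : 1 <= s <= 2 -> g s = P (s - 1).
Proof.
move=> s01; rewrite /loop_through (clamp_gt1 (t := s)) ?(clamp_lt0 (t := s - 2)); [|lra..].
by rewrite clamp_id; [rewrite subrr !mul0r !subr0|lra].
Qed.

Lemma loop_through_back s : 2 <= s <= 3 -> g s = c + (3 - s)%:C * v.
Proof.
move=> s01; rewrite /loop_through (clamp_gt1 (t := s)) ?(clamp_gt1 (t := s - 1)); [|lra..].
rewrite clamp_id ?P1 ?subrr; [|lra].
have -> : (3 - s)%:C = 1 - (s - 2)%:C :> C.
  by rewrite -(rmorph1 (real_complex R)) -rmorphB; congr (_%:C); lra.
by rewrite rmorph0; ring.
Qed.

Lemma continuous_loop_through : continuous g.
Proof.
move=> s.
have cl (a : R) : {for s, continuous (fun s => clamp (s - a))}.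
  apply: (@continuous_comp R R R (fun s => s - a)); last exact: continuous_clamp.
  by apply: (@cvgB _ _ _ (nbhs s)); [exact: cvg_id|exact: cvg_cst].
suff : {for s, continuous (fun s : R => P (clamp (s - 1)) - (1 - clamp s)%:C * u
    - (clamp (s - 2))%:C * v)} by [].
apply: contC_sub; [apply: contC_sub|].
- by apply: (@continuous_comp R R C); [exact: cl|exact: cP].
- apply: contC_mul; last exact: contC_const.
  apply: contC_real; apply: (@cvgB _ _ _ (nbhs s)); first exact: cvg_cst.
  exact: continuous_clamp.
- by apply: contC_mul; [apply: contC_real; exact: cl|exact: contC_const].
Qed.

Lemma loop_through_in (X : set C) s :
  (forall t, X (P t)) -> (forall t : R, 0 < t <= 1 -> X (c + t%:C * u)) ->
  (forall t : R, 0 < t <= 1 -> X (c + t%:C * v)) -> 0 < s < 3 -> X (g s).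
Proof.
move=> XP Xu Xv s03; have [s1|s1] := lerP s 1.
  by rewrite loop_through_out; [apply: Xu|]; lra.
have [s2|s2] := lerP s 2; first by rewrite loop_through_mid //; lra.
by rewrite loop_through_back; [apply: Xv|]; lra.
Qed.

Lemma loop_through_0 : g 0 = c.
Proof. by rewrite loop_through_out ?rmorph0 ?mul0r ?addr0 // lexx ler01. Qed.

Lemma loop_through_3 : g 3 = c.
Proof. by rewrite loop_through_back ?subrr ?rmorph0 ?mul0r ?addr0 //; lra. Qed.

End Loop.

Lemma unit_Im_inv (k : C) : cabs k = 1 -> Im k^-1 = - Im k.
Proof.
move=> k1; have : Re k ^+ 2 + Im k ^+ 2 = 1 by rewrite -sqr_cabs k1 expr1n.
by case: k {k1} => x y /= ->; rewrite invr1 mulr1.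
Qed.

Lemma Re_iM (z : C) : Re ('i * z) = - Im z.
Proof. by case: z => x y /=; rewrite mul0r mul1r sub0r. Qed.

(** Two loops through c, inside X and Y except at c, whose four branches at c
    alternate (directions v, v k^2, v k^4, v k^6 with k of small argument), cannot have
    X and Y disjoint. Otherwise the difference Phi (s, t) of the two loops vanishes
    only at the corners of the square with side 3; cut off the corners and take a
    square root r of Phi on the remaining octagon, which is star-shaped. On opposite
    sides of the square Phi takes the same values, since both loops begin and end at
    c, so the quotient of the two roots is constant there; along the four cut corners
    Phi moves on a segment, and r is multiplied by an explicit number given by
    half_plane_root. Going around, these relations contradict each other by a sign,
    which says that Phi would wind an odd number of times around 0. *)
Theorem crossing_loops_meet (c v k : C) (X Y : set C) :
  v != 0 -> cabs k = 1 -> 0 < Im k -> 0 < Im (k ^+ 3) ->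
  X `&` Y = set0 -> ~ X c -> ~ Y c ->
  (forall s : R, 0 < s <= 1 -> [/\ X (c + s%:C * v), X (c + s%:C * (v * k ^+ 4)),
     Y (c + s%:C * (v * k ^+ 2)) & Y (c + s%:C * (v * k ^+ 6))]) ->
  path_in X (c + v) (c + v * k ^+ 4) ->
  path_in Y (c + v * k ^+ 2) (c + v * k ^+ 6) -> False.
Proof.
move=> v0 k1 ik ik3 XY Xc Yc seg [P [cP P0 P1 PX]] [Q [cQ Q0 Q1 QY]].
set up := v in P0 *; set um := v * k ^+ 4 in P1 seg; set wp := v * k ^+ 2 in Q0 seg.
set wm := v * k ^+ 6 in Q1 seg.
pose gX := loop_through P up um; pose gY := loop_through Q wp wm.
pose Phi (z : R * R) : C := gX z.1 - gY z.2.
have XgX (s : R) : 0 < s < 3 -> X (gX s).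
  by move=> s03; apply: (loop_through_in P0 P1 PX _ _ s03) => t t01; have [] := seg t t01.
have YgY (s : R) : 0 < s < 3 -> Y (gY s).
  by move=> s03; apply: (loop_through_in Q0 Q1 QY _ _ s03) => t t01; have [] := seg t t01.
have gX0 : gX 0 = c := loop_through_0 um P0. have gX3 : gX 3 = c := loop_through_3 up P1.
have gY0 : gY 0 = c := loop_through_0 wm Q0. have gY3 : gY 3 = c := loop_through_3 wp Q1.
pose O : set (R * R) := [set z | [/\ 0 <= z.1 <= 3, 0 <= z.2 <= 3,
  1 <= z.1 + z.2 <= 5 & - 2 <= z.1 - z.2 <= 2]].
have cPhi : continuous Phi.
  move=> z; suff : {for z, continuous (fun z : R * R => gX z.1 - gY z.2)} by [].
  apply: contC_sub; apply: (@continuous_comp _ R C).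
  - exact: cvg_fst.
  - exact: (@continuous_loop_through P up um cP).
  - exact: cvg_snd.
  - exact: (@continuous_loop_through Q wp wm cQ).
have Phi0 z : O z -> Phi z != 0.
  case: z => s t [/= hs ht hst hst']; rewrite subr_eq0; apply/eqP => E.
  have [/andP[s0 s3]|] := boolP (0 < s < 3).
  - have Xs := XgX s ltac:(by rewrite s0 s3).
    have [/andP[t0 t3]|] := boolP (0 < t < 3).
      have Yt := YgY t ltac:(by rewrite t0 t3).
      by move: Yt; rewrite -E => Yt; have : (X `&` Y) (gX s) by []; rewrite XY.
    rewrite negb_and -!leNgt => /orP[t0|t3].
    + by apply: Xc; rewrite -gY0; have <- : t = 0 by [lra]; rewrite -E.
    + by apply: Xc; rewrite -gY3; have <- : t = 3 by [lra]; rewrite -E.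
  - rewrite negb_and -!leNgt => hs'.
    have Yt : Y (gY t) by apply: YgY; case/orP: hs' => ?; lra.
    case/orP: hs' => [s0|s3].
    + by apply: Yc; rewrite -gX0; have <- : s = 0 by [lra]; rewrite E.
    + by apply: Yc; rewrite -gX3; have <- : s = 3 by [lra]; rewrite E.
have cO : compact O.
  have cI : compact (`[0 : R, 3]%classic `*` `[0 : R, 3]%classic).
    by apply: compact_setX; exact: segment_compact.
  apply: (subclosed_compact _ cI); last first.
    by move=> z [] h1 h2 _ _; split; rewrite /= in_itv.
  have cF (h : R * R -> R) (a b : R) : continuous h -> closed [set z | a <= h z <= b].
    move=> ch; rewrite (_ : mkset _ = h @^-1` `[a, b]%classic).
      by apply: closed_comp; [move=> z _; exact: ch|exact: itv_closed].
    by apply/seteqP; split=> z /=; rewrite in_itv.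
  rewrite (_ : O = [set z | 0 <= z.1 <= 3] `&` [set z | 0 <= z.2 <= 3] `&`
    ([set z | 1 <= z.1 + z.2 <= 5] `&` [set z | - 2 <= z.1 - z.2 <= 2])); last first.
    by apply/seteqP; split=> z [] => [|[] ? ? []].
  apply: closedI; apply: closedI; apply: cF => z.
  - exact: cvg_fst.
  - exact: cvg_snd.
  - by apply: (@cvgD _ _ _ (nbhs z)); [exact: cvg_fst|exact: cvg_snd].
  - by apply: (@cvgB _ _ _ (nbhs z)); [exact: cvg_fst|exact: cvg_snd].
pose p : R * R := (3 / 2, 3 / 2).
have Op : O p by split; rewrite /=; lra.
have starO z (t : R) : O z -> 0 <= t <= 1 -> O (p + t *: (z - p)).
  case: z => x y [/= /andP[? ?] /andP[? ?] /andP[? ?] /andP[? ?]] /andP[? ?].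
  by split; rewrite /= /GRing.scale /=; apply/andP; split; nra.
pose r0 : C := 2.-root (Phi p).
have r0E : r0 ^+ 2 = Phi p by rewrite /r0 rootCK.
have [r _ Hr] := continuous_root_star cO Op starO cPhi Phi0 (isT : (0 < 2)%N) r0E.
have rn z : O z -> r z != 0.
  by move=> Oz; have [_] := Hr z Oz; apply: contra_eq_neq => ->; rewrite expr0n eq_sym Phi0.
have cpair (h1 h2 : R -> R) t : {for t, continuous h1} -> {for t, continuous h2} ->
    O (h1 t, h2 t) -> {for t, continuous (fun s => r (h1 s, h2 s))}.
  move=> c1 c2 Ot; have [cr _] := Hr _ Ot.
  by apply: (@continuous_comp R (R * R)%type C (fun s => (h1 s, h2 s))); [exact: (cvg_pair c1 c2)|exact: cr].
have rootP z : O z -> r z ^+ 2 = Phi z by move=> /Hr[].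
have clin (a b t : R) : {for t, continuous (fun s : R => a + b * s)}.
  apply: (@cvgD _ _ _ (nbhs t)); first exact: cvg_cst.
  by apply: (@cvgM _ _ (nbhs t)); [exact: cvg_cst|exact: cvg_id].
(* Along a cut corner Phi is an affine function of the parameter. *)
have corner (a1 b1 a2 b2 : R) (eta : C) (w : C) :
    (forall t : R, 0 <= t <= 1 -> O (a1 + b1 * t, a2 + b2 * t)) ->
    w != 0 -> 0 < Re eta ->
    (forall t : R, 0 <= t <= 1 -> Phi (a1 + b1 * t, a2 + b2 * t)
        = w * ((1 - t)%:C + t%:C * eta ^+ 2)) ->
    r (a1 + b1, a2 + b2) = eta * r (a1, a2).
  move=> HO w0 He HP.
  have O0 : O (a1, a2) by have := HO 0; rewrite !mulr0 !addr0; apply; rewrite lexx ler01.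
  have E0 : r (a1, a2) ^+ 2 = w.
    have := HP 0; rewrite !mulr0 !addr0 rootP // => -> //; last by rewrite lexx ler01.
    by rewrite subr0 rmorph0 rmorph1; ring.
  have := @half_plane_root (fun t => r (a1 + b1 * t, a2 + b2 * t) / r (a1, a2)) eta He.
  rewrite !mulr0 !addr0 !mulr1 divff ?rn // => /(_ erefl) H.
  rewrite -H ?divfK ?rn // => t t01; split.
    apply: contC_mul; last exact: contC_const.
    by apply: cpair; [exact: clin|exact: clin|exact: HO].
  rewrite expr_div_n E0 rootP; last exact: HO.
  by rewrite HP; [rewrite mulrC mulKf|exact: t01].
have side (f1 f2 h1 h2 : R -> R) : (forall t, {for t, continuous f1}) ->
    (forall t, {for t, continuous f2}) -> (forall t, {for t, continuous h1}) ->
    (forall t, {for t, continuous h2}) ->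
    (forall t, 1 <= t <= 2 -> [/\ O (f1 t, f2 t), O (h1 t, h2 t) &
        Phi (f1 t, f2 t) = Phi (h1 t, h2 t)]) ->
    r (f1 1, f2 1) * r (h1 2, h2 2) = r (h1 1, h2 1) * r (f1 2, f2 2).
  move=> cf1 cf2 ch1 ch2 HO.
  apply: (@root_unique R (fun t => r (f1 t, f2 t)) (fun t => r (h1 t, h2 t)) `[1, 2]%classic 2 1 2).
  - by [].
  - exact: segment_connected.
  - by rewrite /= in_itv /= lexx; lra.
  - by rewrite /= in_itv /= lexx; lra.
  - move=> t; rewrite /= in_itv /= => t12; have [in1 in2 E] := HO t t12; split.
    + exact: cpair.
    + exact: cpair.
    + exact: rn.
    + by rewrite !rootP.
have cst (a t : R) : {for t, continuous (fun=> a : R)} by exact: cvg_cst.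
have cid t : {for t, continuous (@idfun R)} by exact: cvg_id.
(* The horizontal and vertical pairs of opposite sides. *)
have SH : r (0, 1) * r (3, 2) = r (3, 1) * r (0, 2).
  apply: (side (fun=> 0) id (fun=> 3) id) => // t t12.
  by split; [split; rewrite /=; lra|split; rewrite /=; lra|rewrite /Phi /= gX0 gX3].
have SV : r (1, 0) * r (2, 3) = r (1, 3) * r (2, 0).
  apply: (side id (fun=> 0) id (fun=> 3)) => // t t12.
  by split; [split; rewrite /=; lra|split; rewrite /=; lra|rewrite /Phi /= gY0 gY3].
have k0 : k != 0 by rewrite -cabs_gt0 k1 ltr01.
have RC t : (1 - t)%:C = 1 - t%:C :> C by rewrite rmorphB rmorph1.
have i2 : ('i : C) * 'i = -1 by rewrite -expr2; exact: sqr_i.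
have i2x (z : C) : ('i * z) ^+ 2 = - z ^+ 2 by rewrite exprMn expr2 i2 mulN1r.
have um0 : um != 0 by rewrite mulf_neq0 ?expf_neq0.
have wm0 : - wm != 0 by rewrite oppr_eq0 mulf_neq0 ?expf_neq0.
(* The four cut corners. The two neighbors of a corner have a quotient of
   directions k ^ 2, k ^ -2 or k ^ -6, up to sign; its root is chosen with positive
   real part. *)
have H1 : r (0, 1) = - ('i * k) * r (1, 0).
  have := @corner 1 (-1) 0 1 (- ('i * k)) up; rewrite subrr add0r; apply.
  - by move=> t t01; split; rewrite /=; lra.
  - exact: v0.
  - by rewrite raddfN /= Re_iM opprK.
  - move=> t t01; rewrite sqrrN i2x /Phi /= !(mulN1r, mul1r, add0r) /gX /gY.
    rewrite (loop_through_out um P0) ?(loop_through_out wm Q0) //; last by lra.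
    by rewrite /up /wp !RC; ring.
have H2 : r (3, 1) = 'i * k^-1 * r (2, 0).
  have := @corner 2 1 0 1 ('i * k^-1) um; rewrite add0r (_ : 2 + 1 = 3); last by lra.
  apply.
  - by move=> t t01; split; rewrite /=; lra.
  - exact: um0.
  - by rewrite Re_iM unit_Im_inv // opprK.
  - move=> t t01; rewrite i2x /Phi /= !(mul1r, add0r) /gX /gY.
    rewrite (loop_through_back up P1) ?(loop_through_out wm Q0) //; last by lra.
    have -> : 3 - (2 + t) = 1 - t by lra.
    by rewrite /um /wp !RC; field.
have H3 : r (2, 3) = 'i * k^-1 * r (3, 2).
  have := @corner 3 (-1) 2 1 ('i * k^-1) (- wm).
  rewrite (_ : 2 + 1 = 3) 1?(_ : 3 - 1 = 2); [|lra..].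
  apply.
  - by move=> t t01; split; rewrite /=; lra.
  - exact: wm0.
  - by rewrite Re_iM unit_Im_inv // opprK.
  - move=> t t01; rewrite i2x /Phi /= !(mul1r, mulN1r) /gX /gY.
    rewrite (loop_through_back up P1) ?(loop_through_back wp Q1); [|lra..].
    have -> : 3 - (2 + t) = 1 - t by lra.
    have -> : 3 - (3 - t) = t by lra.
    by rewrite /um /wm !RC; field.
have H4 : r (1, 3) = 'i * (k ^+ 3)^-1 * r (0, 2).
  have := @corner 0 1 2 1 ('i * (k ^+ 3)^-1) (- wm).
  rewrite add0r (_ : 2 + 1 = 3); last by lra.
  apply.
  - by move=> t t01; split; rewrite /=; lra.
  - exact: wm0.
  - by rewrite Re_iM unit_Im_inv ?opprK // cabsX k1 expr1n.
  - move=> t t01; rewrite i2x /Phi /= !(mul1r, add0r) /gX /gY.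
    rewrite (loop_through_out um P0) ?(loop_through_back wp Q1) //; [|lra..].
    have -> : 3 - (2 + t) = 1 - t by lra.
    by rewrite /up /wm !RC; field.
have O10 : O (1, 0) by split; rewrite /=; lra.
have O32 : O (3, 2) by split; rewrite /=; lra.
have O20 : O (2, 0) by split; rewrite /=; lra.
have O02 : O (0, 2) by split; rewrite /=; lra.
move: SH SV; rewrite H1 H2 H3 H4.
move: (rn _ O10) (rn _ O32) (rn _ O20) (rn _ O02).
move: (r (1, 0)) (r (3, 2)) (r (2, 0)) (r (0, 2)) => A D B G A0 D0 B0 G0 E1 E2.
have : (- ('i * k) * A * D) * ('i / k ^+ 3 * G * B) = ('i / k * B * G) * (A * ('i / k * D)).
  by rewrite E1 E2.
have -> : (- ('i * k) * A * D) * ('i / k ^+ 3 * G * B) = - ('i * 'i) * (A * D * B * G) / k ^+ 2.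
  by field.
have -> : ('i / k * B * G) * (A * ('i / k * D)) = ('i * 'i) * (A * D * B * G) / k ^+ 2.
  by field.
rewrite i2 opprK mul1r mulN1r mulNr => /eqP; rewrite -subr_eq0 opprK -mulr2n mulrn_eq0 /=.
by rewrite !mulf_eq0 invr_eq0 expf_eq0 (negPf A0) (negPf D0) (negPf B0) (negPf G0) (negPf k0).
Qed.

End Crossing.

(** * Joining points by paths *)

Section Paths.
Variables (R : realType) (T : topologicalType).
Implicit Types (A B : set T) (x y z : T).

Lemma path_in_sub A B x y : A `<=` B -> path_in R A x y -> path_in R B x y.
Proof. by move=> AB [g [cg g0 g1 gA]]; exists g; split=> // t; apply/AB/gA. Qed.

Lemma path_in_ends A x y : path_in R A x y -> A x /\ A y.
Proof. by move=> [g [_ <- <- gA]]. Qed.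

Lemma path_in_refl A x : A x -> path_in R A x x.
Proof. by move=> Ax; exists (fun=> x); split=> //; exact: cst_continuous. Qed.

Lemma path_in_sym A x y : path_in R A x y -> path_in R A y x.
Proof.
move=> [g [cg g0 g1 gA]]; exists (fun t => g (1 - t)).
split=> //; rewrite ?subr0 ?subrr // => t.
apply: (@continuous_comp R R T (fun t => 1 - t)); last exact: cg.
by apply: (@cvgB _ _ _ (nbhs t)); [exact: cvg_cst|exact: cvg_id].
Qed.

Lemma continuous_affine (a b : R) : continuous (fun t : R => a * t + b).
Proof.
move=> t; apply: (@cvgD _ _ _ (nbhs t)); last exact: cvg_cst.
by apply: (@cvgM _ _ (nbhs t)); [exact: cvg_cst|exact: cvg_id].
Qed.

Lemma path_in_trans A y x z : path_in R A x y -> path_in R A y z -> path_in R A x z.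
Proof.
move=> [f [cf f0 f1 fA]] [g [cg g0 g1 gA]].
exists (fun t => if t <= 1 / 2 then f (2 * t + 0) else g (2 * t + (- 1))); split.
- apply: continuous_glue => [t|t|].
  + by apply: (@continuous_comp R R T); [exact: continuous_affine|exact: cf].
  + by apply: (@continuous_comp R R T); [exact: continuous_affine|exact: cg].
  + by rewrite addr0 mul1r mulfV ?pnatr_eq0 // subrr f1 g0.
- by rewrite mulr0 addr0 ifT // divr_ge0.
- rewrite ifF; last by apply/negbTE; rewrite -ltNge; lra.
  by rewrite -g1; congr g; lra.
- by move=> t; case: ifP.
Qed.

(** Infinitely many paths, the k-th one inside A k, run through one after the other
    at increasing speed. Since the A k shrink to x, the concatenation extends
    continuously by x at time 1. *)
Lemma path_in_limit (A : nat -> set T) (q : nat -> T) x :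
  (forall k, path_in R (A k) (q k) (q k.+1)) ->
  (forall k, A k.+1 `<=` A k) -> A 0%N x ->
  (forall O, nbhs x O -> exists k, A k `<=` O) ->
  path_in R (A 0%N) (q 0%N) x.
Proof.
move=> H dec Ax base.
have [p Hp] := choice H.
have decn k m : (k <= m)%N -> A m `<=` A k.
  elim: m => [|m IH]; first by rewrite leqn0 => /eqP ->.
  by rewrite leq_eqVlt => /orP[/eqP -> //|/IH km] y /dec/km.
have pA n t : A n (p n t) by have [_ _ _] := Hp n; exact.
(* G n runs through the first n + 1 paths on consecutive unit intervals. *)
pose G := fix G n (s : R) : T := if n is m.+1 then
   (if s <= m.+1%:R then G m s else p m.+1 (s - m.+1%:R)) else p 0%N s.
have Gn n : G n n.+1%:R = q n.+1.
  case: n => [|n]; first by rewrite /=; have [_ _ -> _] := Hp 0%N.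
  rewrite /= ifF; last by apply/negbTE; rewrite -ltNge ltr_nat.
  by rewrite -(natr1 n.+1) addrC addKr; have [_ _ -> _] := Hp n.+1.
have cG n : continuous (G n).
  elim: n => [|n IH]; first by have [c _ _ _] := Hp 0%N.
  apply: (@continuous_glue R T (G n) (fun s => p n.+1 (s - n.+1%:R)) n.+1%:R) => //.
    2: by rewrite subrr Gn; have [_ -> _] := Hp n.+1.
  move=> t; apply: (@continuous_comp R R T (fun s => s - n.+1%:R)); last first.
    by have [c _ _ _] := Hp n.+1; exact: c.
  by apply: (@cvgB _ _ _ (nbhs t)); [exact: cvg_id|exact: cvg_cst].
have Geq n m s : (n <= m)%N -> s <= n.+1%:R -> G m s = G n s.
  elim: m => [|m IH]; first by rewrite leqn0 => /eqP ->.
  rewrite leq_eqVlt => /orP[/eqP -> //|nm] sn /=.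
  by rewrite ifT ?IH // (le_trans sn) // ler_nat.
have GA n k s : (k <= n)%N -> k%:R <= s -> A k (G n s).
  elim: n s => [|n IH] s kn ks.
    by move: kn; rewrite leqn0 => /eqP ->; exact: pA.
  rewrite /=; case: ifPn => sn; last by apply: (decn _ _ kn); exact: pA.
  move: kn; rewrite leq_eqVlt => /orP[/eqP kE|kn]; last exact: IH.
  have -> : s = n.+1%:R by apply/eqP; rewrite eq_le sn -kE ks.
  by rewrite Gn kE; have [_ <- _ _] := Hp n.+1; exact: pA.
have GA0 n s : A 0%N (G n s).
  elim: n s => [|n IH] s /=; first exact: pA.
  by case: ifP => // _; apply: (decn _ _ (leq0n _)); exact: pA.
pose F (s : R) := G (Num.truncn s) s.
have FG n s : s < n%:R -> F s = G n s.
  move=> sn; rewrite /F; apply/esym/Geq; last by rewrite ltW // truncnS_gt.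
  by rewrite truncn_le_nat (lt_trans sn) // ltr_nat.
(* The reparametrization t / (1 - t) maps [0, 1[ onto the half line. *)
exists (fun t => if t < 1 then F (t / (1 - t)) else x); split.
- apply: continuous_forall => t; have [t1|t1] := ltrP t 1.
  + pose n := (Num.truncn (t / (1 - t))).+1.
    have cd : {for t, continuous (fun t : R => t / (1 - t))}.
      apply: (@cvgM _ _ (nbhs t)); first exact: cvg_id.
      apply: (@cvgV _ _ (nbhs t)); first by rewrite subr_eq0 gt_eqF.
      by apply: (@cvgB _ _ _ (nbhs t)); [exact: cvg_cst|exact: cvg_id].
    apply: (@continuous_near_eq R T (fun t => G n (t / (1 - t)))).
      by apply: (@continuous_comp R R T (fun t => t / (1 - t))); [exact: cd|exact: cG].
    have N1 : \forall s \near t, s < 1 by exact: lt_nbhsl.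
    have N2 : \forall s \near t, s / (1 - s) < n%:R.
      by apply: (cd [set u | u < n%:R]); apply: lt_nbhsl; rewrite truncnS_gt.
    by apply: filterS2 N1 N2 => s -> /FG ->.
  + move=> O; rewrite ltNge t1 /= => Ox; have [k AO] := base O Ox.
    have N1 : \forall s \near t, 1 - k.+1%:R^-1 < s.
      apply: lt_nbhsr; apply: lt_le_trans t1; rewrite ltrBlDr ltrDl invr_gt0 ltr0n //.
    apply: filterS N1 => s ks /=; case: ifP => s1; last first.
      by apply: nbhs_singleton Ox.
    apply: AO; rewrite (FG (maxn k (Num.truncn (s / (1 - s))).+1)).
      apply: GA; first exact: leq_maxl.
      have s1' : 0 < 1 - s by lra.
      rewrite ler_pdivlMr //.
      have k0 : 0 < k.+1%:R :> R by rewrite ltr0n.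
      have : (1 - s) * k.+1%:R < 1 by rewrite -ltr_pdivlMr // div1r ltrBlDl -ltrBlDr.
      by rewrite -(natr1 k) mulrDr mulr1 [k%:R * _]mulrC; lra.
    apply: lt_le_trans (truncnS_gt _) _; by rewrite ler_nat leq_maxr.
- rewrite ltr01 mul0r /F truncn0 /=; by have [_ -> _] := Hp 0%N.
- by rewrite ltxx.
- by move=> t; case: ifP => // _; exact: GA0.
Qed.

End Paths.

Section PlanePaths.
Variable R : realType.
Local Notation C := (cplx R).
Implicit Types (z w : C).

Lemma path_in_segment (A : set C) z w :
  (forall t : R, 0 <= t <= 1 -> A (z + t%:C * (w - z))) -> path_in R A z w.
Proof.
move=> H; exists (fun t => z + (clamp t)%:C * (w - z)); split.
- apply: continuous_forall => t; apply: contC_add; first exact: contC_const.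
  apply: contC_mul; last exact: contC_const.
  by apply: contC_real; exact: continuous_clamp.
- by rewrite clamp_lt0 // rmorph0 mul0r addr0.
- by rewrite clamp_gt1 // rmorph1 mul1r addrC subrK.
- by move=> t; apply: H; exact: clamp01.
Qed.

Lemma cabs_convex z w (t : R) r : 0 <= t <= 1 -> cabs z < r -> cabs w < r ->
  cabs (z + t%:C * (w - z)) < r.
Proof.
move=> /andP[t0 t1] zr wr.
have -> : z + t%:C * (w - z) = (1 - t)%:C * z + t%:C * w.
  by rewrite rmorphB rmorph1; ring.
apply: (le_lt_trans (cabsD _ _)); rewrite !cabsM !cabsR !ger0_norm ?subr_ge0 //.
have h1 : 0 <= (1 - t) * (Num.max (cabs z) (cabs w) - cabs z).
  by rewrite mulr_ge0 ?subr_ge0 // le_max lexx.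
have h2 : 0 <= t * (Num.max (cabs z) (cabs w) - cabs w).
  by rewrite mulr_ge0 ?subr_ge0 // le_max lexx orbT.
have : Num.max (cabs z) (cabs w) < r by rewrite gt_max zr.
by move: h1 h2; rewrite !mulrBr; lra.
Qed.

Lemma path_in_ball (A : set C) z w e :
  (forall u, cabs (u - z) < e -> A u) -> cabs (w - z) < e -> path_in R A z w.
Proof.
move=> H wz; apply: path_in_segment => t t01; apply: H.
have e0 : 0 < e := le_lt_trans (cabs_ge0 _) wz.
have -> : z + t%:C * (w - z) - z = 0 + t%:C * (w - z - 0) by ring.
by apply: cabs_convex => //; rewrite cabs0.
Qed.

(** The segment from a to b works unless v lies on it. In that case bend it
    sideways by a quadratic arc, flat enough to stay in the disk: off its ends the arc
    leaves the line through a and b. *)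
Lemma path_in_disk_minus_point (a b v : C) :
  cabs a < 1 -> cabs b < 1 -> a <> v -> b <> v ->
  path_in R [set z | cabs z < 1 /\ z <> v] a b.
Proof.
move=> a1 b1 av bv.
have [<-|ab] := eqVneq a b; first exact: path_in_refl.
(* h is the height of the arc, relative to the chord. *)
pose arc (h t : R) : C := a + (b - a) * Complex t (h * (t * (1 - t))).
have carc h : continuous (arc h).
  apply: continuous_forall => t; apply: contC_add; first exact: contC_const.
  apply: contC_mul; first exact: contC_const.
  apply: (@cvg_Complex R R (nbhs t)); first exact: cvg_id.
  apply: (@cvgM _ _ (nbhs t)); first exact: cvg_cst.
  apply: (@cvgM _ _ (nbhs t)); first exact: cvg_id.
  by apply: (@cvgB _ _ _ (nbhs t)); [exact: cvg_cst|exact: cvg_id].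
have key h : (forall t, 0 <= t <= 1 -> cabs (arc h t) < 1) ->
   (forall t, 0 <= t <= 1 -> arc h t <> v) -> path_in R [set z | cabs z < 1 /\ z <> v] a b.
  move=> h1 h2; exists (fun t => arc h (clamp t)); split.
  - by move=> t; apply: (@continuous_comp R R C); [exact: continuous_clamp|exact: carc].
  - by rewrite clamp_lt0 // /arc mul0r mulr0 mulr0 addr0.
  - rewrite clamp_gt1 // /arc subrr !mulr0.
    by have -> : Complex 1 0 = 1 :> C by []; rewrite mulr1 addrC subrK.
  - by move=> t; split; [apply/h1/clamp01|apply/h2/clamp01].
have ba : b - a != 0 by rewrite subr_eq0 eq_sym.
pose tau := (v - a) / (b - a).
have arcv h t : arc h t = v -> t = Re tau /\ h * (t * (1 - t)) = Im tau.
  move=> E; suff -> : tau = Complex t (h * (t * (1 - t))) by [].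
  by rewrite /tau -E /arc; field.
have [tau0|tau0] := eqVneq (Im tau) 0; last first.
  apply: (key 0) => t t01.
  - have -> : arc 0 t = a + t%:C * (b - a) by rewrite /arc mul0r mulrC.
    exact: cabs_convex.
  - by move=> /arcv[_]; rewrite mul0r => /esym/eqP; rewrite (negPf tau0).
have m0 : 0 < 1 - Num.max (cabs a) (cabs b) by rewrite subr_gt0 gt_max a1.
have d0 : 0 < cabs (b - a) by rewrite cabs_gt0.
pose h := (1 - Num.max (cabs a) (cabs b)) / (2 * cabs (b - a)).
have h0 : 0 < h by rewrite divr_gt0 // mulr_gt0.
apply: (key h) => t t01.
- have -> : arc h t = (a + t%:C * (b - a)) + (h * (t * (1 - t)))%:C * ('i * (b - a)).
    rewrite /arc (_ : Complex t _ = t%:C + 'i * (h * (t * (1 - t)))%:C); last exact: complexE.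
    by ring.
  apply: (le_lt_trans (cabsD _ _)); rewrite cabsM cabsM.
  have -> : cabs ('i : C) = 1 by rewrite /cabs /= expr0n expr1n add0r sqrtr1.
  rewrite mul1r cabsR ger0_norm; last by apply: mulr_ge0; [exact: ltW|apply: mulr_ge0; lra].
  have hb : h * (t * (1 - t)) * cabs (b - a) <= (1 - Num.max (cabs a) (cabs b)) / 2.
    have -> : h * (t * (1 - t)) * cabs (b - a) = (1 - Num.max (cabs a) (cabs b)) / 2 * (t * (1 - t)).
      by rewrite /h; field; rewrite gt_eqF.
    by apply: ler_piMr; [lra|nra].
  pose r := (1 + Num.max (cabs a) (cabs b)) / 2.
  have : cabs (a + t%:C * (b - a)) < r.
    have ma : cabs a <= Num.max (cabs a) (cabs b) by rewrite le_max lexx.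
    have mb : cabs b <= Num.max (cabs a) (cabs b) by rewrite le_max lexx orbT.
    by apply: cabs_convex; rewrite /r; lra.
  by rewrite /r; lra.
- move=> E; have [tE] := arcv _ _ E; rewrite tau0 => /eqP.
  rewrite mulf_eq0 (gt_eqF h0) /= mulf_eq0 => /orP[/eqP t0|/eqP t1].
  + by apply: av; rewrite -E /arc t0 mul0r mulr0 mulr0 addr0.
  + apply: bv; rewrite -E /arc t1 !mulr0 (_ : t = 1); last by lra.
    by have -> : Complex 1 0 = 1 :> C by []; rewrite mulr1 addrC subrK.
Qed.

(** Interpolate modulus and argument linearly, in polar coordinates. *)
Lemma path_in_annulus (A : set C) z w :
  (forall u, Num.min (cabs z) (cabs w) <= cabs u <= Num.max (cabs z) (cabs w) -> A u) ->
  path_in R A z w.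
Proof.
move=> H; have [x zE] := polar z; have [y wE] := polar w.
exists (fun t => ((1 - clamp t) * cabs z + clamp t * cabs w)%:C *
   cis ((1 - clamp t) * x + clamp t * y)); split.
- have cc (p q : R) : continuous (fun t => (1 - clamp t) * p + clamp t * q).
    move=> t; apply: (@cvgD _ _ _ (nbhs t)); apply: (@cvgM _ _ (nbhs t));
      try exact: cvg_cst; last exact: continuous_clamp.
    by apply: (@cvgB _ _ _ (nbhs t)); [exact: cvg_cst|exact: continuous_clamp].
  apply: continuous_forall => t; apply: contC_mul; first by apply: contC_real; exact: cc.
  by apply: (@cvg_cis _ _ (nbhs t)); exact: cc.
- by rewrite clamp_lt0 // subr0 !mul1r !mul0r !addr0 -zE.
- by rewrite clamp_gt1 // subrr !mul1r !mul0r !add0r -wE.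
- move=> t; apply: H; have := clamp01 t; move: (clamp t) => s s01.
  rewrite cabsM cabs_cis mulr1 cabsR; have := cabs_ge0 z; have := cabs_ge0 w => w0 z0.
  rewrite ger0_norm; last by nra.
  by rewrite ge_min le_max; have [zw|zw] := lerP (cabs z) (cabs w); apply/andP; split; apply/orP;
    [left|right|right|left]; nra.
Qed.

End PlanePaths.

(** * Finitely many levels of ramification *)

Section Levels.
Variable R : realType.
Local Notation C := (cplx R).
Implicit Types (z w : C).

(** The affine part of the disk or of the plane. Both are exhausted by closed disks
    around 0. *)
Definition centred_domain (D : set C) := D = [set z | cabs z < 1] \/ D = setT.

Lemma centred_domain_le (D : set C) z w : centred_domain D ->
  D w -> cabs z <= cabs w -> D z.
Proof. by case=> -> //=; move=> h1 h2; apply: le_lt_trans h1. Qed.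

Lemma centred_domain0 (D : set C) : centred_domain D -> D 0.
Proof. by case=> -> //; rewrite /= cabs0. Qed.

Lemma open_centred_domain (D : set C) : centred_domain D -> open D.
Proof.
case=> ->; last exact: openT.
rewrite (_ : mkset _ = cabs @^-1` [set x | x < 1]) //.
by apply: open_comp; [move=> z _; exact: continuous_cabs|exact: open_lt].
Qed.

Lemma cabs_within (A : set C) (h : C -> C) : (forall z, A z -> {for z, continuous h}) ->
  {within A, continuous (fun z => cabs (h z))}.
Proof.
move=> ch; apply: continuous_in_subspaceT => z; rewrite inE => /ch cz.
by apply: (@continuous_comp C C R) => //; exact: continuous_cabs.
Qed.

Lemma centred_domain_exhaust (D K : set C) : centred_domain D -> compact K ->
  K `<=` D -> exists q : R, (forall z, cabs z <= q -> D z) /\ (forall z, K z -> cabs z <= q).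
Proof.
move=> hD cK KD; have [[z0 Kz0]|K0] := pselect (K !=set0); last first.
  exists 0; split=> z; last by move=> Kz; case: K0; exists z.
  by move=> z0; apply: (centred_domain_le hD (centred_domain0 hD)); rewrite cabs0.
have := @compact_EVT_max C R cabs K _ cK _.
case; first by exists z0.
  by apply: (@cabs_within K id) => z _; exact: cvg_id.
move=> c; rewrite inE => Kc Hc; exists (cabs c); split=> z.
  by move=> zc; exact: centred_domain_le (KD _ Kc) zc.
by move=> Kz; apply: Hc; rewrite inE.
Qed.

Lemma closure_argmin (A : set C) (h : C -> C) : A !=set0 -> compact (closure A) ->
  (forall z, closure A z -> {for z, continuous h}) ->
  exists2 m, closure A m & forall z, A z -> cabs (h m) <= cabs (h z).
Proof.
move=> [p Ap] cA /cabs_within ch.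
have [|m /set_mem clm Hm] := compact_EVT_min _ cA ch.
  by exists p; exact: subset_closure.
by exists m => // z Az; apply/Hm/mem_set/subset_closure.
Qed.

Lemma closure_argmax (A : set C) (h : C -> C) : A !=set0 -> compact (closure A) ->
  (forall z, closure A z -> {for z, continuous h}) ->
  exists2 m, closure A m & forall z, A z -> cabs (h z) <= cabs (h m).
Proof.
move=> [p Ap] cA /cabs_within ch.
have [|m /set_mem clm Hm] := compact_EVT_max _ cA ch.
  by exists p; exact: subset_closure.
by exists m => // z Az; apply/Hm/mem_set/subset_closure.
Qed.

Variables (D : set C) (g : C -> C).
Hypothesis hD : centred_domain D.
Hypothesis gD : forall z, D z -> D (g z).
Hypothesis cg : forall z, D z -> {for z, continuous g}.
Hypothesis open_g : forall z (A : set C), D z -> nbhs z A ->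
  exists2 e : R, 0 < e & forall w, cabs (w - g z) < e -> exists2 z', A z' & g z' = w.
Hypothesis proper_g : forall K, compact K -> K `<=` D -> compact (D `&` g @^-1` K).
Hypothesis finite_zeros : finite_set (D `&` [set z | g z = 0]).

(** The map is g c + a (z - c) ^ e + o ((z - c) ^ e) near c; this is the
    form in which holomorphy enters the study of levels. *)
Definition ramified (c : C) := D c /\ exists e (a : C), [/\ (1 < e)%N, a != 0 &
  forall eps : R, 0 < eps -> \forall z \near c,
    cabs (g z - g c - a * (z - c) ^+ e) <= eps * cabs (z - c) ^+ e].

Definition below (r : R) : set C := [set z | D z /\ cabs (g z) < r].
Definition above (r : R) : set C := [set z | D z /\ r < cabs (g z)].

Lemma open_below r : open (below r).
Proof.
have oD := open_centred_domain hD.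
rewrite openE => z [Dz zr].
have N1 : \forall w \near z, D w by exact: open_nbhs_nbhs.
have cz : {for z, continuous (fun z => cabs (g z))}.
  by apply: (@continuous_comp C C R); [exact: cg|exact: continuous_cabs].
have N2 : \forall w \near z, cabs (g w) < r by exact: (cz _ (lt_nbhsl zr)).
by apply: filterS2 N1 N2.
Qed.

Lemma open_above r : open (above r).
Proof.
have oD := open_centred_domain hD.
rewrite openE => z [Dz zr].
have N1 : \forall w \near z, D w by exact: open_nbhs_nbhs.
have cz : {for z, continuous (fun z => cabs (g z))}.
  by apply: (@continuous_comp C C R); [exact: cg|exact: continuous_cabs].
have N2 : \forall w \near z, r < cabs (g w) by exact: (cz _ (lt_nbhsr zr)).
by apply: filterS2 N1 N2.
Qed.

(** In an open subset of the plane, path components are open and relatively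
    closed, because disks are path-connected. *)
Lemma reach_open (A : set C) p m : open A -> A m ->
  closure [set z | path_in R A p z] m ->
  path_in R A p m /\ \forall z \near m, path_in R A p z.
Proof.
move=> oA Am cm; have [e e0 He] := (open_CP A).1 oA m Am.
have [z [/= pz zm]] : [set z | path_in R A p z] `&` [set z | cabs (z - m) < e] !=set0.
  by apply: cm; apply/nbhsCP; exists e.
have pm : path_in R A p m.
  by apply: (path_in_trans pz); apply: path_in_sym; exact: path_in_ball He zm.
split=> //; apply/nbhsCP; exists e => // w wm.
by apply: (path_in_trans pm); exact: path_in_ball He wm.
Qed.

Lemma compact_sublevel c : D c -> compact (D `&` [set z | cabs (g z) <= cabs (g c)]).
Proof.
move=> Dc; apply: (proper_g (@compact_disk R (cabs (g c)))) => z /= zc.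
exact: centred_domain_le (gD Dc) zc.
Qed.

(** Minimum principle for the open map g: on the closure of the points reachable
    below the level of c, which is compact because g is proper, the modulus of g has a
    minimum. The minimum is attained at a reachable point, where openness of g would
    allow a smaller value unless it is 0. *)
Lemma reach_zero c p : D c -> below (cabs (g c)) p ->
  exists z, [/\ D z, g z = 0 & path_in R (below (cabs (g c))) p z].
Proof.
move=> Dc yp; set Y := below _ in yp *.
pose A := [set z | path_in R Y p z].
have AL : closure A `<=` D `&` [set z | cabs (g z) <= cabs (g c)].
  have cL := compact_closed (@hausdorff_C R) (compact_sublevel Dc).
  rewrite [X in _ `<=` X](closure_id _).1 //; apply: closure_subset => z Az.
  by have [_ [Dz zr]] := path_in_ends Az; split=> //; exact: ltW.
have cA : compact (closure A).
  by apply: subclosed_compact (compact_sublevel Dc) AL; exact: closed_closure.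
have Ap : A p by exact: path_in_refl.
have [||m clm Hm] := @closure_argmin A g _ cA.
- by exists p.
- by move=> z /AL[Dz _]; exact: cg.
have [Dm _] := AL m clm.
have Ym : Y m.
  by split=> //; have [_ pr] := yp; apply: le_lt_trans pr; exact: Hm.
have [pm nm] := reach_open (@open_below _) Ym clm.
exists m; split=> //; apply: contrapT => /eqP gm0.
have [e e0 He] := open_g Dm nm.
have gm : 0 < cabs (g m) by rewrite cabs_gt0.
pose s : R := Num.min (1 / 2) (e / (2 * cabs (g m))).
have s0 : 0 < s by rewrite lt_min !divr_gt0 ?mulr_gt0.
have s1 : s <= 1 / 2 by rewrite ge_min lexx.
have se : s * cabs (g m) < e.
  have : s <= e / (2 * cabs (g m)) by rewrite ge_min lexx orbT.
  by rewrite ler_pdivlMr ?mulr_gt0 //; nra.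
have [|z' Az' gz'] := He (g m - s%:C * g m).
  by rewrite addrC addKr cabsN cabsM cabsR gtr0_norm.
have := Hm z' Az'; rewrite gz'.
have -> : g m - s%:C * g m = (1 - s)%:C * g m by rewrite rmorphB rmorph1; ring.
rewrite cabsM cabsR ger0_norm; last by lra.
by nra.
Qed.

(** Maximum principle: if the points reachable above the level of c stayed in a
    disk, the modulus of g would have a maximum on their closure, which contradicts
    openness of g. *)
Lemma reach_far c p q : D c -> above (cabs (g c)) p -> (forall z, cabs z <= q -> D z) ->
  exists2 z, q < cabs z & path_in R (above (cabs (g c))) p z.
Proof.
move=> Dc xp Dq; set X := above _ in xp *; apply: contrapT => H.
pose A := [set z | path_in R X p z].
have Aq : A `<=` [set z | cabs z <= q].
  by move=> z Az /=; rewrite leNgt; apply/negP => qz; apply: H; exists z.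
have cAq : closure A `<=` [set z | cabs z <= q].
  have cL := compact_closed (@hausdorff_C R) (@compact_disk R q).
  by rewrite [X in _ `<=` X](closure_id _).1 //; exact: closure_subset.
have cA : compact (closure A).
  by apply: subclosed_compact (@compact_disk R q) cAq; exact: closed_closure.
have Ap : A p by exact: path_in_refl.
have [||m clm Hm] := @closure_argmax A g _ cA.
- by exists p.
- by move=> z /cAq/Dq; exact: cg.
have Dm := Dq _ (cAq m clm).
have Xm : X m.
  by split=> //; have [_ pr] := xp; apply: (lt_le_trans pr); exact: Hm.
have [pm nm] := reach_open (@open_above _) Xm clm.
have [e e0 He] := open_g Dm nm.
have gm : 0 < cabs (g m) by have [_] := Xm; apply: le_lt_trans; exact: cabs_ge0.
pose s : R := e / (2 * cabs (g m)).
have s0 : 0 < s by rewrite divr_gt0 ?mulr_gt0.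
have se : s * cabs (g m) < e.
  by have -> : s * cabs (g m) = e / 2; [rewrite /s; field; rewrite gt_eqF|lra].
have [|z' Az' gz'] := He (g m + s%:C * g m).
  by rewrite addrC addKr cabsM cabsR gtr0_norm.
have := Hm z' Az'; rewrite gz'.
have -> : g m + s%:C * g m = (1 + s)%:C * g m by rewrite rmorphD rmorph1; ring.
rewrite cabsM cabsR ger0_norm; last by lra.
by nra.
Qed.

(** The levels r at which two given zeros merge: they lie in different components
    of the sublevel set for r, but in one component for every larger level. *)
Definition joined_at (r : R) (z z' : C) :=
  [/\ (D `&` [set z | g z = 0]) z, (D `&` [set z | g z = 0]) z',
    ~ path_in R (below r) z z' & forall r', r < r' -> path_in R (below r') z z'].

Lemma joined_at_unique r r' z z' : joined_at r z z' -> joined_at r' z z' -> r = r'.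
Proof.
move=> [_ _ H1 H2] [_ _ H3 H4]; have [rr|rr|//] := ltrgtP r r'.
- by case: H3; exact: H2.
- by case: H1; exact: H4.
Qed.

(** At a ramification point c, sectors where g is smaller than g c in modulus alternate with
    sectors where it is larger; there are at least two of each. Both small sectors lead
    to zeros of g (reach_zero), and these zeros are joined through c at every level above
    that of c. They are not joined below the level of c: a joining path would close up
    to a loop through c, and the two large sectors, which lead far out (reach_far) and are
    connected to each other there, would give a second loop that crosses the first one
    only at c, against crossing_loops_meet. *)
Lemma ramified_joins c : ramified c -> g c <> 0 ->
  exists z z', joined_at (cabs (g c)) z z'.
Proof.
move=> [Dc [e [a [e1 a0 Ha]]]] /eqP gc0.
have e0 : (0 < e)%N by exact: ltn_trans e1.
set y := g c in gc0 Ha *; have y0 : 0 < cabs y by rewrite cabs_gt0.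
(* k is an e-th root of i: multiplying the direction by k ^ 2 exchanges sectors
   of large and of small modulus. *)
pose k : C := cis (pi / (2 * e%:R)).
have eR : 0 < e%:R :> R by rewrite ltr0n.
have k2e : k ^+ (2 * e) = -1.
  rewrite /k cisX natrM mulrC divfK ?mulf_neq0 ?pnatr_eq0 ?gt_eqF //.
  by rewrite /cis cospi sinpi; apply/eqP; rewrite eq_complex /= oppr0 !eqxx.
have k1 : cabs k = 1 by rewrite cabs_cis.
have e2 : 2 <= e%:R :> R by rewrite ler_nat.
have pi0 : 0 < pi :> R by exact: pi_gt0.
have ik : 0 < Im k.
  rewrite /k /=; apply: sin_gt0_pi; rewrite divr_gt0 ?mulr_gt0 //=.
  by rewrite ltr_pdivrMr ?mulr_gt0 //; nra.
have ik3 : 0 < Im (k ^+ 3).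
  rewrite /k cisX /=; apply: sin_gt0_pi; rewrite mulrA divr_gt0 ?mulr_gt0 //=.
  by rewrite ltr_pdivrMr ?mulr_gt0 //; nra.
(* In the direction v0, g moves radially away from 0. *)
pose v0 : C := e.-root (y / a).
have v0e : a * v0 ^+ e = y by rewrite rootCK // mulrC divfK.
have v00 : v0 != 0.
  by apply: contra_eq_neq v0e => ->; rewrite expr0n gtn_eqF // mulr0 eq_sym.
(* The margin 1/4 makes the error small against the main term. *)
have a4 : 0 < cabs a / 4 by rewrite divr_gt0 // cabs_gt0.
have := open_nbhs_nbhs (conj (open_centred_domain hD) Dc).
have := Ha _ a4 => /nbhsCP[d1 d10 Hd1] /nbhsCP[d2 d20 Hd2].
have v0p : 0 < cabs v0 by rewrite cabs_gt0.
pose s : R := Num.min 1 (Num.min d1 d2 / (2 * cabs v0)).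
have m0 : 0 < Num.min d1 d2 by rewrite lt_min d10.
have s0 : 0 < s by rewrite lt_min ltr01 divr_gt0 ?mulr_gt0.
have s1 : s <= 1 by rewrite ge_min lexx.
have sd : s * cabs v0 < Num.min d1 d2.
  have : s <= Num.min d1 d2 / (2 * cabs v0) by rewrite ge_min lexx orbT.
  by rewrite ler_pdivlMr ?mulr_gt0 //; nra.
have local (t : R) (b : C) : 0 < t <= 1 -> cabs b = 1 ->
    [/\ D (c + t%:C * (s%:C * v0 * b)) & exists2 T : R, 0 < T <= 1 &
     cabs (g (c + t%:C * (s%:C * v0 * b)) - y - T%:C * y * b ^+ e) <= T * cabs y / 4].
  move=> /andP[t0 t1] b1; set z := c + _.
  have zc : z - c = (t * s)%:C * (v0 * b) by rewrite /z rmorphM; ring.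
  have ts : 0 < t * s by exact: mulr_gt0.
  have cz : cabs (z - c) = t * s * cabs v0.
    by rewrite zc !cabsM cabsR b1 mulr1 gtr0_norm.
  have zd : cabs (z - c) < Num.min d1 d2 by rewrite cz; nra.
  move: zd; rewrite lt_min => /andP[zd1 zd2]; split; first exact: Hd2.
  exists ((t * s) ^+ e).
    have ts1 : t * s <= 1 by rewrite mulr_ile1 // ltW.
    by rewrite exprn_gt0 //= exprn_ile1 // ltW.
  have gE : a * (z - c) ^+ e = ((t * s) ^+ e)%:C * y * b ^+ e.
    have -> : ((t * s) ^+ e)%:C = (t * s)%:C ^+ e :> C by rewrite rmorphXn.
    by rewrite zc -v0e 2!exprMn; move: (_ ^+ e) (v0 ^+ e) (b ^+ e) => T1 T2 T3; ring.
  have cE : cabs (z - c) ^+ e * cabs a = (t * s) ^+ e * cabs y.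
    by rewrite cz exprMn -v0e cabsM cabsX; ring.
  by have := Hd1 z zd1; rewrite gE => /le_trans; apply; rewrite -cE; lra.
have up (t : R) (b : C) : 0 < t <= 1 -> cabs b = 1 -> b ^+ e = 1 ->
    above (cabs y) (c + t%:C * (s%:C * v0 * b)).
  move=> t01 b1 be; have [Dz [T /andP[T0 T1] H]] := local t b t01 b1; split=> //.
  move: H; rewrite be mulr1; set z := c + _ => H.
  have := cabs_le_tri (y + T%:C * y) (g z).
  have -> : y + T%:C * y = (1 + T)%:C * y by rewrite rmorphD rmorph1; ring.
  rewrite {1}cabsM cabsR ger0_norm; last by lra.
  have -> : (1 + T)%:C * y - g z = - (g z - y - T%:C * y) by rewrite rmorphD rmorph1; ring.
  by rewrite cabsN; nra.
have down (t : R) (b : C) : 0 < t <= 1 -> cabs b = 1 -> b ^+ e = -1 ->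
    below (cabs y) (c + t%:C * (s%:C * v0 * b)).
  move=> t01 b1 be; have [Dz [T /andP[T0 T1] H]] := local t b t01 b1; split=> //.
  move: H; rewrite be mulrN1 opprK; set z := c + _ => H.
  have := cabs_le_tri (g z) (y - T%:C * y).
  have -> : y - T%:C * y = (1 - T)%:C * y by rewrite rmorphB rmorph1; ring.
  rewrite (cabsM _ y) cabsR ger0_norm; last by lra.
  have -> : g z - (1 - T)%:C * y = g z - y + T%:C * y by rewrite rmorphB rmorph1; ring.
  by nra.
pose v := s%:C * v0.
have vne : v != 0 by rewrite mulf_neq0 // -cabs_gt0 cabsR gtr0_norm.
have kpow m : cabs (k ^+ m) = 1 by rewrite cabsX k1 expr1n.
have ke m : (k ^+ (2 * m)) ^+ e = (-1) ^+ m.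
  by rewrite -exprM -mulnA (mulnC m) mulnA exprM k2e.
have one01 : (0 : R) < (1 : R) <= 1 by rewrite ltr01 lexx.
have at1 b : c + v * b = c + (1 : R)%:C * (s%:C * v0 * b) by rewrite rmorph1 mul1r.
have [z [Dz gz pz]] : exists z, [/\ D z, g z = 0 & path_in R (below (cabs y)) (c + v * k ^+ 2) z].
  by apply: reach_zero Dc _; rewrite at1; apply: down => //; rewrite -[2%N]muln1 ke.
have [z' [Dz' gz' pz']] : exists z, [/\ D z, g z = 0 & path_in R (below (cabs y)) (c + v * k ^+ 6) z].
  by apply: reach_zero Dc _; rewrite at1; apply: down => //; rewrite (ke 3%N) !exprS expr0 !mulN1r !opprK.
have sublevel_sub : D `&` [set z | cabs (g z) <= cabs y] `<=` D by move=> ? [].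
have [q [Dq Hq]] := centred_domain_exhaust hD (compact_sublevel Dc) sublevel_sub.
exists z, z'; split=> //.
- move=> zz'.
  have [p1 p1q pp1] : exists2 p, q < cabs p & path_in R (above (cabs y)) (c + v) p.
    apply: reach_far Dc _ Dq; rewrite -[v]mulr1 at1; apply: up => //; rewrite ?cabs1 ?expr1n //.
  have [p2 p2q pp2] : exists2 p, q < cabs p & path_in R (above (cabs y)) (c + v * k ^+ 4) p.
    apply: reach_far Dc _ Dq; rewrite at1; apply: up => //.
    by rewrite (ke 2%N) expr2 mulrNN mulr1.
  have p12 : path_in R (above (cabs y)) p1 p2.
    have [_ [Dp1 _]] := path_in_ends pp1; have [_ [Dp2 _]] := path_in_ends pp2.
    apply: path_in_annulus => u /andP[]; rewrite ge_min le_max => hu1 hu2.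
    have Du : D u.
      by case/orP: hu2; [exact: centred_domain_le hD Dp1|exact: centred_domain_le hD Dp2].
    split=> //; rewrite ltNge; apply/negP => gu.
    have := Hq u (conj Du gu); move: hu1; case/orP=> hu1; lra.
  apply: (@crossing_loops_meet R c v k (above (cabs y)) (below (cabs y))) => //.
  + by apply/seteqP; split=> u //= [[_ u1] [_ u2]]; have := lt_trans u1 u2; rewrite ltxx.
  + by move=> [_]; rewrite ltxx.
  + by move=> [_]; rewrite ltxx.
  + move=> t t01; split.
    * by rewrite -[v]mulr1; apply: up => //; rewrite ?cabs1 ?expr1n.
    * by apply: up => //; rewrite (ke 2%N) expr2 mulrNN mulr1.
    * by apply: down => //; rewrite -[2%N]muln1 ke.
    * by apply: down => //; rewrite (ke 3%N) !exprS expr0 !mulN1r !opprK.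
  + exact: (path_in_trans pp1 (path_in_trans p12 (path_in_sym pp2))).
  + exact: (path_in_trans pz (path_in_trans zz' (path_in_sym pz'))).
- move=> r' yr'.
  have sub : below (cabs y) `<=` below r' by move=> u [Du ur]; split=> //; exact: lt_trans yr'.
  have toc b : cabs b = 1 -> b ^+ e = -1 -> path_in R (below r') (c + v * b) c.
    move=> b1 be; apply: path_in_sym; apply: path_in_segment => t /andP[t0 t1].
    have -> : c + t%:C * (c + v * b - c) = c + t%:C * (s%:C * v0 * b) by rewrite /v; ring.
    move: t0; rewrite le_eqVlt => /orP[/eqP <-|t0]; first by rewrite rmorph0 mul0r addr0.
    by apply: sub; apply: down => //; rewrite t0.
  apply: (path_in_trans (path_in_sym (path_in_sub sub pz))).
  apply: path_in_trans (path_in_sub sub pz').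
  apply: (path_in_trans (toc _ (kpow 2%N) _)); first by rewrite -[2%N]muln1 ke.
  apply: path_in_sym; apply: toc => //.
  by rewrite (ke 3%N) !exprS expr0 !mulN1r !opprK.
Qed.

(** A pair of zeros merges at one level at most, and by ramified_joins every
    nonzero level of a ramification point is the merging level of some pair. *)
Theorem finite_ramification_levels : finite_set [set cabs (g c) | c in ramified].
Proof.
pose Z := D `&` [set z | g z = 0].
have : finite_set ([set 0] `|` [set (fun p : C * C => xget 0 [set r | joined_at r p.1 p.2]) p
    | p in Z `*` Z]).
  rewrite finite_setU; split; first exact: finite_set1.
  by apply: finite_image; exact: finite_setX.
apply: sub_finite_set => r [c Rc <-].
have [gc0|gc0] := pselect (g c = 0); first by left; rewrite gc0 cabs0.
right; have [z [z' J]] := ramified_joins Rc gc0.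
have [Zz Zz' _ _] := J; exists (z, z') => //=.
apply: (joined_at_unique _ J).
by apply: (@xgetPex R 0 [set r | joined_at r z z']); exists (cabs (g c)).
Qed.

End Levels.

(** * Power maps between disks of the sphere *)

Section RootsOfNumbers.
Variable R : realType.
Local Notation C := (cplx R).

(** The power map is open, with an explicit branch: at a nonzero point multiply
    by the principal root of the quotient, at 0 take any root. *)
Lemma root_near (a : C) n (e : R) : (0 < n)%N -> 0 < e ->
  exists2 d : R, 0 < d & forall w, cabs (w - a ^+ n) < d ->
    exists2 b : C, b ^+ n = w & cabs (b - a) < e.
Proof.
move=> n0 e0; have [->|a0] := eqVneq a 0.
  exists (e ^+ n); first by rewrite exprn_gt0.
  move=> w; rewrite expr0n gtn_eqF // subr0 => we; exists (n.-root w); first by rewrite rootCK.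
  by rewrite subr0 -(@ltr_pXn2r _ n) // ?nnegrE ?cabs_ge0 ?ltW // -cabsX rootCK.
have an0 : a ^+ n != 0 by rewrite expf_neq0.
have ct : {for a ^+ n, continuous (fun w : C => a * near1_root n (w / a ^+ n))}.
  apply: contC_mul; first exact: contC_const.
  apply: (@continuous_comp C C C (fun w => w / a ^+ n)).
    by apply: contC_mul; [exact: cvg_id|exact: contC_const].
  by rewrite divff //; apply: continuous_near1_root; rewrite /= ltr01.
have /nbhsCP[d1 d10 H1] := (contCP _ _).1 ct _ e0.
exists (Num.min d1 (cabs (a ^+ n))); first by rewrite lt_min d10 cabs_gt0.
move=> w; rewrite lt_min => /andP[w1 w2].
have Rw := cabs_lt1_Re an0 w2.
exists (a * near1_root n (w / a ^+ n)).
  by rewrite exprMn (near1_rootK n0 Rw) mulrC divfK.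
by have := H1 w w1; rewrite divff // near1_root1 mulr1.
Qed.

Lemma finite_roots (w : C) n : (0 < n)%N -> finite_set [set z : C | z ^+ n = w].
Proof.
move=> n0; pose p : {poly R[i]} := 'X^n - w%:P.
have p0 : p != 0 by rewrite -size_poly_eq0 size_XnsubC.
have [s ps] := closed_field_poly_normal p.
apply: (@sub_finite_set _ _ [set` s]); last exact: finite_seq.
move=> z /= zw; have : root p z by rewrite /root !hornerE zw subrr.
by rewrite ps rootZ ?lead_coef_eq0 // root_prod_XsubC.
Qed.

End RootsOfNumbers.

Section Sphere.
Variable R : realType.
Local Notation C := (cplx R).
Local Notation S2 := (sphere R).

Definition affine (q : S2) : C := if q is Some z then z else 0.

Lemma continuous_Some : continuous (Some : C -> S2).
Proof. exact: one_point_compactification_some_continuous. Qed.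

Lemma continuous_affine_coord (z : C) : {for (Some z : S2), continuous affine}.
Proof. by move=> A zA; exact: zA. Qed.

Lemma hausdorff_sphere : hausdorff_space S2.
Proof.
apply: one_point_compactification_hausdorff; last exact: hausdorff_C.
move=> z _; exists [set w | cabs w <= cabs z + 1].
  rewrite withinET; apply/nbhsCP; exists 1; first exact: ltr01.
  by move=> w wz; have := cabs_le_tri w z; rewrite /=; lra.
by split; [exact: compact_disk|apply: (compact_closed (@hausdorff_C R)); exact: compact_disk].
Qed.

Lemma open_image_Some (A : set C) : open A -> open (Some @` A : set S2).
Proof. exact: one_point_compactification_open_some. Qed.

Lemma compact_sphere : compact [set: S2].
Proof. exact: one_point_compactification_compact. Qed.

(** The topological content of a conformal map onto the unit disk, read in affine
    coordinates: the form in which charts enter the arguments on paths and limits. *)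
Definition disk_chart (U : set S2) (ch : S2 -> C) (inv : C -> S2) :=
  [/\ forall p, U p -> [/\ {for p, continuous ch}, cabs (ch p) < 1 & inv (ch p) = p]
    & forall w, cabs w < 1 -> [/\ {for w, continuous inv}, U (inv w) & ch (inv w) = w]].

Lemma unit_diskP (q : S2) : unit_disk q <-> exists2 z : C, q = Some z & cabs z < 1.
Proof.
split=> [[z /= z1 <-]|[z -> z1]]; exists z => //.
- by move: z1; rewrite normE -(rmorph1 (real_complex R)) ltcR.
- by rewrite /= normE -(rmorph1 (real_complex R)) ltcR.
Qed.

Lemma unit_disk_affine (q : S2) : unit_disk q -> Some (affine q) = q /\ cabs (affine q) < 1.
Proof. by move=> /unit_diskP[z -> z1]. Qed.

Lemma conformal_disk_chart U (phi psi : S2 -> S2) :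
  holomorphic_on U phi -> holomorphic_on (@unit_disk R) psi ->
  (forall z, U z -> unit_disk (phi z) /\ psi (phi z) = z) ->
  (forall w, unit_disk w -> U (psi w) /\ phi (psi w) = w) ->
  disk_chart U (affine \o phi) (psi \o Some).
Proof.
move=> hphi hpsi H1 H2; split=> [p Up|w w1].
- have [dp pp] := H1 p Up; have [E a1] := unit_disk_affine dp; split=> //=.
  + apply: continuous_comp; first by have [] := hphi p Up.
    by rewrite -E; exact: continuous_affine_coord.
  + by rewrite E.
- have dw : unit_disk (Some w : S2) by apply/unit_diskP; exists w.
  have [Uw pw] := H2 _ dw; split=> //=; last by rewrite pw.
  apply: (@continuous_comp C S2 S2); first exact: continuous_Some.
  by have [] := hpsi _ dw.
Qed.

Definition power_charts (t : nat) (f : S2 -> S2) U W chU invU chW invW :=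
  [/\ disk_chart U chU invU, disk_chart W chW invW &
    forall z, U z -> W (f z) /\ chW (f z) = chU z ^+ t].

Lemma conformal_to_power_charts t f U W : conformal_to_power t f U W ->
  exists chU invU chW invW, power_charts t f U W chU invU chW invW.
Proof.
move=> [fUW [phi [psi [[hphi [phi' [h1 h2 h3]]] [hpsi [psi' [g1 g2 g3]]] E]]]].
exists (affine \o phi), (phi' \o Some), (affine \o psi), (psi' \o Some); split.
- exact: conformal_disk_chart.
- exact: conformal_disk_chart.
- move=> z Uz; split; first exact: fUW.
  rewrite /= E //; have [dz _] := h2 z Uz.
  by have [<- _] := unit_disk_affine dz.
Qed.

Section PowerCharts.
Variables (t : nat) (f : S2 -> S2) (U W : set S2).
Variables (chU chW : S2 -> C) (invU invW : C -> S2).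
Hypothesis t0 : (0 < t)%N.
Hypothesis H : power_charts t f U W chU invU chW invW.

(** The chart form of openness of z ^ t, from root_near. *)
Lemma power_chart_open p (A : set S2) : open U -> U p -> nbhs p A ->
  exists2 B, nbhs (chW (f p)) B & forall w, B w -> cabs w < 1 -> exists2 q, (A `&` U) q & f q = invW w.
Proof.
move=> oU Up pA; have [[hU1 hU2] [hW1 hW2] E] := H.
have [cp p1 ip] := hU1 p Up; have [ci Uc _] := hU2 _ p1.
have /nbhsCP[e e0 He] : \forall w \near chU p, (A `&` U) (invU w).
  apply: ci; rewrite ip; apply: filterI => //; exact: open_nbhs_nbhs.
have m0 : 0 < Num.min e (1 - cabs (chU p)) by rewrite lt_min e0 subr_gt0.
have [d d0 Hd] := root_near (chU p) t0 m0.
exists [set w | cabs (w - chW (f p)) < d].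
  by apply/nbhsCP; exists d.
move=> w /=; have [_ ->] := E p Up; move=> /Hd[b bw]; rewrite lt_min => /andP[be b1] w1.
have bl : cabs b < 1 by have := cabs_le_tri b (chU p); lra.
have [_ Ub cb] := hU2 b bl.
exists (invU b); first exact: He.
have [Wf Ef] := E _ Ub; have [_ _ <-] := hW1 _ Wf.
by rewrite Ef cb bw.
Qed.

(** Properness of z ^ t on the unit disk: if f tends along F to a point of W, the
    chart coordinates of F stay in a compact disk of radius less than 1, so F has a
    limit point inside U. *)
Lemma power_chart_proper (F : set_system S2) y : ProperFilter F -> F U -> W y ->
  f @ F --> y -> exists z, [/\ U z, f z = y & cluster F z].
Proof.
move=> PF FU Wy fy; have [[hU1 hU2] [hW1 hW2] E] := H.
have [cy y1 iy] := hW1 y Wy.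
have cfy : chW (f z) @[z --> F] --> chW y.
  by apply: (@continuous_cvg _ _ _ F _ f chW y cy).
have cpow : chU z ^+ t @[z --> F] --> chW y.
  apply: cvg_trans cfy; apply: near_eq_cvg; apply: filterS FU => z Uz.
  by have [_] := E z Uz.
pose rho := (1 + cabs (chW y)) / 2.
have r1 : cabs (chW y) < rho by rewrite /rho; lra.
have r2 : rho < 1 by rewrite /rho; lra.
have [s [s1 Hs]] : exists s : R, s < 1 /\ forall x : R, 0 <= x -> x ^+ t < rho -> x <= s.
  have r0 : 0 <= rho by have := cabs_ge0 (chW y); rewrite /rho; lra.
  have [->|rn] := eqVneq rho 0.
    exists 0; split; first exact: ltr01.
    by move=> x x0; have := exprn_ge0 t x0; lra.
  have rp : 0 < rho by rewrite lt_def rn.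
  exists (expR (ln rho / t%:R)); split.
    have l0 : ln rho < 0 by apply: ln_lt0; rewrite rp.
    have : expR (ln rho / t%:R) < expR 0 by rewrite ltr_expR pmulr_llt0 ?invr_gt0 ?ltr0n.
    by rewrite expR0.
  move=> x x0 xr; rewrite -(@ler_pXn2r _ t) // ?nnegrE ?expR_ge0 //.
  by rewrite -expRM_natl mulrCA divff ?mulr1 ?lnK ?posrE ?ltW // pnatr_eq0 -lt0n.
have Fs : \forall z \near F, cabs (chU z) <= s.
  have /cvgCP H1 := cpow; have r3 : 0 < rho - cabs (chW y) by rewrite subr_gt0.
  have := H1 _ r3; apply: filterS => z hz; apply: Hs; first exact: cabs_ge0.
  by rewrite -cabsX; have := cabs_le_tri (chU z ^+ t) (chW y); lra.
have PG : ProperFilter (chU @ F) by exact: fmap_proper_filter.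
have [z0 [z0s clz0]] := @compact_disk R s _ PG Fs.
have z01 : cabs z0 < 1 := le_lt_trans z0s s1.
have [ci Ui chi] := hU2 z0 z01.
exists (invU z0); split=> //.
- have [Wf Ef] := E _ Ui; have [_ _ <-] := hW1 _ Wf; rewrite Ef chi.
  suff -> : z0 ^+ t = chW y by rewrite iy.
  apply: (@hausdorff_C R) => A B zA yB.
  have N1 : nbhs z0 [set w | A (w ^+ t)].
    have ct : {for z0, continuous (fun w : C => w ^+ t)} by apply: contC_exp; exact: cvg_id.
    exact: ct.
  have N2 : (chU @ F) [set w | B (w ^+ t)] by exact: cpow.
  by have [w [/= Bw Aw]] := clz0 _ _ N2 N1; exists (w ^+ t).
- move=> A B FA iB.
  have N2 : (chU @ F) [set w | exists2 z, (A `&` U) z & chU z = w].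
    suff : F [set z | exists2 z', (A `&` U) z' & chU z' = chU z] by [].
    by apply: filterS (filterI FA FU) => z AUz; exists z.
  have N1 : nbhs z0 [set w | B (invU w)] by exact: ci.
  have [w [/= [z [Az Uz] <-] Bz]] := clz0 _ _ N2 N1.
  by exists z; split=> //; move: Bz; have [_ _ ->] := hU1 z Uz.
Qed.

End PowerCharts.

End Sphere.
Arguments affine {R} q.

(** * Derivatives and ramification *)

Section ComplexDerivative.
Variable R : realType.
Local Notation C := (cplx R).
Implicit Types (F G : C -> C).

Lemma mulf_eq0_right (a b : C) : a != 0 -> a * b = 0 -> b = 0.
Proof. by move=> /negPf a0 /eqP; rewrite mulf_eq0 a0 => /eqP. Qed.

(** Differentiability with the modulus in R, so that the error terms of chain rule
    and power expansions can be estimated by linear arithmetic. *)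
Definition cderiv F (x A : C) := forall eps : R, 0 < eps ->
  \forall z \near x, cabs (F z - F x - A * (z - x)) <= eps * cabs (z - x).

Lemma derivable_cderiv F (x : C) : derivable F x 1 -> cderiv F x ('D_1 F x).
Proof.
move=> dF eps e0; have := dF; rewrite /derivable => /cvgP/cvgCP/(_ _ e0).
rewrite -/('D_1 F x) /dnbhs => /nbhsCP[d d0 Hd].
apply/nbhsCP; exists d => // z zd.
have [->|zx] := eqVneq z x; first by rewrite !subrr mulr0 subrr cabs0 mulr0.
have zx0 : z - x != 0 by rewrite subr_eq0.
have := Hd (z - x); rewrite subr0 => /(_ zd zx0) /ltW.
have -> : (z - x)^-1 *: (F ((z - x) *: 1 + x) - F x) - 'D_1 F x =
    (F z - F x - 'D_1 F x * (z - x)) / (z - x).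
  have -> : (z - x) *: (1 : C) + x = z by rewrite /GRing.scale /= mulr1 subrK.
  by rewrite /GRing.scale /=; field.
by rewrite cabsM cabsV ler_pdivrMr // cabs_gt0.
Qed.

Lemma cderiv_unique F (x A B : C) : cderiv F x A -> cderiv F x B -> A = B.
Proof.
move=> dA dB; apply/eqP; rewrite -subr_eq0; apply/negPn/negP => AB.
have e0 : 0 < cabs (A - B) / 4 by rewrite divr_gt0 // cabs_gt0.
have N : \forall z \near x, cabs (F z - F x - A * (z - x)) <= cabs (A - B) / 4 * cabs (z - x) /\
    cabs (F z - F x - B * (z - x)) <= cabs (A - B) / 4 * cabs (z - x).
  by apply: filterI; [exact: dA|exact: dB].
have [d d0 Hd] := (nbhsCP _ _).1 N.
have zd : cabs (x + (d / 2)%:C - x) < d.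
  by rewrite addrC addKr cabsR gtr0_norm ?divr_gt0 //; lra.
have [] := Hd _ zd; set z := x + _ => H1 H2.
have zx : 0 < cabs (z - x).
  by rewrite /z addrC addKr cabsR gtr0_norm ?divr_gt0.
have := cabsD (F z - F x - B * (z - x)) (- (F z - F x - A * (z - x))).
have -> : F z - F x - B * (z - x) - (F z - F x - A * (z - x)) = (A - B) * (z - x) by ring.
rewrite cabsN cabsM => H3.
have : 0 < cabs (A - B) * cabs (z - x) by rewrite mulr_gt0 // cabs_gt0.
by lra.
Qed.

Lemma cderiv_near_eq F G (x A : C) : (\forall z \near x, F z = G z) ->
  cderiv F x A -> cderiv G x A.
Proof.
move=> E dF eps e0; have Ex := nbhs_singleton E.
by apply: filterS2 E (dF eps e0) => z <-; rewrite Ex.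
Qed.

Lemma cderiv_chain F G (x A B : C) : cderiv F x A -> cderiv G (F x) B ->
  {for x, continuous F} -> cderiv (fun z => G (F z)) x (B * A).
Proof.
move=> dF dG cF eps e0.
have a1 : 0 < cabs A + 1 by have := cabs_ge0 A; lra.
have b1 : 0 < cabs B + 1 by have := cabs_ge0 B; lra.
pose e1 := Num.min 1 (eps / 2 / (cabs B + 1)).
pose e2 := eps / 2 / (cabs A + 1).
have e10 : 0 < e1 by rewrite lt_min ltr01 !divr_gt0.
have e20 : 0 < e2 by rewrite !divr_gt0.
have N := cF _ (dG _ e20).
apply: filterS2 (dF _ e10) N => z H1 /= H2.
have -> : G (F z) - G (F x) - B * A * (z - x) =
    (G (F z) - G (F x) - B * (F z - F x)) + B * (F z - F x - A * (z - x)) by ring.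
apply: (le_trans (cabsD _ _)); rewrite cabsM.
have H3 : cabs (F z - F x) <= (cabs A + 1) * cabs (z - x).
  apply: (le_trans (cabs_le_tri _ (A * (z - x)))); rewrite cabsM mulrDl lerD2l mul1r.
  apply: (le_trans H1); rewrite ler_piMl ?cabs_ge0 // ge_min lexx //.
have H4 : e2 * cabs (F z - F x) <= eps / 2 * cabs (z - x).
  have -> : eps / 2 * cabs (z - x) = e2 * ((cabs A + 1) * cabs (z - x)).
    by rewrite /e2; field; rewrite gt_eqF.
  by rewrite ler_wpM2l // ltW.
have H5 : cabs B * cabs (F z - F x - A * (z - x)) <= eps / 2 * cabs (z - x).
  apply: le_trans (_ : (cabs B + 1) * (e1 * cabs (z - x)) <= _).
    by apply: ler_pM; rewrite ?cabs_ge0 // ler_wpDr.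
  have -> : eps / 2 * cabs (z - x) = (cabs B + 1) * (eps / 2 / (cabs B + 1) * cabs (z - x)).
    by field; rewrite gt_eqF.
  by rewrite ler_wpM2l ?(ltW b1) // ler_wpM2r ?cabs_ge0 // ge_min lexx orbT.
by lra.
Qed.

(** Psi (G x) is the t-th power of Phi x, where Phi has a simple zero at c and Psi a
    simple zero at G c. Dividing, (G x - G c) / (x - c) ^ t is the product of a quotient
    with limit A ^ t and one with limit 1 / B. *)
Lemma power_expansion (G Phi Psi : C -> C) (c A B : C) t : (0 < t)%N ->
  cderiv Phi c A -> A != 0 -> Phi c = 0 ->
  {for c, continuous G} -> cderiv Psi (G c) B -> B != 0 ->
  (\forall x \near c, Psi (G x) = Phi x ^+ t) ->
  exists2 a : C, a != 0 & forall eps : R, 0 < eps ->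
    \forall x \near c, cabs (G x - G c - a * (x - c) ^+ t) <= eps * cabs (x - c) ^+ t.
Proof.
move=> t0 dPhi A0 Phic cG dPsi B0 E.
have PsiG0 : Psi (G c) = 0 by rewrite (nbhs_singleton E) Phic expr0n gtn_eqF.
have q1 : (Phi x / (x - c)) @[x --> c^'] --> A.
  apply/cvgCP => e e0; have e2 : 0 < e / 2 by rewrite divr_gt0.
  have := dPhi _ e2; rewrite Phic => H; apply: filterS H => x H xc.
  have xc0 : x - c != 0 by rewrite subr_eq0.
  have -> : Phi x / (x - c) - A = (Phi x - 0 - A * (x - c)) / (x - c) by field.
  rewrite cabsM cabsV ltr_pdivrMr ?cabs_gt0 //; apply: (le_lt_trans H).
  by rewrite ltr_pM2r ?cabs_gt0 //; lra.
have Phin0 : \forall x \near c^', Phi x != 0.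
  have cA : 0 < cabs (A : C) by rewrite cabs_gt0.
  have N : \forall x \near c^', cabs (Phi x / (x - c) - A) < cabs A by exact: (cvgCP _ _ _).1 q1 _ cA.
  apply: filterS N => x; apply: contraTneq => ->.
  by rewrite mul0r sub0r cabsN ltxx.
have Gn : \forall x \near c^', G x - G c != 0.
  have E' : \forall x \near c^', Psi (G x) = Phi x ^+ t by apply: filterS E => x -> _.
  apply: filterS2 E' Phin0 => x Ex Px; rewrite subr_eq0; apply: contra_neq Px => Gxc.
  by move: Ex; rewrite Gxc PsiG0 => /esym/eqP; rewrite expf_eq0 t0 => /eqP.
have q2 : (Psi (G x) / (G x - G c)) @[x --> c^'] --> B.
  apply/cvgCP => e e0; have e2 : 0 < e / 2 by rewrite divr_gt0.
  have H : \forall x \near c, cabs (Psi (G x) - 0 - B * (G x - G c)) <= e / 2 * cabs (G x - G c).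
    by have := cG _ (dPsi _ e2); rewrite PsiG0.
  have H' : \forall x \near c^', cabs (Psi (G x) - 0 - B * (G x - G c)) <= e / 2 * cabs (G x - G c).
    by apply: filterS H => x + _.
  apply: filterS2 H' Gn => x {}H Gx.
  have -> : Psi (G x) / (G x - G c) - B = (Psi (G x) - 0 - B * (G x - G c)) / (G x - G c) by field.
  rewrite cabsM cabsV ltr_pdivrMr ?cabs_gt0 //; apply: (le_lt_trans H).
  by rewrite ltr_pM2r ?cabs_gt0 //; lra.
exists (A ^+ t / B); first by rewrite mulf_neq0 ?invr_eq0 ?expf_neq0.
have q3 : ((Phi x / (x - c)) ^+ t / (Psi (G x) / (G x - G c))) @[x --> c^'] --> A ^+ t / B.
  apply: cvgM; last by apply: cvgV.
  have ct : {for A, continuous (fun z : C => z ^+ t)} by apply: contC_exp; exact: cvg_id.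
  exact: (continuous_cvg _ ct q1).
move=> eps e0; have := (cvgCP _ _ _).1 q3 eps e0 => H.
have H2 : \forall x \near c^', cabs (G x - G c - A ^+ t / B * (x - c) ^+ t) <= eps * cabs (x - c) ^+ t.
  have E' : \forall x \near c^', Psi (G x) = Phi x ^+ t by apply: filterS E => x -> _.
  have N : \forall x \near c^', x != c by exact: nbhs_dnbhs_neq.
  near=> x.
  have xc0 : x - c != 0 by rewrite subr_eq0; near: x.
  have Gx0 : G x - G c != 0 by near: x.
  have Px0 : Phi x != 0 by near: x.
  have Ex : Psi (G x) = Phi x ^+ t by near: x.
  have -> : G x - G c - A ^+ t / B * (x - c) ^+ t =
      ((Phi x / (x - c)) ^+ t / (Psi (G x) / (G x - G c)) - A ^+ t / B) * (x - c) ^+ t.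
    by rewrite Ex expr_div_n; field; rewrite B0 Gx0 !expf_neq0.
  rewrite cabsM cabsX ler_wpM2r ?exprn_ge0 ?cabs_ge0 // ltW //; near: x; exact: H.
have {}H2 : \forall x \near c, x != c -> cabs (G x - G c - A ^+ t / B * (x - c) ^+ t) <= eps * cabs (x - c) ^+ t by exact: H2.
apply: filterS H2 => x; have [->|xc] := eqVneq x c; last by apply.
by move=> _; rewrite !subrr expr0n gtn_eqF // mulr0 subrr cabs0 expr0n gtn_eqF // mulr0.
Unshelve. all: by end_near. Qed.

End ComplexDerivative.

Section LocalRep.
Variable R : realType.
Local Notation C := (cplx R).
Local Notation S2 := (sphere R).
Implicit Types (f g h : S2 -> S2) (p q : S2).

Lemma chartK p (w : C) : chart p (unchart p w) = w.
Proof. by case: p => [z|] //=; case: eqP => [->|_] //=; rewrite invrK. Qed.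

Lemma unchartK p : unchart p (chart p p) = p.
Proof. by case: p => [z|] //=; rewrite eqxx. Qed.

Lemma open_neqNone : open [set q : S2 | q <> None].
Proof.
rewrite (_ : mkset _ = Some @` setT); first exact/open_image_Some/openT.
by apply/seteqP; split=> [[z|]|q [z _ <-]] //=; exists z.
Qed.

Lemma near_unchartK p : \forall q \near p, unchart p (chart p q) = q.
Proof.
case: p => [z|].
- have N : nbhs (Some z : S2) [set q : S2 | q <> None].
    by apply: open_nbhs_nbhs; split; [exact: open_neqNone|].
  by apply: filterS N => -[w|].
- exists [set 0]; first by split; [exact: compact_set1|exact: (accessible_closed_set1 (hausdorff_accessible (@hausdorff_C R)))].
  move=> q [[z /= z0 <-]|->] /=; last by rewrite eqxx.
  by rewrite invr_eq0; case: eqP => [/z0|_] //; rewrite invrK.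
Qed.

Lemma continuous_unchart p : {for chart p p, continuous (unchart p)}.
Proof.
case: p => [z|]; first exact: continuous_Some.
suff : forall A : set S2, nbhs (None : S2) A -> \forall w \near (0 : C), A (unchart None w).
  by move=> H A; rewrite /= eqxx => /H.
move=> A [K [cK _] KA].
have [q [_ Hq]] := centred_domain_exhaust (or_intror erefl) cK (fun z _ => I).
have q0 : 0 < 1 + `|q| by rewrite ltr_wpDr.
apply/nbhsCP; exists ((1 + `|q|)^-1); first by rewrite invr_gt0.
move=> w; rewrite subr0 => w1; apply: KA => /=.
case: eqP => [_|/eqP w0]; first by right.
left; exists w^-1 => // /Hq; rewrite cabsV => wq.
have wp : 0 < cabs w by rewrite cabs_gt0.
have : 1 + `|q| < (cabs w)^-1 by rewrite -[ltLHS]invrK ltf_pV2 ?posrE ?invr_gt0.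
by have := ler_norm q; lra.
Qed.

Definition holomorphic_at f p :=
  {for p, continuous f} /\ derivable (local_rep f p) (chart p p) 1.

Definition deriv_at f p : C := 'D_1 (local_rep f p) (chart p p).

Lemma local_rep_center f p : local_rep f p (chart p p) = chart (f p) (f p).
Proof. by rewrite /local_rep /= unchartK. Qed.

Lemma near_chart (P : S2 -> Prop) p : (\forall q \near p, P q) ->
  \forall x \near chart p p, P (unchart p x).
Proof.
move=> H; have := @continuous_unchart p (fun q => P q).
by rewrite unchartK => /(_ H).
Qed.

Lemma deriv_atP f p : holomorphic_at f p ->
  cderiv (local_rep f p) (chart p p) (deriv_at f p).
Proof. by move=> [_]; exact: derivable_cderiv. Qed.

Lemma continuous_local_rep f p : holomorphic_at f p ->
  {for chart p p, continuous (local_rep f p)}.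
Proof. by move=> [_ /derivable1_diffP]; exact: differentiable_continuous. Qed.

Lemma cderiv_comp f g p : holomorphic_at f p -> holomorphic_at g (f p) ->
  cderiv (local_rep (g \o f) p) (chart p p) (deriv_at g (f p) * deriv_at f p).
Proof.
move=> hf hg; have cf := hf.1.
have E : \forall x \near chart p p, local_rep g (f p) (local_rep f p x) =
    local_rep (g \o f) p x.
  have := near_chart (cf _ (near_unchartK (f p))).
  by apply: filterS => x Hx; rewrite /local_rep /= Hx.
apply: (cderiv_near_eq E); apply: cderiv_chain.
- exact: deriv_atP.
- by rewrite local_rep_center; exact: deriv_atP.
- exact: continuous_local_rep.
Qed.

Lemma cderiv_local_rep_eq f g p A : (\forall q \near p, f q = g q) ->
  cderiv (local_rep f p) (chart p p) A -> cderiv (local_rep g p) (chart p p) A.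
Proof.
move=> E; apply: cderiv_near_eq; have := near_chart E.
by apply: filterS => x Hx; rewrite /local_rep /= Hx (nbhs_singleton E).
Qed.

Lemma cderiv_local_id p : cderiv (local_rep id p) (chart p p) 1.
Proof.
move=> eps e0; suff : \forall x \near chart p p, True by apply: filterS => x _; rewrite /local_rep /= !chartK mul1r subrr cabs0 mulr_ge0 ?cabs_ge0 // ltW.
exact: filterT.
Qed.

Lemma deriv_at_power t (w : C) :
  deriv_at (power_map t) (Some w) = t%:R * w ^+ t.-1.
Proof.
rewrite /deriv_at (_ : local_rep _ _ = (fun z : C => z ^+ t)) //.
by rewrite exp_derive /GRing.scale /= mulr1.
Qed.

Lemma holomorphic_at_power t (w : C) : holomorphic_at (power_map t) (Some w).
Proof.
split.
- move=> A; rewrite /power_map /= => wA.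
  have ct : {for w, continuous (fun z : C => z ^+ t)} by apply: contC_exp; exact: cvg_id.
  have := @continuous_comp C C S2 _ Some w ct (@continuous_Some R _).
  by move=> /(_ A wA).
- by rewrite (_ : local_rep _ _ = (fun z : C => z ^+ t)) //; exact: exprn_derivable.
Qed.

(** Chain rule for psi after phi, which is the identity near p. *)
Lemma conformal_deriv_neq0 (U W : set S2) phi psi p : open U -> U p ->
  holomorphic_at phi p -> holomorphic_at psi (phi p) ->
  (forall z, U z -> psi (phi z) = z) -> deriv_at phi p != 0.
Proof.
move=> oU Up hphi hpsi E.
have H : deriv_at psi (phi p) * deriv_at phi p = 1.
  apply: (cderiv_unique (cderiv_comp hphi hpsi)).
  apply: (cderiv_local_rep_eq _ (cderiv_local_id p)).
  have N : \forall q \near p, U q by exact: open_nbhs_nbhs.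
  by apply: filterS N => q /E.
by apply/eqP => H0; move: H; rewrite H0 mulr0 => /esym/eqP; rewrite oner_eq0.
Qed.

(** The conformal charts turn f into z ^ t, and their derivatives do not vanish; so
    by the chain rule f is critical exactly where the derivative t z ^ (t - 1) is zero,
    and the expansion of z ^ t at 0 transfers to f. *)
Theorem conformal_to_power_local t f U W : (0 < t)%N -> open U -> open W ->
  conformal_to_power t f U W ->
  exists chU invU chW invW, [/\ power_charts t f U W chU invU chW invW,
    forall p, U p -> holomorphic_at f p -> (deriv_at f p = 0 <-> (1 < t)%N /\ chU p = 0) &
    forall c y : C, U (Some c) -> f (Some c) = Some y -> chU (Some c) = 0 ->
      {for (Some c : S2), continuous f} ->
      exists2 a : C, a != 0 & forall eps : R, 0 < eps -> \forall x \near c,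
        cabs (affine (f (Some x)) - y - a * (x - c) ^+ t) <= eps * cabs (x - c) ^+ t].
Proof.
move=> t0 oU oW [fUW [phi [psi [[hphi [phi' [h1 h2 h3]]] [hpsi [psi' [g1 g2 g3]]] E]]]].
have phin0 p : U p -> deriv_at phi p != 0.
  move=> Up; apply: (@conformal_deriv_neq0 U W phi phi' p) => //.
  - exact: hphi.
  - by apply: h1; have [] := h2 p Up.
  - by move=> z /h2[].
have psin0 q : W q -> deriv_at psi q != 0.
  move=> Wq; apply: (@conformal_deriv_neq0 W W psi psi' q) => //.
  - exact: hpsi.
  - by apply: g1; have [] := g2 q Wq.
  - by move=> z /g2[].
have phiE p : U p -> phi p = Some (affine (phi p)).
  by move=> /h2[/unit_disk_affine[-> _]].
exists (affine \o phi), (phi' \o Some), (affine \o psi), (psi' \o Some); split.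
- split; [exact: conformal_disk_chart|exact: conformal_disk_chart|].
  move=> z Uz; split; first exact: fUW.
  by rewrite /= E // phiE.
- move=> p Up hf.
  have hpow : holomorphic_at (power_map t) (phi p).
    by rewrite (phiE p Up); exact: holomorphic_at_power.
  have hpsi' := hpsi _ (fUW p Up); have hphi' := hphi _ Up.
  have EE : deriv_at psi (f p) * deriv_at f p = deriv_at (power_map t) (phi p) * deriv_at phi p.
    apply: (cderiv_unique (cderiv_comp hf hpsi')).
    apply: (cderiv_local_rep_eq _ (cderiv_comp hphi' hpow)).
    have N : \forall q \near p, U q by exact: open_nbhs_nbhs.
    by apply: filterS N => q Uq /=; rewrite E.
  rewrite (phiE p Up) deriv_at_power in EE.
  split=> [f0|[t1 c0]].
  + move: EE; rewrite f0 mulr0 => /esym/eqP.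
    rewrite mulf_eq0 (negPf (phin0 p Up)) orbF mulf_eq0 pnatr_eq0 gtn_eqF //= expf_eq0.
    by move=> /andP[t1 /eqP ->]; split=> //; rewrite -ltnS prednK in t1.
  + move: EE; rewrite [affine _]c0 expr0n -subn1 subn_eq0 leqNgt t1 /=.
    by rewrite mulr0 mul0r; apply: mulf_eq0_right; exact: psin0 (fUW p Up).
- move=> c y Uc fc chc cf.
  have dphi := deriv_atP (hphi _ Uc); have dpsi := deriv_atP (hpsi _ (fUW _ Uc)).
  rewrite fc in dpsi.
  have pn := phin0 _ Uc; have qn := psin0 _ (fUW _ Uc); rewrite fc in qn.
  have repphi : local_rep phi (Some c) = fun x => affine (phi (Some x)).
    by apply/funext => x; rewrite /local_rep /= phiE.
  have reppsi : local_rep psi (Some y) = fun x => affine (psi (Some x)).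
    have psiE : psi (Some y) = Some (affine (psi (Some y))).
      by have := g2 _ (fUW _ Uc); rewrite fc => -[/unit_disk_affine[]].
    by apply/funext => x; rewrite /local_rep /= psiE.
  rewrite repphi in dphi; rewrite reppsi in dpsi.
  have Gc : affine (f (Some c)) = y by rewrite fc.
  have cG : {for c, continuous (fun x : C => affine (f (Some x)))}.
    apply: (@continuous_comp C S2 C (fun x => f (Some x))).
      by apply: (@continuous_comp C S2 S2); [exact: continuous_Some|exact: cf].
    by rewrite fc; exact: continuous_affine_coord.
  move: (deriv_at psi (Some y)) (deriv_at phi (Some c)) qn pn dpsi dphi => B A B0 A0 dpsi dphi.
  rewrite -Gc; rewrite -Gc in dpsi.
  apply: (power_expansion t0 dphi A0 chc cG dpsi B0).
  have N1 : \forall x \near c, U (Some x) by apply: (@continuous_Some R c U); exact: open_nbhs_nbhs.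
  have N2 : \forall x \near c, f (Some x) <> None.
    have cS : {for c, continuous (fun x : C => f (Some x))}.
      by apply: (@continuous_comp C S2 S2); [exact: continuous_Some|exact: cf].
    apply: (cS [set q | q <> None]); rewrite fc.
    by apply: open_nbhs_nbhs; split; [exact: open_neqNone|].
  apply: filterS2 N1 N2 => x Ux fx.
  have -> : Some (affine (f (Some x))) = f (Some x) by case: (f _) fx.
  by rewrite E // phiE.
Qed.

End LocalRep.

(** * Finitely many critical points *)

Section NearRoots.
Variable R : realType.
Local Notation C := (cplx R).

(** The distance from z ^ n to w is the product of the distances from z to the
    n-th roots of w, so one factor is small when the product is. *)
Lemma near_some_root (w : C) n : (0 < n)%N -> exists s : seq C,
  forall (z : C) (e : R), 0 < e -> cabs (z ^+ n - w) < e ^+ n ->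
    exists2 b, b \in s & cabs (z - b) < e.
Proof.
move=> n0; pose p : {poly R[i]} := 'X^n - w%:P.
have [s ps] := closed_field_poly_normal p.
have lp : lead_coef p = 1 by apply/monicP; exact: monicXnsubC.
have sz : size s = n.
  have := size_XnsubC w n0; rewrite -/p ps lp scale1r size_prod_XsubC.
  by move=> [].
exists s => z e e0 zw; apply: contrapT => H.
have far b : b \in s -> e <= cabs (z - b).
  by move=> bs; rewrite leNgt; apply/negP => zb; apply: H; exists b.
suff : e ^+ n <= cabs (z ^+ n - w) by rewrite leNgt zw.
have -> : z ^+ n - w = \prod_(b <- s) (z - b).
  have -> : z ^+ n - w = p.[z] by rewrite !hornerE.
  by rewrite ps lp scale1r horner_prod; apply: eq_bigr => b _; rewrite !hornerE.
rewrite -sz; elim: s far {ps sz H} => [|b s IH] far.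
  by rewrite big_nil cabs1 expr0.
rewrite big_cons cabsM exprS; apply: ler_pM.
- exact: ltW.
- by rewrite exprn_ge0 // ltW.
- by apply: far; rewrite mem_head.
- by apply: IH => c cs; apply: far; rewrite in_cons cs orbT.
Qed.

Lemma isolate_in_seq (a : C) (s : seq C) : exists2 e : R, 0 < e &
  forall b, b \in s -> b != a -> 2 * e <= cabs (b - a).
Proof.
elim: s => [|b s [e e0 He]]; first by exists 1.
have [->|ba] := eqVneq b a.
  by exists e => // c; rewrite in_cons => /orP[/eqP ->|/He //]; rewrite eqxx.
have d0 : 0 < cabs (b - a) by rewrite cabs_gt0 subr_eq0.
exists (Num.min e (cabs (b - a) / 2)); first by rewrite lt_min e0 divr_gt0.
move=> c; rewrite in_cons => /orP[/eqP -> _|/He H /H].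
- have : Num.min e (cabs (b - a) / 2) <= cabs (b - a) / 2 by rewrite ge_min lexx orbT.
  by lra.
- have : Num.min e (cabs (b - a) / 2) <= e by rewrite ge_min lexx.
  by lra.
Qed.

End NearRoots.

Section BranchedCovering.
Variable R : realType.
Local Notation C := (cplx R).
Local Notation S2 := (sphere R).
Variables (S : set S2) (d : nat) (f : S2 -> S2).
Hypothesis hS : simply_connected_model S.
Hypothesis hf : branched_covering S d f.

Lemma covering_into z : S z -> S (f z). Proof. by have [+ _ _] := hf; apply. Qed.

Lemma covering_holomorphic z : S z -> holomorphic_at f z.
Proof. by have [_ + _] := hf; apply. Qed.

Lemma covering_continuous z : S z -> {for z, continuous f}.
Proof. by move=> /covering_holomorphic[]. Qed.

Lemma critical_pointP c : critical_point S f c <-> S c /\ deriv_at f c = 0.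
Proof. by []. Qed.

Lemma covering_sheets y : S y -> exists W, [/\ open W, W y, W `<=` S &
  exists (k : nat) (V : 'I_k -> set S2) (t : 'I_k -> nat),
  [/\ forall j, (0 < t j)%N /\ open (V j) /\ V j `<=` S /\ conformal_to_power (t j) f (V j) W,
    trivIset setT V & forall z, S z -> W (f z) -> exists j, V j z]].
Proof.
move=> Sy; have [_ _ H] := hf; have [W [oW Wy WS [k [V [t [HV tV E _]]]]]] := H y Sy.
exists W; split=> //; exists k, V, t; split=> // [j|z Sz Wz].
- have [oV [t0 cV]] := HV j; split=> //; split=> //; split=> // z Vz.
  have : (S `&` f @^-1` W) z by rewrite E; exists j.
  by case.
- have : (S `&` f @^-1` W) z by [].
  by rewrite E => -[j _ Vz]; exists j.
Qed.

Lemma finite_fibre y : S y -> finite_set (S `&` [set z | f z = y]).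
Proof.
move=> Sy; have [W [oW Wy WS [k [V [t [HV _ E]]]]]] := covering_sheets Sy.
apply: (@sub_finite_set _ _ (\bigcup_(j in [set: 'I_k]) (V j `&` [set z | f z = y]))).
  by move=> z [Sz fz]; have [|j Vz] := E z Sz; [rewrite fz|exists j].
apply: bigcup_finite => [|j _]; first exact: finite_finset.
have [t0 [oV [_ /conformal_to_power_charts[chV [invV [chW [invW [[h1 _] _ HE]]]]]]]] := HV j.
apply: (@sub_finite_set _ _ (invV @` [set z | z ^+ t j = chW y])).
  move=> z [Vz fz]; exists (chV z); last by have [_ _] := h1 z Vz.
  by rewrite /=; have [_ <-] := HE z Vz; rewrite fz.
by apply: finite_image; exact: finite_roots.
Qed.

(** Each sheet over a small disk has at most one critical point, its center. *)
Lemma finite_critical_near y : S y -> exists W, [/\ open W, W y &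
  finite_set [set c | critical_point S f c /\ W (f c)]].
Proof.
move=> Sy; have [W [oW Wy WS [k [V [t [HV _ E]]]]]] := covering_sheets Sy.
exists W; split=> //.
apply: (@sub_finite_set _ _ (\bigcup_(j in [set: 'I_k]) (V j `&` [set c | critical_point S f c]))).
  by move=> z [[Sz fz] Wz]; have [j Vz] := E z Sz Wz; exists j.
apply: bigcup_finite => [|j _]; first exact: finite_finset.
have [t0 [oV [VS /(conformal_to_power_local t0 oV oW)
  [chV [invV [chW [invW [[[h1 _] _ _] Hc _]]]]]]]] := HV j.
apply: (@sub_finite_set _ _ [set invV 0]); last exact: finite_set1.
move=> z [Vz /critical_pointP[Sz dz]] /=.
have [_ <-] := (Hc z Vz (covering_holomorphic Sz)).1 dz.
by have [_ _ ->] := h1 z Vz.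
Qed.

(** If infinitely many critical points were mapped into K, their images would
    accumulate, with infinite multiplicity, at some point of K, against
    finite_critical_near. The accumulation is expressed by the filter of sets that
    contain the images of all but finitely many of these points. *)
Lemma finite_critical_over (K : set S2) : compact K -> K `<=` S ->
  finite_set [set c | critical_point S f c /\ K (f c)].
Proof.
move=> cK KS; apply: contrapT => nE; set E := [set c | _] in nE.
pose F : set_system S2 := [set A | finite_set (E `&` [set c | ~ A (f c)])].
have PF : ProperFilter F.
  split; first by move=> F0; apply: nE; apply: sub_finite_set F0 => c Ec; split.
  split.
  - by apply: (@sub_finite_set _ _ set0) => [c [_ []]|] //; exact: finite_set0.
  - move=> A1 A2 F1 F2.
    have : finite_set ((E `&` [set c | ~ A1 (f c)]) `|` (E `&` [set c | ~ A2 (f c)])).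
      by rewrite finite_setU.
    apply: sub_finite_set => c [Ec nA]; have [A1c|nA1] := pselect (A1 (f c)); [right|by left].
    by split=> // A2c; apply: nA.
  - by move=> A1 A2 A12; apply: sub_finite_set => c [Ec nA]; split=> // /A12.
have FK : F K.
  by apply: (@sub_finite_set _ _ set0) => [c [[_ Kc] []]|] //; exact: finite_set0.
have [y [Ky cl]] := cK F PF FK.
have [W [oW Wy FW]] := finite_critical_near (KS y Ky).
have FnW : F (~` W).
  by apply: sub_finite_set FW => c [[cc _] /= nn]; split=> //; apply: contrapT.
by have [z [nWz Wz]] := cl _ _ FnW (open_nbhs_nbhs (conj oW Wy)).
Qed.

(** Over a small disk around f p, the points of the sheet through p are close to one
    of the finitely many roots of the coordinate of f p; a connected set through p
    cannot jump from the root p to another one, nor to another sheet. *)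
Lemma small_component p (O : set S2) : S p -> nbhs p O ->
  exists O', [/\ open O', O' (f p) & forall A, connected A -> A p ->
    A `<=` S `&` f @^-1` O' -> A `<=` O].
Proof.
move=> Sp pO; have [W [oW Wp WS [k [V [t [HV tV E]]]]]] := covering_sheets (covering_into Sp).
have [j Vp] := E p Sp Wp.
have [t0 [oV [VS /conformal_to_power_charts[chV [invV [chW [invW [[h1 h2] [g1 g2] HE]]]]]]]] := HV j.
have [cp p1 ip] := h1 p Vp; have [ci _ _] := h2 _ p1.
set a := chV p in p1 ip ci.
have [s Hs] := near_some_root (a ^+ t j) t0.
have [e1 e10 He1] := isolate_in_seq a s.
have /nbhsCP[e2 e20 He2] : \forall w \near a, O (invV w) by apply: ci; rewrite ip.
pose e := Num.min e1 e2.
have e0 : 0 < e by rewrite lt_min e10.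
have ee1 : e <= e1 by rewrite ge_min lexx.
have ee2 : e <= e2 by rewrite ge_min lexx orbT.
pose O' := [set q | W q /\ cabs (chW q - a ^+ t j) < e ^+ t j].
exists O'; split.
- rewrite openE => q [Wq qe]; have [cq _ _] := g1 q Wq.
  have N1 : \forall q' \near q, W q' by exact: open_nbhs_nbhs.
  have cc : {for q, continuous (fun q => cabs (chW q - a ^+ t j))}.
    apply: (@continuous_comp S2 C R (fun q => chW q - a ^+ t j)); last exact: continuous_cabs.
    by apply: contC_sub; [exact: cq|exact: contC_const].
  have N2 : \forall q' \near q, cabs (chW q' - a ^+ t j) < e ^+ t j by exact: (cc _ (lt_nbhsl qe)).
  by apply: filterS2 N1 N2.
- by split=> //; have [_ ->] := HE p Vp; rewrite subrr cabs0 exprn_gt0.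
- move=> A cA Ap AS z Az.
  pose P q := V j q /\ cabs (chV q - a) < e.
  have : P z.
    apply: (connected_locally_constant cA _ Ap Az); last first.
      by split=> //; rewrite subrr cabs0.
    move=> q Aq; have [Sq [Wq qe]] := AS q Aq.
    have [i Vq] := E q Sq Wq.
    have oVi : open (V i) by have [_ []] := HV i.
    have Ni : \forall q' \near q, V i q' by exact: open_nbhs_nbhs.
    have [ij|ij] := eqVneq i j; last first.
      have nV q' : V i q' -> ~ V j q'.
        by move=> Vi Vj; move/eqP: ij; apply; apply: tV => //; exists q'.
      by apply: filterS Ni => q' /nV nq' _; split=> -[] // Vj; case: (nV q Vq).
    rewrite ij in Vq Ni => {i ij oVi}.
    have [cq _ _] := h1 q Vq.
    have cc (b : C) : {for q, continuous (fun q => cabs (chV q - b))}.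
      apply: (@continuous_comp S2 C R (fun q => chV q - b)); last exact: continuous_cabs.
      by apply: contC_sub; [exact: cq|exact: contC_const].
    have [b bs qb] : exists2 b, b \in s & cabs (chV q - b) < e.
      by apply: Hs => //; have [_ <-] := HE q Vq.
    have N2 : \forall q' \near q, cabs (chV q' - b) < e by exact: (cc _ _ (lt_nbhsl qb)).
    have [ba|ba] := eqVneq b a.
      by rewrite ba in qb N2; apply: filterS2 Ni N2 => q' ? ? _; split.
    have far q' : cabs (chV q' - b) < e -> ~ (cabs (chV q' - a) < e).
      move=> h1' h2'; have := He1 b bs ba.
      have := cabsD (b - chV q') (chV q' - a); rewrite addrA subrK (cabsC b).
      by lra.
    by apply: filterS N2 => q' /far nq' _; split=> -[] // _ ?; case: (far q qb).
  move=> [Vz za]; have [_ _ <-] := h1 z Vz; apply: He2.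
  exact: lt_le_trans ee2.
Qed.

(** U is relatively open in the preimage of W, and relatively closed by properness
    of the power map; so a connected subset of the preimage that meets U lies in U. *)
Lemma power_chart_component t U W chU invU chW invW (A : set S2) p :
  (0 < t)%N -> power_charts t f U W chU invU chW invW -> open U ->
  connected A -> A p -> U p -> A `<=` S `&` f @^-1` W -> A `<=` U.
Proof.
move=> t0 H oU cA Ap Up AS z Az.
apply: (connected_locally_constant cA _ Ap Az Up) => q Aq.
have [Uq|nUq] := pselect (U q).
  by have : \forall q' \near q, U q' by [exact: open_nbhs_nbhs]; apply: filterS.
have [Sq Wq] := AS q Aq.
suff : \forall q' \near q, ~ U q' by apply: filterS => q' ? _; split.
apply: contrapT => nN.
have PF : ProperFilter (within U (nbhs q)).
  split; last exact: within_filter.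
  by move=> H0; apply: nN; apply: filterS H0.
have fq : f @ within U (nbhs q) --> f q.
  by apply: cvg_trans (covering_continuous Sq); apply: cvg_app; exact: cvg_within.
have UU : within U (nbhs q) U by apply: withinT; exact: nbhs_filter.
have [z' [Uz' _ cl]] := power_chart_proper t0 H PF UU Wq fq.
suff E : q = z' by apply: nUq; rewrite E.
apply: hausdorff_sphere => X Y qX z'Y; apply: cl => //.
by apply: filterS qX => x Xx _.
Qed.

Section PlaneCoordinate.
Variable D : set C.
Hypothesis hD : centred_domain D.
Hypothesis SD : S = Some @` D.
Let g (z : C) : C := affine (f (Some z)).

Lemma surface_affine z : D z -> S (Some z). Proof. by rewrite SD => Dz; exists z. Qed.

Lemma covering_affine z : D z -> f (Some z) = Some (g z) /\ D (g z).
Proof.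
move=> Dz; have := covering_into (surface_affine Dz); rewrite /g SD => -[w Dw <-].
by [].
Qed.

Lemma covering_affine_continuous z : D z -> {for z, continuous g}.
Proof.
move=> Dz; have [fz _] := covering_affine Dz.
apply: (@continuous_comp C S2 C (fun z => f (Some z)) (@affine R)).
  apply: (@continuous_comp C S2 S2 Some f); first exact: (@continuous_Some R).
  exact: covering_continuous (surface_affine Dz).
by rewrite fz; exact: continuous_affine_coord.
Qed.

Lemma covering_affine_open z (A : set C) : D z -> nbhs z A ->
  exists2 e : R, 0 < e & forall w, cabs (w - g z) < e -> exists2 z', A z' & g z' = w.
Proof.
move=> Dz zA; have [fz Dg] := covering_affine Dz.
have [W [oW Wz WS [k [V [t [HV _ E]]]]]] := covering_sheets (surface_affine Dg).
have [j Vz] : exists j, V j (Some z) by apply: E; [exact: surface_affine|rewrite fz].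
have [t0 [oV [VS /conformal_to_power_charts[chV [invV [chW [invW H]]]]]]] := HV j.
have zA' : nbhs (Some z : S2) (Some @` A).
  move: zA => /nbhsCP[e e0 He].
  have oB : open (Some @` [set w : C | cabs (w - z) < e] : set S2).
    apply: open_image_Some; apply/open_CP => w wz.
    exists (e - cabs (w - z)); first by rewrite subr_gt0.
    move=> u uw; rewrite /=.
    have -> : u - z = (u - w) + (w - z) by rewrite addrA subrK.
    by have := cabsD (u - w) (w - z); lra.
  have N : nbhs (Some z : S2) (Some @` [set w : C | cabs (w - z) < e]).
    by apply: open_nbhs_nbhs; split=> //; exists z; rewrite //= subrr cabs0.
  by apply: filterS N => _ [w /He Aw <-]; exists w.
have [B nB HB] := power_chart_open t0 H oV Vz zA'.
have [_ [hW _] _] := H.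
rewrite fz in nB.
have [cW _ _] := hW _ Wz.
have cc : {for g z, continuous (fun w => chW (Some w))}.
  by apply: (@continuous_comp C S2 C Some chW); [exact: (@continuous_Some R)|exact: cW].
have N1 : \forall w \near g z, B (chW (Some w)) by exact: cc.
have N2 : \forall w \near g z, W (Some w).
  by apply: (@continuous_Some R (g z)); exact: open_nbhs_nbhs.
have /nbhsCP[e e0 He] : \forall w \near g z, B (chW (Some w)) /\ W (Some w).
  by apply: filterS2 N1 N2 => w; split.
exists e => // w /He[Bw Ww].
have [_ w1 iw] := hW _ Ww.
have [q [[z' Az' <-] Vq] fq] := HB _ Bw w1.
by exists z' => //; rewrite /g fq iw.
Qed.

(** An ultrafilter on the preimage of K has images converging to some y in K, and it
    contains one of the finitely many sheets over a disk around y, where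
    power_chart_proper provides the limit. *)
Lemma covering_affine_proper K : compact K -> K `<=` D -> compact (D `&` g @^-1` K).
Proof.
move=> cK KD; rewrite compact_ultra => F UF FDK.
have PF : ProperFilter F by case: UF.
have FK : F (g @^-1` K) by apply: filterS FDK => z [].
have [y [Ky cly]] := cK (g @ F) _ FK.
have near_y (A : set C) : nbhs y A -> F (g @^-1` A).
  move=> yA; have [//|nA] := in_ultra_setVsetC (g @^-1` A) UF.
  by have [u [nAu Au]] := cly (~` A) A nA yA.
have Dy := KD y Ky.
have [W [oW Wy WS [k [V [t [HV _ E]]]]]] := covering_sheets (surface_affine Dy).
have FW : F [set z | D z /\ W (Some (g z))].
  have N : F [set z | W (Some (g z))].
    by apply: (near_y [set w | W (Some w)]); apply: (@continuous_Some R y); exact: open_nbhs_nbhs.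
  by apply: filterS2 FDK N => z [].
have [j Fj] : exists j, F [set z | V j (Some z)].
  apply: contrapT => nj.
  have N : \forall z \near F, forall j, ~ V j (Some z).
    apply: filter_forall => j.
    by have [Fj|//] := in_ultra_setVsetC [set z | V j (Some z)] UF; case: nj; exists j.
  have [z [[Dz Wz] nV]] := filter_ex (filterI FW N).
  have [|j Vj] := E _ (surface_affine Dz); last exact: nV Vj.
  by rewrite (covering_affine Dz).1.
have [t0 [oV [VS /conformal_to_power_charts[chV [invV [chW [invW H]]]]]]] := HV j.
have PSF : ProperFilter (Some @ F : set_system S2) by exact: fmap_proper_filter.
have fy : f @ (Some @ F : set_system S2) --> (Some y : S2).
  move=> A yA.
  have N : F [set z | A (Some (g z))].
    by apply: (near_y [set w | A (Some w)]); exact: (@continuous_Some R y).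
  suff : F [set z | A (f (Some z))] by [].
  by apply: filterS2 FDK N => z [Dz _] Az; rewrite /= (covering_affine Dz).1.
have [p [Vp fp clp]] := power_chart_proper t0 H PSF Fj Wy fy.
have := VS p Vp; rewrite {1}SD => -[z0 Dz0 E0].
have gz0 : g z0 = y by rewrite /g E0 fp.
exists z0; split; first by split=> //=; rewrite gz0.
move=> A zA; have [//|nA] := in_ultra_setVsetC A UF.
have {}zA := nbhs_interior zA.
have oA : nbhs p (Some @` interior A).
  rewrite -E0; apply: open_nbhs_nbhs; split; last by exists z0 => //; exact: nbhs_singleton.
  by apply: open_image_Some; exact: open_interior.
have nA' : (Some @ F : set_system S2) (Some @` (~` A)).
  suff : F [set z | (Some @` (~` A)) (Some z : S2)] by [].
  by apply: filterS nA => z nz; exists z.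
have [_ [[u nu <-] [u' /interior_subset Au' []]]] := clp _ _ nA' oA.
by move=> uu; case: nu; rewrite -uu.
Qed.

Lemma covering_affine_zeros : D 0 -> finite_set (D `&` [set z | g z = 0]).
Proof.
move=> D0; have F := finite_image (@affine R) (finite_fibre (surface_affine D0)).
apply: sub_finite_set F => z [Dz /= gz]; exists (Some z) => //.
by split; [exact: surface_affine|rewrite /= (covering_affine Dz).1 gz].
Qed.

Lemma critical_ramified c : critical_point S f (Some c) -> ramified D g c.
Proof.
move=> /critical_pointP[Sc dc]; have Dc : D c by move: Sc; rewrite SD => -[z Dz [<-]].
split=> //; have [fc Dg] := covering_affine Dc.
have [W [oW Wc WS [k [V [t [HV _ E]]]]]] := covering_sheets (surface_affine Dg).
have [j Vc] : exists j, V j (Some c) by apply: E; rewrite ?fc.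
have [t0 [oV [VS /(conformal_to_power_local t0 oV oW)
  [chV [invV [chW [invW [_ Hc Hexp]]]]]]]] := HV j.
have [t1 ch0] := (Hc _ Vc (covering_holomorphic Sc)).1 dc.
have [a a0 Ha] := Hexp c (g c) Vc fc ch0 (covering_continuous Sc).
by exists (t j), a.
Qed.

(** The critical values lie on finitely many circles around 0, and over the closed
    disk bounded by each circle there are only finitely many critical points. *)
Lemma finite_critical_plane : finite_set [set c | critical_point S f c].
Proof.
have D0 : D 0 by case: hD => -> //=; rewrite cabs0.
have F := finite_ramification_levels hD (fun z Dz => (covering_affine Dz).2)
  covering_affine_continuous covering_affine_open covering_affine_proper (covering_affine_zeros D0).
pose K r : set S2 := Some @` [set z : C | D z /\ cabs z <= r].
have FK r : [set cabs (g c) | c in ramified D g] r ->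
    finite_set [set c | critical_point S f c /\ K r (f c)].
  move=> [c0 [Dc0 _] <-]; have [_ Dg] := covering_affine Dc0.
  have EK : [set z : C | D z /\ cabs z <= cabs (g c0)] = [set z : C | cabs z <= cabs (g c0)].
    apply/seteqP; split=> z; first by case.
    by move=> zc; split=> //; exact: centred_domain_le hD Dg zc.
  apply: finite_critical_over.
    rewrite /K EK; apply: continuous_compact; last exact: compact_disk.
    by apply: continuous_subspaceT; exact: (@continuous_Some R).
  by rewrite SD => _ [z [Dz _] <-]; exists z.
apply: sub_finite_set (bigcup_finite F FK) => c cc.
have [Sc _] := cc; move: Sc; rewrite {1}SD => -[z Dz E]; rewrite -E in cc *.
exists (cabs (g z)); first by exists z => //; exact: critical_ramified.
split=> //; have [-> Dg] := covering_affine Dz; exists (g z) => //.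
Qed.

End PlaneCoordinate.

(** On the sphere this is compactness. The disk and the plane are not compact, and
    there the level argument replaces it. *)
Theorem finite_critical : finite_set [set c | critical_point S f c].
Proof.
case: hS => E.
- apply: (@finite_critical_plane [set z : C | cabs z < 1]); first by left.
  rewrite E; apply/seteqP; split=> q.
    by move=> /unit_diskP[z -> z1]; exists z.
  by move=> [z z1 <-]; apply/unit_diskP; exists z.
- by apply: (@finite_critical_plane setT); [right|rewrite E].
- have := finite_critical_over (@compact_sphere R).
  rewrite E => /(_ (fun _ _ => I)) F; apply: sub_finite_set F => c cc.
  by split.
Qed.

End BranchedCovering.

(** * Signatures with a maximal element *)

Section Signature.

Lemma eventually_finite (T : eqType) (C : set T) (P : T -> nat -> Prop) :
  finite_set C -> (forall c, C c -> exists N, forall n, (N <= n)%N -> P c n) ->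
  exists N, forall n, (N <= n)%N -> forall c, C c -> P c n.
Proof.
move=> /finite_seqP[s ->]; elim: s => [|c s IH] H; first by exists 0%N.
have [|N HN] := IH; first by move=> c' c's; apply: H; rewrite /= in_cons (c's : _ \in _) orbT.
have [|M HM] := H c; first by rewrite /= mem_head.
exists (maxn M N) => n; rewrite geq_max => /andP[Mn Nn] c' /=.
by rewrite in_cons => /orP[/eqP ->|]; [exact: HM|exact: HN].
Qed.

Lemma finite_nat_bound (A : set nat) : finite_set A ->
  exists N, forall n, A n -> (n < N)%N.
Proof.
move=> F; have [n _|N HN] := eventually_finite (P := fun n m => (n < m)%N) F; first by exists n.+1.
by exists N; exact: HN.
Qed.

Lemma germ_le_of s t :
  germ_le (germ_of t) (germ_of s) <-> finite_set [set n | t n /\ ~~ s n].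
Proof.
rewrite /germ_le germ_joinE; split.
  move=> /eqquotP /asboolP F; apply: sub_finite_set F => n /= [tn sn].
  by rewrite tn orbT => E; rewrite -E in sn.
move=> F; apply/eqquotP/asboolP; apply: sub_finite_set F => n /=.
by case: (s n); case: (t n).
Qed.

Lemma germ_ofK (a : germ) : exists s, a = germ_of s.
Proof. by exists (repr a); rewrite /germ_of reprK. Qed.

Lemma increasing_avoid (P : nat -> nat -> Prop) :
  (forall k m, exists2 n, (m < n)%N & P k n) ->
  exists u : nat -> nat, (forall k, (u k < u k.+1)%N) /\ forall k, P k (u k).
Proof.
move=> H.
have H' (km : nat * nat) : exists n, (km.2 < n)%N /\ P km.1 n.
  by have [n] := H km.1 km.2; exists n.
have [g Hg] := choice H'.
pose u := fix u k := if k is k'.+1 then g (k, u k') else g (0%N, 0%N).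
exists u; split=> [k|[|k]]; first by have [] := Hg (k.+1, u k).
  by have [] := Hg (0%N, 0%N).
by have [] := Hg (k.+1, u k).
Qed.

(** Were no s j almost contained in a, choose increasing numbers n_k in s k but not
    in a. The set of all n_k is almost contained in every s j, hence almost contained in
    a by hypothesis; but it is infinite and disjoint from a. *)
Lemma diagonal_bound (s : nat -> nat -> bool) (a : nat -> bool) :
  (forall j n, s j.+1 n -> s j n) ->
  (forall b : nat -> bool, (forall j, finite_set [set n | b n /\ ~~ s j n]) ->
     finite_set [set n | b n /\ ~~ a n]) ->
  exists j, finite_set [set n | s j n /\ ~~ a n].
Proof.
move=> dec amax; apply: contrapT => nE.
have decr j k n : (j <= k)%N -> s k n -> s j n.
  elim: k => [|k IH]; first by rewrite leqn0 => /eqP ->.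
  by rewrite leq_eqVlt => /orP[/eqP -> //|jk /dec]; exact: IH.
have inf k m : exists2 n, (m < n)%N & s k n /\ ~~ a n.
  apply: contrapT => nn; apply: nE; exists k.
  apply: sub_finite_set (finite_II m.+1) => n Hn /=.
  by rewrite ltnS leqNgt; apply/negP => mn; apply: nn; exists n.
have [u [u_inc Hu]] := increasing_avoid inf.
have u_ge k : (k <= u k)%N.
  by elim: k => // k IH; apply: leq_ltn_trans IH (u_inc k).
have u_le k m : (k <= m)%N -> (u k <= u m)%N.
  elim: m => [|m IH]; first by rewrite leqn0 => /eqP ->.
  rewrite leq_eqVlt => /orP[/eqP -> //|km]; apply: leq_trans (IH km) _; exact: ltnW.
pose b n := `[< exists k, u k = n >].
have bs j : finite_set [set n | b n /\ ~~ s j n].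
  apply: sub_finite_set (finite_II (u j)) => n [/asboolP[k <-] ns] /=.
  rewrite ltnNge; apply/negP => jk; move: ns.
  have [kj|kj] := leqP j k; first by rewrite (decr _ _ _ kj) //; have [] := Hu k.
  have := u_le _ _ (ltnW kj) => kj'.
  have E : u k = u j by apply/eqP; rewrite eqn_leq kj' jk.
  by rewrite E; have [->] := Hu j.
have := amax b bs.
have [M HM] := finite_nat_bound (amax b bs).
suff /HM : [set n | b n /\ ~~ a n] (u M) by rewrite ltnNge u_ge.
by split; [apply/asboolP; exists M|have [] := Hu M].
Qed.

(** The maximal element a is almost contained in every index sequence, and by
    diagonal_bound it almost contains one of them; from that one on all of them agree
    up to finitely many levels. *)
Lemma has_maximal_elementP (R : realType) (B : nat -> nat -> set (sphere R)) c :
  (forall j n, B j.+1 n `<=` B j n) -> has_maximal_element (sign B c) ->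
  exists J, forall k, exists N, forall n, (N <= n)%N -> B J n c -> B k n c.
Proof.
move=> dec [m Em]; have [a ma] := germ_ofK m; rewrite {m}ma in Em.
pose s j n := `[< B j n c >].
have signP b : sign B c (germ_of b) <-> forall j, finite_set [set n | b n /\ ~~ s j n].
  by split=> H j; [apply/germ_le_of; exact: H|move=> _; apply/germ_le_of; exact: H].
have as_ j : finite_set [set n | a n /\ ~~ s j n].
  apply: (signP a).1; rewrite Em; apply/germ_le_of.
  by apply: sub_finite_set (finite_set0 nat) => n /= -[an]; rewrite an.
have [J FJ] : exists J, finite_set [set n | s J n /\ ~~ a n].
  apply: diagonal_bound => [j n /asboolP/dec/asboolP //|b Hb].
  by apply/germ_le_of; move/signP: Hb; rewrite Em.
exists J => k; have F : finite_set ([set n | s J n /\ ~~ a n] `|` [set n | a n /\ ~~ s k n]).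
  by rewrite finite_setU.
have [N HN] := finite_nat_bound F.
exists N => n Nn BJ; apply/asboolP; apply: contrapT => nk.
move: Nn; rewrite leqNgt => /negP; apply; apply: HN.
have [an|nan] := boolP (a n); [right|left]; split=> //; last by apply/asboolP.
exact/negP.
Qed.

End Signature.

(** * Lifting paths to the inverse limit *)

Section Charts.
Variable R : realType.
Local Notation C := (cplx R).
Local Notation S2 := (sphere R).

Lemma path_in_image (T : topologicalType) (A : set C) (B : set T) (h : C -> T) z w :
  (forall u, A u -> B (h u) /\ {for u, continuous h}) ->
  path_in R A z w -> path_in R B (h z) (h w).
Proof.
move=> H [g [cg g0 g1 gA]]; exists (h \o g); split.
- by move=> t; apply: (@continuous_comp R C T g h); [exact: cg|exact: (H _ (gA t)).2].
- by rewrite /= g0.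
- by rewrite /= g1.
- by move=> t; exact: (H _ (gA t)).1.
Qed.

Lemma disk_chart_path (U : set S2) ch inv p q :
  disk_chart U ch inv -> U p -> U q -> path_in R U p q.
Proof.
move=> [h1 h2] Up Uq; have [_ p1 ip] := h1 p Up; have [_ q1 iq] := h1 q Uq.
rewrite -ip -iq; apply: (path_in_image (A := [set z : C | cabs z < 1])).
  by move=> u /h2[].
by apply: path_in_segment => t t01 /=; exact: cabs_convex.
Qed.

Lemma disk_chart_path_minus (U : set S2) ch inv p q v :
  disk_chart U ch inv -> U p -> U q -> U v -> p <> v -> q <> v ->
  path_in R (U `\ v) p q.
Proof.
move=> [h1 h2] Up Uq Uv pv qv; have [_ p1 ip] := h1 p Up.
have [_ q1 iq] := h1 q Uq; have [_ v1 iv] := h1 v Uv.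
rewrite -ip -iq; apply: (path_in_image (A := [set z : C | cabs z < 1 /\ z <> ch v])).
  move=> u [u1 uv]; have [cu Uu iu] := h2 u u1.
  by split=> //; split=> //= E; apply: uv; rewrite -iu E.
apply: path_in_disk_minus_point => // E.
  by apply: pv; rewrite -ip E.
by apply: qv; rewrite -iq E.
Qed.

(** In the charts, a lift of a path is an n-th root of it; the lift exists even when
    the path runs through the branch point. *)
Lemma power_chart_lift t f (U W : set S2) chU invU chW invW (alpha : R -> S2) y :
  (0 < t)%N -> power_charts t f U W chU invU chW invW -> continuous alpha ->
  (forall s, W (alpha s)) -> U y -> f y = alpha 0 ->
  exists beta : R -> S2, [/\ continuous beta, beta 0 = y &
    forall s, U (beta s) /\ f (beta s) = alpha s].
Proof.
move=> t0 [[hU1 hU2] [hW1 hW2] E] ca Wa Uy fy.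
have cb : continuous (chW \o alpha).
  move=> s; apply: (@continuous_comp R S2 C alpha chW); first exact: ca.
  by have [] := hW1 _ (Wa s).
have [_ y1 iy] := hU1 y Uy.
have b0 : chU y ^+ t = (chW \o alpha) 0 by rewrite /= -fy; have [_ ->] := E y Uy.
have [r [cr r0 Hr]] := path_root_exists cb t0 b0.
have r1 s : cabs (r s) < 1.
  have [_ + _] := hW1 _ (Wa s).
  have := Hr s; rewrite /= => <-; rewrite cabsX.
  by rewrite expr_lt1 ?cabs_ge0.
exists (invU \o r); split.
- move=> s; apply: (@continuous_comp R C S2 r invU); first exact: cr.
  by have [] := hU2 _ (r1 s).
- by rewrite /= r0.
- move=> s; have [_ Us cs] := hU2 _ (r1 s); split=> //=.
  have [Ws Es] := E _ Us.
  have [_ _ <-] := hW1 _ Ws; have [_ _ <-] := hW1 _ (Wa s).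
  by rewrite Es cs Hr.
Qed.

End Charts.

Section InverseLimit.
Variable R : realType.
Local Notation C := (cplx R).
Local Notation S2 := (sphere R).
Variables (S : set S2) (d : nat) (f : S2 -> S2).
Hypothesis hf : branched_covering S d f.
Local Notation coord := Defs.coord.
Local Notation pil := (plaque_inverse_limit S f).

Lemma coord_in (y : pil) i : S (coord y i).
Proof. by have [] := svalP y i. Qed.

Lemma coord_step (y : pil) i : f (coord y i.+1) = coord y i.
Proof. by have [] := svalP y i. Qed.

Lemma coord_iter (y : pil) m k : iter k f (coord y (m + k)) = coord y m.
Proof.
elim: k => [|k IH]; first by rewrite addn0.
by rewrite addnS iterSr coord_step.
Qed.

Lemma pil_ext (y z : pil) : (forall i, coord y i = coord z i) -> y = z.
Proof.
case: y z => y Py [z Pz] H; have E : y = z by apply: funext => i; exact: H.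
by subst z; congr exist; exact: Prop_irrelevance.
Qed.

(** Continuity of the coordinates: pull a small neighborhood back down to the first
    level by small_component, one step at a time. *)
Lemma pullback_coord_nbhs n (y : pil) (O : set S2) : nbhs (coord y n) O ->
  exists U1, [/\ open U1, U1 (coord y 0) & pullback y U1 n `<=` O].
Proof.
elim: n O => [|n IH] O nO.
  exists (interior O); split; [exact: open_interior|exact: nO|exact: interior_subset].
have [Q [oQ Qy HQ]] := small_component hf (coord_in y n.+1) nO.
rewrite coord_step in Qy.
have [|U1 [oU U1y HU]] := IH Q; first exact: open_nbhs_nbhs.
exists U1; split=> // z [A [Ay AS cA] Az]; apply: (HQ A cA Ay) => // q /AS[Sq /HU Qq].
by split.
Qed.

Lemma coord_avoid_nbhs n (x v : pil) : coord x n <> coord v n ->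
  nbhs x [set y : pil | coord y n <> coord v n].
Proof.
move=> xv.
have oO : open ([set q : S2 | q <> coord v n]).
  have /closed_openC : closed [set coord v n] by apply: accessible_closed_set1; apply: hausdorff_accessible; exact: hausdorff_sphere.
  by rewrite (_ : ~` _ = [set q : S2 | q <> coord v n]).
suff oA : pil_open [set y : pil | coord y n <> coord v n].
  by apply: open_nbhs_nbhs; split; [exact: oA|exact: xv].
move=> y yv; have [|U1 [oU U1y HU]] := @pullback_coord_nbhs n y [set q | q <> coord v n].
  exact: open_nbhs_nbhs.
by exists U1; split=> // z Hz; apply: HU; exact: Hz.
Qed.

(** The image of a small interval under the coordinate i + 1 is connected, and lies
    over the image under the coordinate i; so it stays in the component that defines
    the pull-back. *)
Lemma continuous_into_pil (g : R -> pil) :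
  (forall i, continuous (fun t => coord (g t) i)) -> continuous g.
Proof.
move=> cg t A; rewrite nbhsE => -[G [oG Gt] GA].
have {}oG : pil_open G by exact: oG.
have [U1 [oU U1t HU]] := oG _ Gt.
have /nbhs_ballP[e /= e0 He] : \forall s \near t, U1 (coord (g s) 0).
  by apply: cg; exact: open_nbhs_nbhs.
apply/nbhs_ballP; exists e => // s ts; apply: GA; apply: HU => i.
elim: i s ts => [|i IH] s ts; first exact: He.
exists ((fun t => coord (g t) i.+1) @` ball t e); last by exists s.
split.
- by exists t => //; exact: ballxx.
- move=> _ [u tu <-]; split; first exact: coord_in.
  by rewrite /= coord_step; exact: IH.
- apply: connected_continuous_connected; last by apply: continuous_subspaceT; exact: cg.
  apply/connected_intervalP => a b; rewrite /ball /= !ltr_norml => /andP[a1 a2] /andP[b1 b2] c /andP[ac cb].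
  by rewrite ltr_norml; apply/andP; split; lra.
Qed.

Lemma plaque_charts V n : plaque S f d V -> exists t chV invV chW invW,
  [/\ (0 < t)%N, open (V n.+1), V n.+1 `<=` S &
    power_charts t f (V n.+1) (V n) chV invV chW invW].
Proof.
move=> pV; have [_ _ _ _ [t /andP[t0 _]]] := pV n; have [oV VS _ _ _] := pV n.+1.
move=> /conformal_to_power_charts[chV [invV [chW [invW H]]]].
by exists t, chV, invV, chW, invW.
Qed.

Lemma plaque_chart V n : plaque S f d V -> exists ch inv, disk_chart (V n) ch inv.
Proof.
move=> /(plaque_charts n)[t [chV [invV [chW [invW [_ _ _ [_ H _]]]]]]].
by exists chW, invW.
Qed.

Lemma plaque_sub V n : plaque S f d V -> V n `<=` S.
Proof. by move=> /(_ n)[]. Qed.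

Lemma plaque_open V n : plaque S f d V -> open (V n).
Proof. by move=> /(_ n)[]. Qed.

Lemma plaque_down V n z : plaque S f d V -> V n.+1 z -> V n (f z).
Proof. by move=> /(_ n)[_ _ <- _ _] Vz; exists z. Qed.

Lemma plaque_iter V m k z : plaque S f d V -> V (m + k)%N z -> V m (iter k f z).
Proof.
move=> pV; elim: k z => [|k IH] z; first by rewrite addn0.
by rewrite addnS iterSr => /(plaque_down pV); exact: IH.
Qed.

(** Each level of a plaque is a whole component of the preimage of the level before, so it
    contains the pull-back of its own first level. *)
Lemma plaque_open_levels V (y : pil) : plaque S f d V -> levels V y -> nbhs y (levels V).
Proof.
move=> pV Vy; suff oV : pil_open (levels V : set pil) by apply: open_nbhs_nbhs; split; [exact: oV|exact: Vy].
move=> z Vz; exists (V 0%N); split; [exact: plaque_open|exact: Vz|].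
move=> w Hw i; have : pullback z (V 0%N) i `<=` V i; last by apply; exact: Hw.
elim: i {w Hw} => [//|i IH] w [A [Az AS cA] Aw].
have [t [chV [invV [chW [invW [t0 oV VS H]]]]]] := plaque_charts i pV.
by apply: (power_chart_component hf t0 H oV cA Az (Vz i.+1) _ Aw) => q /AS[Sq /IH].
Qed.

(** Above level n lift the path step by step with power_chart_lift, starting at
    the coordinates of p; below level n apply f. *)
Lemma plaque_path_lift V n (alpha : R -> S2) (p : pil) : plaque S f d V ->
  levels V p -> continuous alpha -> (forall s, V n (alpha s)) -> alpha 0 = coord p n ->
  exists g : R -> pil, [/\ continuous g, g 0 = p &
    forall s, levels V (g s) /\ coord (g s) n = alpha s].
Proof.
move=> pV Vp ca Va a0.
pose good k (b : R -> S2) := [/\ continuous b, b 0 = coord p (n + k) & forall s, V (n + k)%N (b s)].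
have step (kb : nat * (R -> S2)) : exists b', good kb.1 kb.2 ->
    good kb.1.+1 b' /\ forall s, f (b' s) = kb.2 s.
  case: kb => k b /=; have [gb|ngb] := pselect (good k b); last by exists b.
  have [cb b0 Vb] := gb.
  have [t [chV [invV [chW [invW [t0 oV VS H]]]]]] := plaque_charts (n + k) pV.
  have [||b' [cb' b'0 Hb']] := @power_chart_lift _ _ _ _ _ _ _ _ _ b (coord p (n + k).+1) t0 H cb Vb.
  - exact: Vp.
  - by rewrite coord_step.
  exists b' => _; split; last by move=> s; have [] := Hb' s.
  by split; rewrite ?addnS // => s; have [] := Hb' s.
have [h Hh] := choice step.
pose A := fix A k := if k is k'.+1 then h (k', A k') else alpha.
have gA k : good k (A k).
  elim: k => [|k IH]; first by split=> //; rewrite addn0.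
  by have [] := Hh (k, A k) IH.
have fA k s : f (A k.+1 s) = A k s by have [_] := Hh (k, A k) (gA k); apply.
(* Truncated subtraction covers both cases: one of the two differences
   is 0. *)
pose c i s := iter (n - i) f (A (i - n)%N s).
have cV i s : V i (c i s).
  apply: (plaque_iter pV); have [_ _ VA] := gA (i - n)%N.
  have -> : (i + (n - i) = n + (i - n))%N by lia.
  exact: VA.
have cf i s : f (c i.+1 s) = c i s.
  rewrite /c; case: (leqP n i) => ni.
    have -> : (n - i.+1 = 0)%N by lia.
    have -> : (n - i = 0)%N by lia.
    by rewrite subSn //= fA.
  have -> : (i.+1 - n = 0)%N by lia.
  have -> : (i - n = 0)%N by lia.
  by have -> : (n - i = (n - i.+1).+1)%N by lia.
have c0 i : c i 0 = coord p i.
  rewrite /c; have [_ -> _] := gA (i - n)%N.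
  have -> : (n + (i - n) = i + (n - i))%N by lia.
  exact: coord_iter.
have cc i : continuous (c i).
  have [cA _ VA] := gA (i - n)%N.
  have SA s : S (A (i - n)%N s) by exact: (plaque_sub pV (VA s)).
  rewrite /c; elim: (n - i)%N => [//|k IH] s; apply: (@continuous_comp R S2 S2 _ f); first exact: IH.
  apply: (covering_continuous hf); elim: k {IH} => [|k IH] /=; first exact: SA.
  exact: covering_into hf _ IH.
have cP s : forall i, S (c i s) /\ f (c i.+1 s) = c i s.
  by move=> i; split; [exact: (plaque_sub pV (cV i s))|exact: cf].
exists (fun s => exist _ (fun i => c i s) (cP s)); split.
- by apply: continuous_into_pil => i; exact: cc.
- by apply: pil_ext => i; exact: c0.
- move=> s; split; first by move=> i; exact: cV.
  by rewrite /coord /= /c subnn.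
Qed.

End InverseLimit.

(** * Contracting a plaque to its center *)

Section Contraction.
Variable R : realType.
Local Notation C := (cplx R).
Local Notation S2 := (sphere R).
Variables (S : set S2) (d : nat) (f : S2 -> S2).
Hypothesis hf : branched_covering S d f.
Local Notation coord := Defs.coord.
Local Notation pil := (plaque_inverse_limit S f).

Lemma plaque_path_in_lift V n (A : set S2) (p : pil) z : plaque S f d V -> levels V p ->
  A `<=` V n -> path_in R A (coord p n) z -> exists q : pil,
  coord q n = z /\ path_in R (levels V `&` [set y : pil | A (coord y n)]) p q.
Proof.
move=> pV Vp AV [a [ca a0 a1 aA]].
have [g [cg g0 Hg]] := plaque_path_lift hf pV Vp ca (fun s => AV _ (aA s)) a0.
exists (g 1); split; first by rewrite (Hg 1).2.
exists g; split=> // s; split; first exact: (Hg s).1.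
by rewrite /= (Hg s).2.
Qed.

(** Every point of a level is a coordinate of some point of the plaque: join it to the
    coordinate of a known point, and lift the path. *)
Lemma levels_sub V W (x : pil) : plaque S f d V -> plaque S f d W -> levels W x ->
  (levels W : set pil) `<=` levels V -> forall n, W n `<=` V n.
Proof.
move=> pV pW Wx WV n z Wz; have [ch [inv hc]] := plaque_chart n pW.
have [q [<- xq]] := plaque_path_in_lift pW Wx (@subset_refl _ _)
  (disk_chart_path hc (Wx n) Wz).
have [_ [Wq _]] := path_in_ends xq.
exact: WV Wq n.
Qed.

(** If V n.+1 is mapped homeomorphically there is nothing to choose. Otherwise the center c
    of V n.+1 is critical, hence lies in W n.+1. Lift a path inside W n from f y to f c,
    starting at y: it ends over f c, hence at c, the only point there; so y is connected
    to c inside the preimage of W n, and therefore lies in W n.+1. *)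
Lemma plaque_saturated V W n y : plaque S f d V -> plaque S f d W ->
  (forall n, W n `<=` V n) ->
  (forall c, critical_point S f c -> V n.+1 c -> W n.+1 c) ->
  V n.+1 y -> W n (f y) -> W n.+1 y.
Proof.
move=> pV pW WV crit Vy Wfy.
have [oW WS EW _ _] := pW n; have [oW' WS' _ _ _] := pW n.+1.
have [oV VS _ _ [t /andP[t0 _] cV]] := pV n; have [oV' VS' _ _ _] := pV n.+1.
have [chU [invU [chV [invV [H Hc _]]]]] := conformal_to_power_local t0 oV' oV cV.
have [[hU1 hU2] [hV1 hV2] E] := H.
have [_ y1 iy] := hU1 y Vy.
have [t1|t1] := leqP t 1.
  have {t0 t1} t1 : t = 1%N by apply/eqP; rewrite eqn_leq t1.
  move: Wfy; rewrite -{1}EW => -[y' Wy' fy'].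
  have Vy' := WV _ _ Wy'; have [_ _ iy'] := hU1 y' Vy'.
  have [_ Ey] := E y Vy; have [_ Ey'] := E y' Vy'.
  by rewrite -iy -[chU y]expr1 -t1 -Ey -fy' Ey' t1 expr1 iy'.
have c1 : cabs (0 : C) < 1 by rewrite cabs0.
have [_ Vc chc] := hU2 0 c1; set c := invU 0 in Vc chc.
have Wc : W n.+1 c.
  apply: crit => //; apply/critical_pointP; split; first exact: VS'.
  by apply/(Hc c Vc (covering_holomorphic hf (VS' _ Vc))).
have Wfc : W n (f c) := plaque_down pW Wc.
have [ch [inv hc]] := plaque_chart n pW.
have [a [ca a0 a1 aW]] := disk_chart_path hc Wfy Wfc.
have [b [cb b0 Hb]] := power_chart_lift t0 H ca (fun s => WV _ _ (aW s)) Vy (esym a0).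
have b1 : b 1 = c.
  have [Vb fb] := Hb 1; have [_ _ <-] := hU1 _ Vb; congr invU.
  have [_ Eb] := E _ Vb; have [_ Ec] := E _ Vc.
  move: Eb; rewrite fb a1 Ec chc expr0n gtn_eqF //= => /esym/eqP.
  by rewrite expf_eq0 t0 /= => /eqP.
have [s [chW' [invW' [chW [invW [s0 _ _ HW]]]]]] := plaque_charts n pW.
have cA : connected (b @` `[0 : R, 1]%classic).
  apply: connected_continuous_connected; first exact: segment_connected.
  exact: continuous_subspaceT.
apply: (power_chart_component (A := b @` `[0 : R, 1]%classic) hf s0 HW oW' cA _ Wc).
- by exists 1; rewrite // /= in_itv /= ler01 lexx.
- move=> _ [u _ <-]; have [Vb fb] := Hb u; split; first exact: VS'.
  by rewrite /= fb.
- by exists 0; rewrite // /= in_itv /= ler01 lexx.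
Qed.

(** Upwards by plaque_saturated, downwards by f. Membership in W can then be read
    off the end of a lifted path, where only one coordinate is prescribed. *)
Lemma plaque_eventually_saturated V W : plaque S f d V -> plaque S f d W ->
  (forall n, W n `<=` V n) ->
  (exists N, forall n, (N <= n)%N -> forall c, critical_point S f c -> V n c -> W n c) ->
  exists N, forall n (y : pil), (N <= n)%N -> levels V y -> W n (coord y n) -> levels W y.
Proof.
move=> pV pW WV [N HN]; exists N => n y Nn Vy Wy.
have up k : W (n + k)%N (coord y (n + k)).
  elim: k => [|k IH]; first by rewrite addn0.
  rewrite addnS; apply: (plaque_saturated pV pW WV) => [c cc||].
  - by apply: HN => //; lia.
  - exact: Vy.
  - by rewrite coord_step.
move=> m; rewrite -(coord_iter y m n); apply: (plaque_iter pW).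
by rewrite addnC.
Qed.

Lemma path_to_smaller_plaque V W (x : pil) p : plaque S f d V -> plaque S f d W ->
  levels W x -> (forall n, W n `<=` V n) ->
  (exists N, forall n, (N <= n)%N -> forall c, critical_point S f c -> V n c -> W n c) ->
  levels V p -> exists2 q : pil, levels W q & path_in R (levels V) p q.
Proof.
move=> pV pW Wx WV crit Vp.
have [N HN] := plaque_eventually_saturated pV pW WV crit.
have [ch [inv hc]] := plaque_chart N pV.
have [q [qx pq]] := plaque_path_in_lift pV Vp (@subset_refl _ _)
  (disk_chart_path hc (Vp N) (WV _ _ (Wx N))).
have [_ [Vq _]] := path_in_ends pq.
exists q; first by apply: (HN N) => //; rewrite qx.
by apply: path_in_sub pq => y [].
Qed.

(** Two distinct points differ in all coordinates from some level on, so at a high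
    level n the coordinates of p and of x both differ from that of v: the latter because
    v does not belong to W. A path in the disk V n that avoids the coordinate of v lifts to
    a path that avoids v and ends over the coordinate of x, hence in W. *)
Lemma path_avoiding_point V W (x p v : pil) : plaque S f d V -> plaque S f d W ->
  levels W x -> (forall n, W n `<=` V n) ->
  (exists N, forall n, (N <= n)%N -> forall c, critical_point S f c -> V n c -> W n c) ->
  levels V p -> levels V v -> p <> v -> ~ levels W v ->
  exists2 q : pil, levels W q & path_in R (levels V `\ v) p q.
Proof.
move=> pV pW Wx WV crit Vp Vv pv Wv.
have [N HN] := plaque_eventually_saturated pV pW WV crit.
have [m pvm] : exists m, coord p m <> coord v m.
  apply: contrapT => H; apply: pv; apply: pil_ext => i.
  by apply: contrapT => pvi; apply: H; exists i.
pose n := (m + N)%N.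
have pvn : coord p n <> coord v n.
  by move=> E; apply: pvm; rewrite -(coord_iter p m N) E coord_iter.
have Nn : (N <= n)%N by rewrite /n; lia.
have xvn : coord x n <> coord v n.
  by move=> E; apply: Wv; apply: (HN n) => //; rewrite -E.
have [ch [inv hc]] := plaque_chart n pV.
have [q [qx pq]] := plaque_path_in_lift pV Vp (@subDsetl _ _ _)
  (disk_chart_path_minus hc (Vp n) (WV _ _ (Wx n)) (Vv n) pvn xvn).
have [_ [Vq _]] := path_in_ends pq.
exists q; first by apply: (HN n) => //; rewrite qx.
by apply: path_in_sub pq => y [Vy [_ yv]]; split=> //= E; apply: yv; rewrite E.
Qed.

(** Pass from each plaque to the next smaller one, and concatenate the infinitely
    many paths. *)
Lemma path_to_center (x p : pil) (W : nat -> nat -> set S2) :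
  (forall k, plaque S f d (W k)) -> (forall k, levels (W k) x) ->
  (forall k n, W k.+1 n `<=` W k n) ->
  (forall k, exists N, forall n, (N <= n)%N ->
     forall c, critical_point S f c -> W k n c -> W k.+1 n c) ->
  (forall A : set pil, nbhs x A -> exists k, levels (W k) `<=` A) ->
  levels (W 0%N) p -> path_in R (levels (W 0%N)) p x.
Proof.
move=> pW Wx dec crit base Wp.
have H (kp : nat * pil) : exists q : pil, levels (W kp.1) kp.2 ->
    levels (W kp.1.+1) q /\ path_in R (levels (W kp.1)) kp.2 q.
  case: kp => k r /=; have [Wr|nWr] := pselect (levels (W k) r); last by exists r.
  by have [q Wq rq] := path_to_smaller_plaque (pW k) (pW k.+1) (Wx k.+1) (dec k) (crit k) Wr; exists q.
have [h Hh] := choice H.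
pose q := fix q k := if k is k'.+1 then h (k', q k') else p.
have Wq k : levels (W k) (q k).
  by elim: k => [//|k IH]; have [] := Hh (k, q k) IH.
apply: (@path_in_limit R pil (fun k => levels (W k)) q x) => //.
- by move=> k; have [] := Hh (k, q k) (Wq k).
- by move=> k y Wy n; exact: dec (Wy n).
Qed.

End Contraction.

(** * Path-connectedness without one point *)

Theorem theorem28 (R : realType) (S : set (sphere R))
    (hS : simply_connected_model S) (d : nat) (hd : (1 < d)%N)
    (f : sphere R -> sphere R) (hf : branched_covering S d f)
    (x : plaque_inverse_limit S f) (hx : irregular_point d x)
    (B : nat -> nat -> set (sphere R)) (hB : decreasing_local_base d x B)
    (hsign : forall c : sphere R,
      critical_point S f c -> has_maximal_element (sign B c)) :
  exists2 U : nat -> set (sphere R), open_neighborhood d x U &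
    forall V : nat -> set (sphere R), open_neighborhood d x V ->
      (levels V : set (plaque_inverse_limit S f)) `<=` levels U ->
      forall v : plaque_inverse_limit S f, levels V v -> v <> x ->
        path_connected R (levels V `\ v).
Proof.
have [nbB decB baseB] := hB.
have pB j : plaque S f d (B j) by have [] := nbB j.
have Bx j : levels (B j) x by have [] := nbB j.
have dec j n : B j.+1 n `<=` B j n by exact: (levels_sub hf (pB j) (pB j.+1) (Bx j.+1) (@decB j)).
have decr j k n : (j <= k)%N -> B k n `<=` B j n.
  elim: k => [|k IH]; first by rewrite leqn0 => /eqP ->.
  by rewrite leq_eqVlt => /orP[/eqP -> //|/IH jk]; apply: subset_trans (dec k n) jk.
have [J HJ] : exists J, forall j, (J <= j)%N -> forall c, critical_point S f c ->
    forall k, exists N, forall n, (N <= n)%N -> B j n c -> B k n c.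
  apply: (eventually_finite (finite_critical hS hf)) => c cc.
  have [J HJ] := has_maximal_elementP dec (hsign c cc).
  exists J => j Jj k; have [N HN] := HJ k.
  by exists N => n Nn /(decr _ _ _ Jj); exact: HN.
have crit k : exists N, forall n, (N <= n)%N -> forall c, critical_point S f c ->
    B J n c -> B k n c.
  apply: (eventually_finite (finite_critical hS hf)) => c cc.
  exact: HJ (leqnn J) c cc k.
exists (B J) => [|V [pV Vx] VU v Vv vx]; first by split.
have VB := levels_sub hf (pB J) pV Vx VU.
have [m xv] : exists m, Defs.coord x m <> Defs.coord v m.
  apply: contrapT => H; apply: vx; apply: pil_ext => i.
  by apply: contrapT => xvi; apply: H; exists i => /esym.
have [k1 Hk1] := baseB _ (filterI (coord_avoid_nbhs hf xv) (plaque_open_levels hf pV Vx)).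
pose W k := B (maxn J k1 + k)%N.
have pW k : plaque S f d (W k) by exact: pB.
have Wx k : levels (W k) x by exact: Bx.
have W0 (y : plaque_inverse_limit S f) : levels (W 0%N) y -> levels V y /\ Defs.coord y m <> Defs.coord v m.
  move=> Wy; have [|? ?] := Hk1 y; last by split.
  by move=> n; apply: (decr k1 _ n _ _ (Wy n)); lia.
have WV := levels_sub hf pV (pW 0%N) (Wx 0%N) (fun y Wy => (W0 y Wy).1).
have nWv : ~ levels (W 0%N) v by move=> /W0[].
have to_x p : (levels V `\ v) p -> path_in R (levels V `\ v) p x.
  move=> [Vp pv].
  have [|q Wq pq] := path_avoiding_point hf pV (pW 0%N) (Wx 0%N) WV _ Vp Vv pv nWv.
    have [N HN] := crit (maxn J k1 + 0)%N.
    by exists N => n Nn c cc Vc; apply: HN => //; exact: VB.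
  apply: path_in_trans pq _; apply: (@path_in_sub _ _ (levels (W 0%N))).
    by move=> y Wy; split; [exact: (W0 y Wy).1|move=> E; apply: nWv; rewrite -E].
  apply: (path_to_center hf pW Wx _ _ _ Wq).
  - by move=> k n; rewrite /W addnS; exact: dec.
  - move=> k; have [N HN] := crit (maxn J k1 + k.+1)%N.
    by exists N => n Nn c cc Wc; apply: HN => //; apply: (decr J _ n _ _ Wc); lia.
  - move=> A /baseB[k Hk]; exists k => y Wy; apply: Hk => n.
    by apply: (decr k _ n _ _ (Wy n)); lia.
move=> a b Va Vb; have [g [cg g0 g1 gV]] := path_in_trans (to_x a Va) (path_in_sym (to_x b Vb)).
exists g; split; [exact: continuous_subspaceT|exact: g0|exact: g1|].
by move=> t _; exact: gV.
Qed.
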